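(* Let $\omega:[0,+\infty)\to[0,+\infty)$ be a continuous function such that $\omega(\mu)>0$ for every $\mu>0$ and $\int_1^{+\infty}\frac{\omega(\mu)}{\mu^2}\,d\mu=+\infty$. Let $d$ be a positive integer, let $\Omega\subseteq\mathbb{R}^d$ be a connected open set, and let $u:\Omega\to\mathbb{R}$ be a function with bounded variation that is not essentially constant. Then $\mathscr{F}_\omega(u,\Omega)=+\infty$.
   Context: For a measurable $u:\Omega\to\mathbb{R}$, $$\mathscr{F}_\omega(u,\Omega):=\iint_{\Omega\times\Omega}\omega\left(\frac{|u(y)-u(x)|}{|y-x|}\right)\frac{1}{|y-x|^d}\,dx\,dy\in[0,+\infty].$$ A measurable function is essentially constant if it coincides almost everywhere with a constant. ''Bounded variation'' is the standard notion $u\in BV(\Omega)$: $u\in L^1(\Omega)$ and its distributional gradient is a finite $\mathbb{R}^d$-valued Radon measure on $\Omega$. *)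

(* Defs.v *)
From HB Require Import structures.
From mathcomp Require Import all_boot all_order all_algebra.
From mathcomp Require Import all_classical all_reals all_analysis.
From mathcomp Require Import measurable_realfun.

Set Implicit Arguments.
Unset Strict Implicit.
Unset Printing Implicit Defensive.

Import Order.TTheory GRing.Theory Num.Theory.
Import numFieldNormedType.Exports.

Local Open Scope classical_set_scope.
Local Open Scope ring_scope.

Definition borel_rV_display : measure_display.
Proof. by constructor. Qed.

Section borel_rV.
Context (R : realType) (n : nat).

Let borel0 : <<s (@open 'rV[R]_n) >> set0.
Proof. exact: sigma_algebra0. Qed.

Let borelC A : <<s (@open 'rV[R]_n) >> A -> <<s (@open 'rV[R]_n) >> (~` A).
Proof. exact: sigma_algebraC. Qed.

Let borel_bigcup (F : (set 'rV[R]_n)^nat) :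
  (forall i, <<s (@open 'rV[R]_n) >> (F i)) ->
  <<s (@open 'rV[R]_n) >> (\bigcup_i F i).
Proof. exact: sigma_algebra_bigcup. Qed.

HB.instance Definition _ := @isMeasurable.Build borel_rV_display
  'rV[R]_n (<<s (@open 'rV[R]_n) >>) borel0 borelC borel_bigcup.

End borel_rV.

Section measurable_rV.
Context (R : realType).

Lemma open_measurable_rV n (A : set 'rV[R]_n) : open A -> measurable A.
Proof. exact: sub_sigma_algebra. Qed.

Lemma measurable_coord_rV n (i : 'I_n) :
  measurable_fun [set: 'rV[R]_n] (fun v : 'rV[R]_n => v ord0 i : R).
Proof.
apply: (@measurability _ _ _ _ _ _ (@RGenOInfty.G R)).
  exact: RGenOInfty.measurableE.
move=> _ [_ [r ->] <-]; rewrite setTI; apply: open_measurable_rV.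
by apply: open_comp => [v _|]; [exact: coord_continuous|exact: interval_open].
Qed.

Let rat_itv (p : rat * rat) : interval R := `](ratr p.1), (ratr p.2)[.

Let rat_box n (q : {ffun 'I_n -> rat * rat}) : set 'rV[R]_n :=
  [set v | forall i, v ord0 i \in rat_itv (q i)].

Let open_rat_box n (A : set 'rV[R]_n) : open A ->
  A = \bigcup_(q in [set q | rat_box q `<=` A]) rat_box q.
Proof.
move=> oA; apply/seteqP; split=> [v Av|v [q qA qv]]; last exact: qA.
have [e /= e0 veA] : exists2 e : R, 0 < e & ball v e `<=` A.
  by apply/nbhs_ballP; exact: open_nbhs_nbhs.
have qP i : exists q : rat * rat, v ord0 i \in rat_itv q /\
    [set` rat_itv q] `<=` ball (v ord0 i) e.
  have /rat_in_itvoo[q1] : v ord0 i - e < v ord0 i by rewrite ltrBlDr ltrDl.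
  rewrite in_itv/= => /andP[eq1 q1v].
  have /rat_in_itvoo[q2] : v ord0 i < v ord0 i + e by rewrite ltrDl.
  rewrite in_itv/= => /andP[vq2 q2e].
  exists (q1, q2); rewrite /rat_itv in_itv/= q1v vq2; split => // x /=.
  rewrite in_itv/= => /andP[q1x xq2].
  by rewrite -ball_normE/= distrC ltr_distl (lt_trans eq1 q1x) (lt_trans xq2 q2e).
pose q := [ffun i => projT1 (cid (qP i))].
exists q => [w qw|i].
  apply: veA; split => // i j; rewrite (ord1 i).
  by have := qw j; rewrite ffunE; case: (cid (qP j)) => /= p [_]; apply.
by rewrite ffunE; case: (cid (qP i)) => /= p [].
Qed.

Lemma measurable_fun_rV d (T : measurableType d) n (f : T -> 'rV[R]_n) :
  (forall i, measurable_fun [set: T] (fun x => f x ord0 i : R)) ->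
  measurable_fun [set: T] f.
Proof.
move=> mf; apply: (@measurability _ _ _ _ _ _ (@open 'rV[R]_n)) => //.
move=> _ [A oA <-]; rewrite setTI (open_rat_box oA) preimage_bigcup.
rewrite bigcup_mkcond; apply: countable_bigcupT_measurable => // q.
case: ifPn => // _.
rewrite (_ : _ @^-1` _ = \bigcap_(i in [set: 'I_n])
    (fun x => f x ord0 i) @^-1` [set` rat_itv (q i)]).
  apply: fin_bigcap_measurable => // i _.
  by rewrite -[X in measurable X]setTI; apply: mf => //; exact: measurable_itv.
by apply/seteqP; split=> [x fx i _|x fx i]; [exact: fx|exact: (fx i)].
Qed.

End measurable_rV.

Section lebesgue_rV.
Context (R : realType).
Local Notation mu1 := (@lebesgue_measure R).

(* (x, v) |-> (x, v_0, ..., v_(n-1)) *)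
Definition cons_rV n (p : measurableTypeR R * 'rV[R]_n) : 'rV[R]_n.+1 :=
  row_mx (p.1 : R)%:M p.2.

Lemma cons_rV0 n p : @cons_rV n p ord0 ord0 = p.1.
Proof.
have -> : ord0 = lshift n ord0 :> 'I_(1 + n) by exact/val_inj.
by rewrite [LHS]row_mxEl mxE eqxx mulr1n.
Qed.

Lemma cons_rVS n p (i : 'I_n) : cons_rV p ord0 (lift ord0 i) = p.2 ord0 i.
Proof.
have -> : lift ord0 i = rshift 1 i :> 'I_(1 + n) by exact/val_inj.
by rewrite [LHS]row_mxEr.
Qed.

Lemma measurable_cons_rV n : measurable_fun setT (@cons_rV n).
Proof.
apply: measurable_fun_rV => i; case: (unliftP ord0 i) => [j ->|->].
  under eq_fun do rewrite cons_rVS.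
  exact: (measurableT_comp (measurable_coord_rV j)).
under eq_fun do rewrite cons_rV0.
exact: measurable_fst.
Qed.

HB.instance Definition _ n :=
  isMeasurableFun.Build _ _ _ _ (@cons_rV n) (@measurable_cons_rV n).

Definition uncons_rV n (v : 'rV[R]_n.+1) : measurableTypeR R * 'rV[R]_n :=
  (v ord0 ord0, \row_i v ord0 (lift ord0 i)).

Lemma cons_rVK n : cancel (@cons_rV n) (@uncons_rV n).
Proof.
move=> [x v]; rewrite /uncons_rV cons_rV0; congr pair.
by apply/rowP => i; rewrite mxE cons_rVS.
Qed.

Lemma measurable_uncons_rV n : measurable_fun setT (@uncons_rV n).
Proof.
apply: measurable_fun_pair; first exact: measurable_coord_rV.
apply: measurable_fun_rV => i; under eq_fun do rewrite mxE.
exact: measurable_coord_rV.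
Qed.

Section step.
Context n (m : {sigma_finite_measure set 'rV[R]_n -> \bar R}).

Definition lebesgue_step : set 'rV[R]_n.+1 -> \bar R :=
  pushforward (mu1 \x m)%E (@cons_rV n).

Let step0 : lebesgue_step set0 = 0%E.
Proof. exact: measure0. Qed.

Let step_ge0 A : (0 <= lebesgue_step A)%E.
Proof. exact: measure_ge0. Qed.

Let step_sigma_additive : semi_sigma_additive lebesgue_step.
Proof.
exact: (@measure_semi_sigma_additive _ _ _
  (pushforward (mu1 \x m)%E (@cons_rV n))).
Qed.

HB.instance Definition _ := isMeasure.Build _ _ _ lebesgue_step
  step0 step_ge0 step_sigma_additive.

Let sigma_finite_step : sigma_finite setT lebesgue_step.
Proof.
have /sigma_finiteP[F [TF ndF Foo]] := sigma_finiteT mu1.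
have /sigma_finiteP[G [TG ndG Goo]] := sigma_finiteT m.
exists (fun k => @uncons_rV n @^-1` (F k `*` G k)).
  apply/esym; rewrite -subTset => v _.
  have [i _ Fi] : (\bigcup_k F k) (v ord0 ord0) by rewrite -TF.
  have [j _ Gj] : (\bigcup_k G k) (uncons_rV v).2 by rewrite -TG.
  exists (maxn i j) => //; split.
    by move: Fi; exact/subsetPset/ndF/leq_maxl.
  by move: Gj; exact/subsetPset/ndG/leq_maxr.
move=> k; have [mFk Fkoo] := Foo k; have [mGk Gkoo] := Goo k.
have mFG : measurable (F k `*` G k) by exact: measurableX.
split; first by rewrite -[X in measurable X]setTI; exact: measurable_uncons_rV.
rewrite /lebesgue_step /pushforward -comp_preimage (_ : _ \o _ = id).
  by rewrite [X in (X < _)%E]product_measure1E// lte_mul_pinfty// ge0_fin_numE.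
by apply/funext => p; exact: cons_rVK.
Qed.

HB.instance Definition _ := Measure_isSigmaFinite.Build _ _ _
  lebesgue_step sigma_finite_step.

End step.

(* n-fold product of the one-dimensional Lebesgue measure, on the Borel sets
   of R^n; [lebesgue_rV_box] gives its value on products of Borel sets. *)
Fixpoint lebesgue_rV n : {sigma_finite_measure set 'rV[R]_n -> \bar R} :=
  match n with
  | 0 => \d_(0 : 'rV[R]_0)
  | n'.+1 => lebesgue_step (lebesgue_rV n')
  end.

Lemma lebesgue_rV_box n (A : 'I_n -> set R) :
  (forall i, measurable (A i)) ->
  lebesgue_rV n [set v | forall i, A i (v ord0 i)] =
  (\prod_(i < n) mu1 (A i))%E.
Proof.
elim: n A => [|n ih] A mA.
  by rewrite big_ord0 /= diracE mem_set// => -[].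
rewrite big_ord_recl -ih//= /lebesgue_step /pushforward.
rewrite -[RHS]product_measure1E//; [|exact: mA|]; last first.
  rewrite [X in measurable X](_ : _ = \bigcap_(i in [set: 'I_n])
      (fun v : 'rV[R]_n => v ord0 i) @^-1` A (lift ord0 i)).
    apply: fin_bigcap_measurable => // i _.
    by rewrite -[X in measurable X]setTI; exact: measurable_coord_rV.
  by apply/seteqP; split=> [x fx i _|x fx i]; [exact: fx|exact: (fx i)].
congr (_ _); apply/seteqP; split=> [[x v] /= Axv|[x v] /= [Ax Av] i].
  split=> [|i]; first by have := Axv ord0; rewrite cons_rV0.
  by have := Axv (lift ord0 i); rewrite cons_rVS.
by case: (unliftP ord0 i) => [j ->|->]; rewrite ?cons_rVS ?cons_rV0.
Qed.

End lebesgue_rV.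

Arguments lebesgue_rV {R n}.

Section definitions.
Context (R : realType) (d : nat).
Local Notation E := 'rV[R]_d.
Local Notation mu := (@lebesgue_rV R d).

(* The norm of the library on matrices is the sup norm. *)
Definition euclidean_norm (x : E) : R := Num.sqrt (\sum_(i < d) x ord0 i ^+ 2).

(* Measurability with respect to the Lebesgue sigma-algebra, i.e. the
   completion of the Borel one. Library integrals of such functions are still
   the usual Lebesgue integrals: the integral of a nonnegative function is the
   supremum of the integrals of the Borel simple functions below it, and a
   Lebesgue measurable function can be lowered to a Borel one on a null set. *)
Definition lebesgue_measurable_fun (Omega : set E) (u : E -> R) : Prop :=
  forall B : set R, measurable B ->
    completed_algebra_gen mu (Omega `&` u @^-1` B).

Definition L1 (Omega : set E) (u : E -> R) : Prop :=
  lebesgue_measurable_fun Omega u /\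
  (\int[mu]_(x in Omega) `|u x|%:E < +oo)%E.

Definition essentially_constant (Omega : set E) (u : E -> R) : Prop :=
  exists c : R, {ae mu, forall x, Omega x -> u x = c}.

Definition partial (i : 'I_d) (f : E -> R) : E -> R :=
  'D_(delta_mx ord0 i) f.

Definition smooth (f : E -> R) : Prop := forall s : seq 'I_d,
  continuous (foldr partial f s) /\
  forall i x, derivable (foldr partial f s) x (delta_mx ord0 i).

(* C_c^oo(Omega), its elements being extended by zero outside Omega *)
Definition test_function (Omega : set E) (phi : E -> R) : Prop :=
  [/\ smooth phi, compact (closure [set x | phi x != 0]) &
      closure [set x | phi x != 0] `<=` Omega].

(* Integral against a finite signed measure, through its Jordan decomposition;
   the latter does not depend on the choice of the Hahn decomposition. *)
Definition charge_integral (nu : {charge set E -> \bar R}) (D : set E)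
    (f : E -> \bar R) : \bar R :=
  let: exist P exN := cid (Hahn_decomposition nu) in
  let: exist N PN := cid exN in
  (\int[jordan_pos PN]_(x in D) f x - \int[jordan_neg PN]_(x in D) f x)%E.

(* Du = (Du_1, ..., Du_d) is a finite R^d-valued Borel (hence Radon) measure;
   charges are finite, and only the restriction of Du to Omega matters. *)
Definition distributional_gradient (Omega : set E) (u : E -> R)
    (Du : 'I_d -> {charge set E -> \bar R}) : Prop :=
  forall (i : 'I_d) (phi : E -> R), test_function Omega phi ->
    (\int[mu]_(x in Omega) (u x * partial i phi x)%:E =
     - charge_integral (Du i) Omega (EFin \o phi))%E.

Definition BV (Omega : set E) (u : E -> R) : Prop :=
  L1 Omega u /\
  exists Du : 'I_d -> {charge set E -> \bar R},
    distributional_gradient Omega u Du.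

(* On the diagonal, a null set when d > 0, division by zero yields 0. *)
Definition F_functional (omega : R -> R) (u : E -> R) (Omega : set E) : \bar R :=
  (\int[mu \x mu]_(p in Omega `*` Omega)
    (omega (`|u p.2 - u p.1| / euclidean_norm (p.2 - p.1))
      / euclidean_norm (p.2 - p.1) ^+ d)%:E)%E.

End definitions.

(* Main.v *)
From HB Require Import structures.
From mathcomp Require Import all_boot all_order all_algebra.
From mathcomp Require Import all_classical all_reals all_analysis.
From mathcomp Require Import measurable_realfun.
From mathcomp Require Import ring lra.
Require Import Defs.

(** Suppose that the functional is finite. As [Omega] is connected, [u] is not
essentially constant on some small cube ([nonconstant_on_some_cube]); there it is
replaced by a Borel function [v] that coincides with it almost everywhere. Since
[v] is not constant, there is a scale [rho] such that the rise of [v] from [x] to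
[x + z], capped at [1], has a positive integral [c] over the pairs of points with
[rho <= |z| < 2 rho] ([nonconstant_rise]).

Cut such a step into [n] equal ones and fix a slope [s] with [1 <= s rho]. Let
[f i] be the value of [v] at the [i]-th point minus the value at that point of
the line of slope [s], and consider the intervals of length [s |z| / n] that end
at the [f i]. Their total length is [s |z|], but they are confined to an interval
that is shorter by the rise of [v], up to the length of one of them, unless some
step from the first point or to the last one is steeper than [s]. Hence the
rise, when it is not due to such steep steps, is at most the total overlap of
the intervals ([chain_overlaps]). The intervals with indices [i < j] overlap only
if the slope [y] of [v] between these two points satisfies
[|y - s| < s / (j - i)]. A chain that rises thus contains, for every slope [s],
pairs of points between which [v] has almost this slope.

Integrated over all the pairs [(x, x + z)], this bounds [c] by three kinds of
averages over steps [(k / n) z] ([chain_average]).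
- Steep steps: as [u] has bounded variation, the integral of [|v (x + z) - v x|]
  is at most [C |z|] ([bv_increments]), and the steep steps contribute little when
  [s] is large ([sum_average_steep]).
- Pairs with [k < K]: their steps become short when [n] tends to infinity, and a
  nonzero moderate slope over a short step costs energy, that is, a part of the
  functional close to the diagonal ([average_slope_small]).
- Pairs with [k >= K]: for a pair of slope [y], the slopes [s] with
  [|y - s| < s / k] form an interval of length about [2 y / k], on which
  [omega s <= 2 omega y] if [K] is large. Therefore the integral over [s] of this
  contribution, with the weight [omega s / s ^+ 2], is bounded by a multiple of
  the functional, uniformly in [n] ([sum_average_tangent]).

The first two contributions being at most [c / 2], the integral of
[omega s / s ^+ 2] over any segment [[s0, S]] is at most a constant that does not
depend on [S] ([slope_weight_bounded]), which contradicts the divergence of the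
integral. *)

Set Implicit Arguments.
Unset Strict Implicit.
Unset Printing Implicit Defensive.

Import Order.TTheory GRing.Theory Num.Theory.
Import numFieldNormedType.Exports.

Local Open Scope classical_set_scope.
Local Open Scope ring_scope.

(** * Affine changes of variables *)

Section affine.
Context (R : realType).
Local Notation mu1 := (@lebesgue_measure R).

(** The measure [t mu(g^-1 A)], with [g x = t x + z], gives each interval its
length, hence is the Lebesgue measure. *)
Lemma ge0_integral_affine1 (t z : R) (f : R -> \bar R) : 0 < t ->
  measurable_fun setT f -> (forall x, (0 <= f x)%E) ->
  (\int[mu1]_x f (t * x + z)%R = (t^-1)%:E * \int[mu1]_x f x)%E.
Proof.
move=> t0 mf f0.
pose g : measurableTypeR R -> measurableTypeR R := fun x => t * x + z.
have mg : measurable_fun setT g.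
  by apply: measurable_funD => //; exact: measurable_funM.
have t0' : 0 <= t by exact: ltW.
pose pm : {measure set (measurableTypeR R) -> \bar R} :=
  measure_function_pushforward__canonical__measure_function_Measure mu1 mg.
pose m := mscale (NngNum t0') pm.
have E : forall A, measurable A -> mu1 A = m A.
  apply: lebesgue_measure_unique => X [[a b]] /= _ <-.
  rewrite /m /mscale/= /pushforward.
  rewrite (_ : _ @^-1` _ = `](a - z) / t, (b - z) / t]%classic); last first.
    apply/seteqP; split=> x /=; rewrite !in_itv/= /g.
      by rewrite ltr_pdivrMr// ler_pdivlMr// ltrBlDr lerBrDr mulrC.
    by rewrite ltr_pdivrMr// ler_pdivlMr// ltrBlDr lerBrDr mulrC.
  rewrite !lebesgue_measure_itv/= !lte_fin ltr_pM2r ?invr_gt0// ltrD2r.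
  case: ifPn => _; last by rewrite mule0.
  rewrite -!EFinD -EFinM; congr EFin.
  by field; rewrite gt_eqF.
rewrite [in RHS](eq_measure_integral m); last by move=> A mA _; exact: E.
rewrite (ge0_integral_mscale pm measurableT)//=.
rewrite ge0_integral_pushforward// muleA -EFinM mulVf ?gt_eqF// mul1e.
by rewrite preimage_setT.
Qed.

Lemma ge0_integral_lebesgue_rVS n (f : 'rV[R]_n.+1 -> \bar R) :
  measurable_fun setT f -> (forall x, (0 <= f x)%E) ->
  (\int[lebesgue_rV]_x f x =
   \int[mu1]_a \int[@lebesgue_rV R n]_v f (cons_rV (a, v)))%E.
Proof.
move=> mf f0.
pose pm : {measure set 'rV[R]_n.+1 -> \bar R} :=
  measure_function_pushforward__canonical__measure_function_Measure
    (mu1 \x @lebesgue_rV R n)%E (@measurable_cons_rV R n).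
rewrite (eq_measure_integral pm) => [|A mA _ //].
rewrite (ge0_integral_pushforward (@measurable_cons_rV R n))//.
rewrite preimage_setT fubini_tonelli1//; last by move=> p; exact: f0.
by apply: (measurableT_comp mf); exact: measurable_cons_rV.
Qed.

Lemma measurable_affine_rV n (t : R) (z : 'rV[R]_n) :
  measurable_fun setT (fun x : 'rV[R]_n => t *: x + z).
Proof.
apply: measurable_fun_rV => i; under eq_fun do rewrite !mxE.
apply: measurable_funD => //; apply: measurable_funM => //.
exact: measurable_coord_rV.
Qed.

(** Tonelli's theorem reduces the formula to one coordinate at a time. *)
Lemma ge0_integral_affine_rV n (t : R) (z : 'rV[R]_n) (f : 'rV[R]_n -> \bar R) :
  0 < t -> measurable_fun setT f -> (forall x, (0 <= f x)%E) ->
  (\int[lebesgue_rV]_x f (t *: x + z)%R =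
   (t ^- n)%:E * \int[lebesgue_rV]_x f x)%E.
Proof.
move=> t0; elim: n z f => [|n ih] z f mf f0.
  rewrite expr0 invr1 mul1e; apply: eq_integral => x _.
  by congr f; apply/rowP => -[].
have t1 : 0 <= t ^- n by rewrite invr_ge0 exprn_ge0// ltW.
have mfc : measurable_fun setT (f \o @cons_rV R n).
  by apply: (measurableT_comp mf); exact: measurable_cons_rV.
rewrite ge0_integral_lebesgue_rVS//; last first.
  by apply: (measurableT_comp mf); exact: measurable_affine_rV.
transitivity (\int[mu1]_a ((t ^- n)%:E * \int[@lebesgue_rV R n]_v
    f (cons_rV ((t * a + z ord0 ord0)%R : measurableTypeR R, v)))%E)%E.
  apply: eq_integral => a _.
  rewrite -(ih (\row_i z ord0 (lift ord0 i)))//; last first.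
    apply: (measurableT_comp mfc) => //.
  apply: eq_integral => v _; congr f; apply/rowP => i.
  rewrite [LHS]mxE [X in X + _]mxE.
  case: (unliftP ord0 i) => [j ->|->]; last by rewrite !cons_rV0; reflexivity.
  by rewrite !cons_rVS/= !mxE; reflexivity.
pose F a := (\int[@lebesgue_rV R n]_v f (cons_rV (a : measurableTypeR R, v)))%E.
have F0 a : (0 <= F a)%E by exact: integral_ge0.
have mF : measurable_fun setT F.
  exact: (measurable_fun_fubini_tonelli_F (f \o @cons_rV R n) mfc (fun p => f0 _)).
have mFt : measurable_fun setT (fun a : R => F (t * a + z ord0 ord0)%R).
  apply: (measurableT_comp mF); apply: measurable_funD => //.
rewrite ge0_integralZl//; last by move=> a _; exact: (F0 (t * a + z ord0 ord0)).
rewrite (ge0_integral_affine1 _ t0 mF F0) -ge0_integral_lebesgue_rVS//.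
by rewrite muleA -EFinM -invfM -exprSr.
Qed.

End affine.

(** * Null sets and Borel representatives *)

Section equal_off_null.
Context d (T : measurableType d) (R : realType).
Variable mu : {measure set T -> \bar R}.

Import HBNNSimple.

(** The functions are arbitrary: the integral of a nonnegative function is the
supremum of the integrals of the simple functions below it, and a simple
function can be set to [0] on a null set without changing its integral. *)
Lemma le_integral_off_null (D N : set T) (f g : T -> \bar R) :
  measurable N -> mu N = 0%E ->
  (forall x, D x -> (0 <= f x)%E) -> (forall x, D x -> (0 <= g x)%E) ->
  (forall x, D x -> ~ N x -> (f x <= g x)%E) ->
  (\int[mu]_(x in D) f x <= \int[mu]_(x in D) g x)%E.
Proof.
move=> mN N0 f0 g0 fg; rewrite !ge0_integralE//.
apply: ge_ereal_sup => _ [h /= hf <-].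
apply: ereal_sup_ubound => /=.
have mNC : measurable (~` N) by exact: measurableC.
pose h' := mul_nnsfun h (indic_nnsfun R mNC).
have h'E x : h' x = h x * \1_(~` N) x by [].
exists h' => [x|].
  have := hf x; rewrite h'E indicE /patch; case: ifPn => [|xD hx0].
    rewrite inE => xD hfx; case: (pselect (N x)) => Nx.
      by rewrite memNset ?mulr0 ?g0//= => /(_ Nx).
    by rewrite mem_set// mulr1 (le_trans hfx)// fg.
  have -> : (h x = 0 :> R).
    by apply/eqP; rewrite eq_le -lee_fin hx0/=; exact: fun_ge0.
  by rewrite mul0r.
rewrite -!integralT_nnsfun; apply: ge0_ae_eq_integral => //.
- by apply/measurable_EFinP; exact: measurable_funP.
- by apply/measurable_EFinP; exact: measurable_funP.
- by move=> x _; rewrite lee_fin; exact: fun_ge0.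
- by move=> x _; rewrite lee_fin; exact: fun_ge0.
exists N; split => // x /not_implyP[_].
by apply: contra_notP => Nx; rewrite [RHS]/= -[X in X%:E]/(h' x) h'E indicE mem_set ?mulr1.
Qed.

Lemma eq_integral_off_null (D N : set T) (f g : T -> \bar R) :
  measurable N -> mu N = 0%E -> (forall x, D x -> ~ N x -> f x = g x) ->
  (\int[mu]_(x in D) f x = \int[mu]_(x in D) g x)%E.
Proof.
move=> mN N0 fg; rewrite integralE [RHS]integralE; congr (_ - _)%E; apply/eqP;
  by rewrite eq_le !(@le_integral_off_null D N)// => x Dx Nx;
     rewrite ?funeposE ?funenegE fg.
Qed.

End equal_off_null.

Section borel_representative.
Context (R : realType) (d : nat).
Local Notation E := 'rV[R]_d.
Local Notation mu := (@lebesgue_rV R d).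

(** Each set [u > q], with [q] rational, is Borel up to a null set. Away from the
union of these countably many null sets, [u] is a Borel function. *)
Lemma lebesgue_measurable_borel (Omega : set E) (u : E -> R) :
  lebesgue_measurable_fun Omega u ->
  exists v : E -> R, exists N : set E, [/\ measurable N, mu N = 0%E,
    measurable_fun setT v & forall x, Omega x -> ~ N x -> u x = v x].
Proof.
move=> mu_.
have split_set (B : set R) : measurable B -> exists AM : set E * set E,
    [/\ measurable AM.1, measurable AM.2, mu AM.2 = 0%E &
     (Omega `&` u @^-1` B) `\` AM.2 = AM.1 `\` AM.2].
  move=> mB; have [A mA [N' [N [mN N0 N'N]] AN']] := mu_ B mB.
  exists (A, N); split => //=; rewrite -AN'; apply/seteqP; split=> x /=.
    by move=> [[//|/N'N]].
  by move=> [Ax Nx]; split => //; left.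
pose rn n : R := ratr (odflt 0 (@unpickle rat n)).
have ray n := split_set _ (measurable_itv `]rn n, +oo[%R).
have [[A N0] /= [mA mN0 N00 AE]] := split_set _ measurableT.
pose AM n := projT1 (cid (ray n)).
have AMP n := projT2 (cid (ray n)) : [/\ measurable (AM n).1,
    measurable (AM n).2, mu (AM n).2 = 0%E & _].
have : mu.-negligible (N0 `|` \bigcup_n (AM n).2).
  apply: negligibleU; first by exists N0; split.
  by apply: negligible_bigcup => n; case: (AMP n) => _ m2 z2 _; exists (AM n).2; split.
move=> [N [mN muN NN]].
have N0N : N0 `<=` N by move=> x ?; apply: NN; left.
have AMN n : (AM n).2 `<=` N by move=> x ?; apply: NN; right; exists n.
have AP x : ~ N x -> (Omega x <-> A x).
  move=> Nx; have N0x : ~ N0 x by move=> /N0N.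
  by move/seteqP : AE => [/(_ x)/= h1 /(_ x)/= h2]; tauto.
have AMPx n x : ~ N x -> ((AM n).1 x <-> Omega x /\ rn n < u x).
  move=> Nx; have N0x : ~ (AM n).2 x by move=> /AMN.
  have [_ _ _ /seteqP[/(_ x)/= h1 /(_ x)/= h2]] := AMP n.
  move: h1 h2; rewrite in_itv/= andbT => h1 h2.
  by tauto.
pose v x := if x \in (A `\` N) then u x else 0.
exists v; exists N; split => //; last first.
  by move=> x Ox Nx; rewrite /v mem_set//; split => //; exact/AP.
apply: (@measurability _ _ _ _ _ _ (@RGenOInfty.G R)).
  exact: RGenOInfty.measurableE.
move=> _ [_ [r ->] <-]; rewrite setTI.
rewrite (_ : _ @^-1` _ = (if r < 0 then ~` (A `\` N) else set0) `|`
    \bigcup_n (if r < rn n then (AM n).1 `\` N else set0)); last first.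
  apply/seteqP; split=> x /=; rewrite in_itv/= andbT /v;
    case: (boolP (x \in A `\` N)).
  - rewrite inE/= => -[Ax Nx] rux; right.
    have [q] := rat_in_itvoo rux; rewrite in_itv/= => /andP[rq qu].
    exists (pickle q) => //; rewrite /rn pickleK/= rq; split => //.
    by apply/AMPx => //; split; [exact/AP|rewrite /rn pickleK].
  - by rewrite notin_setE => Ax r0; left; rewrite r0.
  - rewrite inE/= => -[Ax Nx] [|[n _]]; first by case: ifP => // _ [].
    by case: ifP => // rrn [/AMPx[//|_ ] rnu _]; rewrite (lt_trans rrn).
  - rewrite notin_setE => Ax [|[n _]]; first by case: ifP.
    case: ifP => // rrn [An Nx]; exfalso; apply: Ax; split => //.
    by apply/AP => //; case/AMPx : An.
apply: measurableU.
  by case: ifP => // _; apply: measurableC; exact: measurableD.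
apply: bigcupT_measurable => n; case: ifP => // _; apply: measurableD => //.
by case: (AMP n).
Qed.

End borel_representative.

(** * Changes of variables for pairs of points *)

Section shear.
Context (R : realType) (d : nat).
Local Notation E := 'rV[R]_d.
Local Notation mu := (@lebesgue_rV R d).

Lemma measurable_addZ d' (T : measurableType d') (f g : T -> E) (s : R) :
  measurable_fun setT f -> measurable_fun setT g ->
  measurable_fun setT (fun p => f p + s *: g p).
Proof.
move=> mf mg; apply: measurable_fun_rV => i; under eq_fun do rewrite !mxE.
apply: measurable_funD; first exact: (measurableT_comp (measurable_coord_rV i)).
apply: measurable_funM => //.
exact: (measurableT_comp (measurable_coord_rV i)).
Qed.

Lemma ge0_integral_shear (s : R) (f : E * E -> \bar R) :
  measurable_fun setT f -> (forall p, (0 <= f p)%E) ->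
  (\int[mu \x mu]_p f (p.1 + s *: p.2, p.2)%R = \int[mu \x mu]_p f p)%E.
Proof.
move=> mf f0; rewrite [RHS]fubini_tonelli2// fubini_tonelli2//; last first.
  apply: (measurableT_comp mf); apply: measurable_fun_pair => //.
  exact: measurable_addZ.
apply: eq_integral => y _; rewrite /fubini_G/=.
have := @ge0_integral_affine_rV R d 1 (s *: y) (fun x => f (x, y)) ltr01.
rewrite expr1n invr1 mul1e => <- //; last exact: measurableT_comp mf _.
by under [RHS]eq_integral do rewrite scale1r.
Qed.

Lemma ge0_integral_shift2 (f : E * E -> \bar R) :
  measurable_fun setT f -> (forall p, (0 <= f p)%E) ->
  (\int[mu \x mu]_p f (p.1, p.1 + p.2)%R = \int[mu \x mu]_p f p)%E.
Proof.
move=> mf f0; rewrite [RHS]fubini_tonelli1// fubini_tonelli1//; last first.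
  apply: (measurableT_comp mf); apply: measurable_fun_pair => //.
  under eq_fun do rewrite -[X in _ + X]scale1r.
  exact: measurable_addZ.
apply: eq_integral => x _; rewrite /fubini_F/=.
have := @ge0_integral_affine_rV R d 1 x (fun y => f (x, y)) ltr01.
rewrite expr1n invr1 mul1e => <- //; last exact: measurableT_comp mf _.
by under [RHS]eq_integral do rewrite scale1r addrC.
Qed.

Lemma ge0_integral_scale2 (t : R) (f : E * E -> \bar R) : 0 < t ->
  measurable_fun setT f -> (forall p, (0 <= f p)%E) ->
  (\int[mu \x mu]_p f (p.1, t *: p.2)%R = (t ^- d)%:E * \int[mu \x mu]_p f p)%E.
Proof.
move=> t0 mf f0; have t1 : 0 <= t ^- d by rewrite invr_ge0 exprn_ge0// ltW.
have mft : measurable_fun setT (fun p : E * E => f (p.1, t *: p.2)%R).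
  apply: (measurableT_comp mf); apply: measurable_fun_pair => //.
  rewrite (_ : (fun p => _) = fun p : E * E => 0 + t *: p.2).
    exact: measurable_addZ.
  by apply/funext => p; rewrite add0r.
rewrite [in RHS]fubini_tonelli1// fubini_tonelli1//.
rewrite -ge0_integralZl//.
- apply: eq_integral => x _; rewrite /fubini_F/=.
  have := @ge0_integral_affine_rV R d t 0 (fun y => f (x, y)) t0.
  move=> <- //; last exact: measurableT_comp mf _.
  by under [RHS]eq_integral do rewrite addr0.
- exact: measurable_fun_fubini_tonelli_F.
- by move=> x _; exact: integral_ge0.
Qed.

End shear.

(** * Overlapping intervals along a chain of values *)

Section overlaps.
Context d (T : measurableType d) (R : realType).
Variable mu : {measure set T -> \bar R}.
Local Open Scope ereal_scope.

(** Bonferroni: counting a point of [N] of the sets [N] times exceeds counting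
it once by [N - 1], which is at most the number [N (N - 1) / 2] of pairs. *)
Lemma sum_measure_le_overlaps (A : nat -> set T) n :
  (forall i, measurable (A i)) ->
  \sum_(i < n) mu (A i) <= mu (\big[setU/set0]_(i < n) A i) +
    \sum_(j < n) \sum_(i < j) mu (A i `&` A j).
Proof.
move=> mA; have mU m : measurable (\big[setU/set0]_(i < m) A i).
  by apply: bigsetU_measurable.
elim: n => [|n ih]; first by rewrite !big_ord0 measure0 adde0.
rewrite !big_ord_recr/=; set U := \big[setU/set0]_(i < n) A i.
have -> : mu (A n) = mu (A n `\` U) + mu (A n `&` U).
  exact: (measureDI mu (mA n) (mU n)).
have -> : mu (U `|` A n) = mu U + mu (A n `\` U).
  rewrite -measureU//; [|exact: (mU n)|exact: (measurableD (mA n) (mU n))|].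
    congr (mu _); apply/seteqP; split=> x /=; last by tauto.
    by move=> [|Ax]; [left|case: (pselect (U x)) => ?; [left|right]].
  by rewrite setDE setICA setICr setI0.
rewrite [leRHS]addeACA; apply: leeD => //; apply: leeD2l.
rewrite (_ : A n `&` U = \big[setU/set0]_(i < n) (A i `&` A n)).
  by apply: (@Boole_inequality _ _ _ mu (fun i => A i `&` A n)) => i _; exact: measurableI.
by rewrite setIC /U big_distrl.
Qed.

End overlaps.

Section chain.
Context (R : realType).
Local Notation mu1 := (@lebesgue_measure R).

Lemma lebesgue_measure_oc (a b : R) :
  mu1 `]a, b]%classic = (Num.max 0 (b - a))%:E.
Proof.
rewrite lebesgue_measure_itv/= lte_fin; case: ltP => ab.
  by rewrite max_r// subr_ge0 ltW.
by rewrite max_l// subr_le0.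
Qed.

(** Compare the values [a i] with the line of slope [s / n], by means of the
intervals [ ]f i - s / n, f i] ], whose total length is [s]. If no value [a i]
is above the line issued from [a 0], nor below the one that ends at [a n], then
they all lie in an interval of length [s - (a n - a 0) + s / n], so that a rise
of the chain forces them to overlap. The middle sum counts the intervals of the
exceptional indices. *)
Lemma chain_overlaps (a f : nat -> R) (n : nat) (s : R) :
  (0 < n)%N -> 0 < s -> (forall i, f i = a i - s * (i%:R / n%:R)) ->
  Num.min (a n - a 0) s <= s / n%:R +
    \sum_(i < n) (s / n%:R) *
      ((s * (i%:R / n%:R) < a i - a 0)%R%:R +
       (s * ((n - i)%:R / n%:R) < a n - a i)%R%:R) +
    \sum_(j < n) \sum_(i < j) Num.max 0 (s / n%:R - `|f j - f i|).
Proof.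
move=> n0 s0 fE; set L := s / n%:R.
have nR : 0 < n%:R :> R by rewrite ltr0n.
have L0 : 0 < L by rewrite divr_gt0.
pose I i := `](f i - L), (f i)]%classic.
have mI i : measurable (I i) by exact: measurable_itv.
have muI i : mu1 (I i) = L%:E.
  by rewrite lebesgue_measure_oc opprB addrC subrK max_r// ltW.
pose bad i : R := (s * (i%:R / n%:R) < a i - a 0)%R%:R +
       (s * ((n - i)%:R / n%:R) < a n - a i)%R%:R.
have bad0 i : 0 <= bad i by rewrite addr_ge0.
pose T := `](f n - L), (f 0)]%classic.
have mT : measurable T by exact: measurable_itv.
pose J i := if 0 < bad i then I i else set0.
have mJ i : measurable (J i) by rewrite /J; case: ifP.
have muJ i : (mu1 (J i) <= (L * bad i)%:E)%E.
  rewrite /J; case: ifPn => [b0|_]; last first.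
    by rewrite measure0 lee_fin mulr_ge0// ltW.
  rewrite muI lee_fin; apply: ler_peMr; first exact: ltW.
  move: b0; rewrite /bad; by case: (s * _ < _)%R; case: (s * _ < _)%R => /= ?; lra.
have sub : \big[setU/set0]_(i < n) I i `<=` T `|` \big[setU/set0]_(i < n) J i.
  rewrite -!bigcup_mkord => x [i /= ni Ix].
  have [b0|] := ltP 0 (bad i); first by right; exists i => //; rewrite /J b0.
  rewrite /bad => bi; left; move: Ix; rewrite /I /T /= !in_itv/=.
  have : f i <= f 0 /\ f n <= f i.
    have : ~~ (s * (i%:R / n%:R) < a i - a 0) /\ ~~ (s * ((n - i)%:R / n%:R) < a n - a i).
      by move: bi; case: (s * _ < _)%R; case: (s * _ < _)%R => //= ?; lra.
    rewrite -!leNgt => -[h1 h2]; rewrite !fE !mul0r mulr0 subr0 divff ?gt_eqF// mulr1.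
    move: h2; rewrite natrB ?(ltnW ni)// mulrBl divff ?gt_eqF// mulrBr mulr1.
    by move: h1; set c := s * _ => h1 h2; split; lra.
  by move=> [f1 f2] /andP[h1 h2]; apply/andP; split; lra.
have IJ i j : (mu1 (I i `&` I j) <= (Num.max 0 (L - `|f j - f i|))%:E)%E.
  have S : I i `&` I j `<=` `](Num.max (f i) (f j) - L), (Num.min (f i) (f j))].
    move=> x; rewrite /I /= !in_itv/= => -[/andP[h1 h2] /andP[h3 h4]].
    by rewrite le_min h2 h4 ltrBlDr gt_max -!ltrBlDr h1 h3.
  have mIJ : measurable (I i `&` I j) by exact: measurableI.
  apply: (@le_trans _ _
      (Num.max 0 (Num.min (f i) (f j) - (Num.max (f i) (f j) - L)))%:E).
    by rewrite -lebesgue_measure_oc; apply: le_measure; rewrite ?inE.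
  rewrite lee_fin.
  by case: (leP (f i) (f j)) => h; [rewrite ger0_norm|rewrite ltr0_norm];
    rewrite ?subr_ge0 ?subr_lt0//; rewrite ge_max le_max lexx/= le_max; apply/orP; right; lra.
have := @sum_measure_le_overlaps _ _ _ mu1 I n mI.
have : (mu1 (\big[setU/set0]_(i < n) I i) <= (Num.max 0 (f 0 - (f n - L)))%:E +
    \sum_(i < n) (L * bad i)%:E)%E.
  have mUJ : measurable (\big[setU/set0]_(i < n) J i) by apply: bigsetU_measurable.
  have mUI : measurable (\big[setU/set0]_(i < n) I i) by apply: bigsetU_measurable.
  have mTJ : measurable (T `|` \big[setU/set0]_(i < n) J i).
    exact: measurableU.
  apply: (@le_trans _ _ (mu1 T + mu1 (\big[setU/set0]_(i < n) J i))%E).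
    apply: le_trans (measureU2 _ _ _) => //.
    by apply: le_measure; rewrite ?inE.
  rewrite /T lebesgue_measure_oc leeD2l//.
  apply: (@le_trans _ _ (\sum_(i < n) mu1 (J i))%E).
    by apply: Boole_inequality => i _; exact: mJ.
  by apply: lee_sum => i _; exact: muJ.
have : (\sum_(j < n) \sum_(i < j) mu1 (I i `&` I j) <=
    \sum_(j < n) \sum_(i < j) (Num.max 0 (L - `|f j - f i|))%:E)%E.
  by apply: lee_sum => j _; apply: lee_sum => i _; exact: IJ.
under [X in (_ <= X)%E -> _]eq_bigr do rewrite sumEFin.
rewrite sumEFin => h3 h2 h1.
have {h1 h2 h3} := le_trans h1 (leeD h2 h3).
rewrite (eq_bigr (fun=> L%:E)) => [|i _]; last exact: muI.
rewrite !sumEFin -!EFinD lee_fin sumr_const card_ord -[L *+ n]mulr_natr.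
rewrite {1}/L divfK ?gt_eqF//.
set S1 := \sum_(i < n) _; set S2 := \sum_(j < n) _ => H.
move: H; rewrite -/S1 -/S2 !fE mul0r mulr0 subr0 divff ?gt_eqF// mulr1.
have [h|h] := leP 0 (a 0 - (a n - s - L)).
  by move=> H; rewrite ge_min; apply/orP; left; lra.
by move=> H; rewrite ge_min; apply/orP; right; lra.
Qed.

End chain.

(** * Smooth functions of one variable *)

Section smooth_functions_of_one_variable.
Context (R : realType).
Implicit Types (f g : R -> R) (k : nat).

Fixpoint class_C k f : Prop :=
  if k is k'.+1 then (forall x, derivable f x 1) /\ class_C k' (derive1 f)
  else continuous f.

Definition smooth1 f := forall k, class_C k f.

Lemma derivable_all_continuous f : (forall x, derivable f x 1) -> continuous f.
Proof. by move=> df x; exact/differentiable_continuous/derivable1_diffP. Qed.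

Lemma class_CS k f : class_C k.+1 f -> class_C k f.
Proof.
elim: k f => [|k ih] f /= [df]; first by move=> _; exact: derivable_all_continuous.
by move=> h; split => //; apply: ih.
Qed.

Lemma class_CD k f g : class_C k f -> class_C k g -> class_C k (fun x => f x + g x).
Proof.
elim: k f g => [|k ih] f g /=; first by move=> cf cg x; exact: (continuousD (cf x) (cg x)).
move=> [df Cf] [dg Cg]; split; first by move=> x; exact: derivableD.
rewrite (_ : derive1 _ = fun x => derive1 f x + derive1 g x); first exact: ih.
by apply/funext => x; rewrite derive1E deriveD// -!derive1E.
Qed.

Lemma class_CM k f g : class_C k f -> class_C k g -> class_C k (fun x => f x * g x).
Proof.
elim: k f g => [|k ih] f g; first by move=> cf cg x; exact: (continuousM (cf x) (cg x)).
move=> Cf Cg; have Cf' := class_CS Cf; have Cg' := class_CS Cg.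
move: Cf Cg => /= [df Cf] [dg Cg]; split; first by move=> x; exact: derivableM.
rewrite (_ : derive1 _ = fun x => f x * derive1 g x + g x * derive1 f x); last first.
  by apply/funext => x; rewrite !derive1E; exact: (deriveM (df x) (dg x)).
by apply: class_CD; exact: ih.
Qed.

Lemma class_C_cst k (c : R) : class_C k (cst c).
Proof.
elim: k c => [|k ih] c /=; first by move=> x; exact: cvg_cst.
split; first by move=> x; exact: derivable_cst.
by rewrite (_ : derive1 _ = cst 0)//; apply/funext => x; rewrite derive1_cst.
Qed.

Lemma is_derive_affine (c b x : R) : is_derive x 1 (fun t : R => c * t + b) c.
Proof.
have -> : (fun t : R => c * t + b) = (c \*: (@id R)) + cst b by [].
by apply: is_derive_eq; rewrite addr0 scaler1.
Qed.

Lemma class_C_affine k f (c b : R) : class_C k f -> class_C k (fun t => f (c * t + b)).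
Proof.
elim: k f => [|k ih] f /=.
  move=> cf x; apply: (@continuous_comp _ _ _ (fun t => c * t + b) f); last exact: cf.
  apply: (@continuousD _ _ _ (fun t => c * t) (cst b)); last exact: cvg_cst.
  exact: mulrl_continuous.
move=> [df Cf]; have D (x : R) : is_derive x 1 (fun t : R => f (c * t + b)) (c * (derive1 f) (c * x + b)).
  have h1 : is_derive (c * x + b) 1 f ((derive1 f) (c * x + b)).
    by rewrite derive1E; exact: derivableP.
  have h2 := is_derive_affine c b x.
  by have := @is_derive1_comp _ f (fun t => c * t + b) x _ _ h1 h2; rewrite mulrC.
split; first by move=> x; exact: (@ex_derive _ _ _ _ _ _ _ (D x)).
rewrite (_ : derive1 _ = fun x => cst c x * (derive1 f (c * x + b))%R).
  by apply: class_CM; [exact: class_C_cst|exact: ih].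
by apply/funext => x; rewrite derive1E (@derive_val _ _ _ _ _ _ _ (D x)).
Qed.

(** The flat function [exp (- delta / t)] and its multiples by powers of [1 / t].
This family is stable under differentiation up to linear combinations, hence
all its members are smooth as soon as they are differentiable. *)
Definition exp_step (delta : R) (n : nat) (t : R) : R :=
  if 0 < t then t ^- n * expR (- (delta / t)) else 0.

(** Quadratic decay at [0] makes the derivative at [0] vanish. *)
Lemma exp_step_le (delta : R) n t : 0 < delta ->
  `|exp_step delta n t| <= (n.+2)`!%:R / delta ^+ n.+2 * t ^+ 2.
Proof.
move=> d0; rewrite /exp_step; case: ltP => t0; last first.
  by rewrite normr0 mulr_ge0// ?sqr_ge0// divr_ge0// exprn_ge0// ltW.
rewrite ger0_norm ?mulr_ge0 ?invr_ge0 ?exprn_ge0 ?expR_ge0 ?(ltW t0)//.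
have dt0 : 0 < delta / t by rewrite divr_gt0.
have H : (delta / t) ^+ n.+2 / (n.+2)`!%:R <= expR (delta / t).
  by apply: (le_trans _ (expR_ge1Dxn n.+1 (ltW dt0))); rewrite lerDr.
rewrite expRN.
have H2 : (expR (delta / t))^-1 <= ((delta / t) ^+ n.+2 / (n.+2)`!%:R)^-1.
  by rewrite lef_pV2 ?posrE ?expR_gt0// divr_gt0 ?exprn_gt0// ltr0n fact_gt0.
apply: le_trans (ler_wpM2l _ H2) _; first by rewrite invr_ge0 exprn_ge0// ltW.
rewrite le_eqVlt; apply/orP; left; apply/eqP.
rewrite expr_div_n -(addn2 n) (exprD t) !(exprD delta); field.
by rewrite !expf_neq0 ?gt_eqF// ?ltr0n ?fact_gt0.
Qed.

Lemma is_derive_exp_step (delta : R) (n : nat) (x : R) : 0 < delta ->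
  is_derive x 1 (exp_step delta n)
    (delta * exp_step delta n.+2 x + - n%:R * exp_step delta n.+1 x).
Proof.
move=> d0; have [x0|x0|x0] := ltgtP x 0.
- rewrite /exp_step ltNge (ltW x0)/= !mulr0 addr0.
  apply: (@near_eq_is_derive _ _ _ (cst 0)).
  near=> y; rewrite ltNge ifF//; apply/negbTE; rewrite negbK.
  by apply: ltW; near: y; exact: lt_nbhsl.
- have xn0 : x != 0 by rewrite gt_eqF.
  pose g (y : R) := y ^+ n * expR (- delta * y).
  apply: (@near_eq_is_derive _ _ _ (g \o GRing.inv)).
    near=> y; rewrite /exp_step ifT; last by near: y; exact: lt_nbhsr.
    by rewrite /g/= exprVn mulNr.
  have hV : is_derive x 1 (GRing.inv : R -> R) (- x ^- 2).
    have := @is_deriveV R id x 1 1 xn0 (is_derive_id _ _).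
    by rewrite [_ *: _]mulr1.
  have hn : is_derive x^-1 1 (fun y : R => y ^+ n) (n%:R * x^-1 ^+ n.-1).
    apply: DeriveDef; first exact: exprn_derivable.
    by rewrite exp_derive [LHS]mulr1.
  have hE : is_derive x^-1 1 (fun y : R => expR (- delta * y))
      (expR (- delta * x^-1) * - delta).
    have ha := is_derive_affine (- delta) 0 x^-1.
    have := @is_derive1_comp _ expR (fun t => - delta * t + 0) x^-1 _ _
      (is_derive_expR _) ha.
    rewrite addr0; congr is_derive.
    by apply/funext => y /=; rewrite addr0.
  have := @is_derive1_comp _ g GRing.inv x _ _ (is_deriveM hn hE) hV.
  congr is_derive.
  rewrite /exp_step x0 !exprVn /GRing.scale/=.
  have -> : - delta / x = - (delta / x) by rewrite mulNr.
  set e := expR _; case: n {hn g} => [|n].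
    by rewrite /= !mulr0n expr0 !invr1; field.
  by rewrite /= !exprS; field; rewrite xn0 expf_neq0.
- have fE0 : exp_step delta n 0 = 0 by rewrite /exp_step ltxx.
  have -> : delta * exp_step delta n.+2 x + - n%:R * exp_step delta n.+1 x = 0.
    by rewrite x0 /exp_step ltxx !mulr0 addr0.
  rewrite x0; apply/is_derive1_caratheodory.
  exists (fun z => exp_step delta n z / z); split.
  + move=> z; rewrite fE0 !subr0; have [->|z0] := eqVneq z 0.
      by rewrite fE0 !mul0r.
    by rewrite divfK.
  + set C := (n.+2)`!%:R / delta ^+ n.+2.
    have C0 : 0 <= C by rewrite divr_ge0// exprn_ge0// ltW.
    apply/cvgrPdist_le => e e0; rewrite /= fE0 mul0r.
    near=> z; rewrite sub0r normrN normrM normfV.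
    have [->|z0] := eqVneq z 0; first by rewrite fE0 normr0 mul0r ltW.
    rewrite ler_pdivrMr ?normr_gt0//; apply: le_trans (exp_step_le _ _ d0) _.
    rewrite -/C -real_normK ?num_real// expr2 mulrA ler_wpM2r//.
    have : `|z| <= e / (C + 1).
      near: z; apply: (@pseudometric_normed_Zmodule.nbhs0_le R R).
      by rewrite divr_gt0// ltr_wpDl.
    rewrite ler_pdivlMr ?ltr_wpDl// => /(le_trans _); apply.
    by rewrite mulrC ler_wpM2l// lerDl.
  + by rewrite fE0 mul0r.
Unshelve. all: by end_near. Qed.

Lemma smooth1_exp_step (delta : R) n : 0 < delta -> smooth1 (exp_step delta n).
Proof.
move=> d0 k; elim: k n => [|k ih] n /=.
  apply: derivable_all_continuous => x.
  exact: (@ex_derive _ _ _ _ _ _ _ (is_derive_exp_step n x d0)).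
split; first by move=> x; exact: (@ex_derive _ _ _ _ _ _ _ (is_derive_exp_step n x d0)).
rewrite (_ : derive1 _ = fun x => cst delta x * exp_step delta n.+2 x +
    cst (- n%:R) x * exp_step delta n.+1 x).
  by apply: class_CD; apply: class_CM; rewrite //; exact: class_C_cst.
apply/funext => x; rewrite derive1E.
exact: (@derive_val _ _ _ _ _ _ _ (is_derive_exp_step n x d0)).
Qed.

Lemma exp_step0_ge0 (delta t : R) : 0 <= exp_step delta 0 t.
Proof. by rewrite /exp_step; case: ifP => // _; rewrite mulr_ge0 ?expR_ge0// invr1. Qed.

Lemma exp_step0_le1 (delta t : R) : 0 <= delta -> exp_step delta 0 t <= 1.
Proof.
move=> d0; rewrite /exp_step; case: ltP => // t0; rewrite invr1 mul1r -expR0 ler_expR.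
by rewrite oppr_le0 divr_ge0// ltW.
Qed.

Lemma exp_step0_gt0 (delta t : R) : exp_step delta 0 t != 0 -> 0 < t.
Proof. by rewrite /exp_step; case: ifP => //; rewrite eqxx. Qed.

(** [exp (- delta / t)] tends to [1] for [t > 0] when [delta] tends to [0]. *)
Lemma exp_step0_cvg (t : R) :
  exp_step n.+1%:R^-1 0 t @[n --> \oo] --> ((0 < t)%R%:R : R).
Proof.
rewrite /exp_step; case: ltP => t0; last exact: cvg_cst.
rewrite invr1 (_ : true%:R = expR (- (0 / t)) :> R); last by rewrite mul0r oppr0 expR0.
under eq_fun do rewrite mul1r.
have h0 : {for (0 : R), continuous (fun x : R => expR (- (x / t)))}.
  apply: (@continuous_comp _ _ _ (fun x : R => - (x / t)) expR); last exact: continuous_expR.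
  apply: (@continuousN _ _ _ (fun x : R => x / t)).
  exact: mulrr_continuous.
exact: (cvg_comp _ _ cvg_harmonic h0).
Qed.

End smooth_functions_of_one_variable.

Section primitive.
Context (R : realType).
Local Notation mu1 := (@lebesgue_measure R).

(** Integration from [a - 1] preserves the vanishing on the left of [a], whereas
a primitive of a compactly supported function need not have compact support. *)
Definition smooth1_from (a : R) (h : R -> R) :=
  smooth1 h /\ forall t, t <= a -> h t = 0.

Lemma primitive_smooth1_from (a : R) (h : R -> R) : smooth1_from a h ->
  exists2 H, smooth1_from a H & forall x : R, is_derive x 1 H (h x).
Proof.
move=> [sh h0].
pose H x : R := (\int[mu1]_(t in [set` `[a - 1, x]]) h t)%R.
have H0 (x : R) : x <= a -> H x = 0.
  move=> xa; rewrite /H /Rintegral integral0_eq// => t /=.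
  by rewrite in_itv/= => /andP[_ tx]; rewrite h0// (le_trans tx).
have ch : continuous h := sh 0%N.
have dH (x : R) : is_derive x 1 H (h x).
  have [xa|ax] := ltP x a.
    apply: (@near_eq_is_derive _ _ _ (cst 0)).
      by near=> y; rewrite /cst H0//; apply: ltW; near: y; exact: lt_nbhsl.
    by rewrite h0 ?(ltW xa)//; exact: is_derive_cst.
  have ax1 : a - 1 < x by lra.
  have xx1 : x < x + 1 by rewrite ltrDl.
  have ih : mu1.-integrable `[a - 1, x + 1] (EFin \o h).
    apply: continuous_compact_integrable; first exact: segment_compact.
    exact: continuous_subspaceT.
  have [dH HE] := continuous_FTC1_closed xx1 ih ax1 (ch x).
  by apply: (DeriveDef dH); rewrite -derive1E; exact: HE.
exists H => //; split => // k.
have H1 : derive1 H = h.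
  by apply/funext => x; rewrite derive1E; exact: (@derive_val _ _ _ _ _ _ _ (dH x)).
have dH' (x : R) : derivable H x 1 by exact: (@ex_derive _ _ _ _ _ _ _ (dH x)).
case: k => [|k]; first exact: derivable_all_continuous.
by split => //; rewrite H1.
Unshelve. all: by end_near. Qed.

End primitive.

(** * Tensor products of smooth functions *)

Section tensor_sums.
Context (R : realType) (d : nat).
Local Notation E := 'rV[R]_d.
Local Notation e_ i := (delta_mx ord0 i : E).

(** A partial derivative, or a primitive in one coordinate, changes only one
factor of a product of functions of one coordinate each. Test functions of this
kind therefore need no more than calculus in one variable. *)
Inductive tensor_sum (Q : (R -> R) -> Prop) : (E -> R) -> Prop :=
| tensor_prod (h : 'I_d -> R -> R) : (forall j, Q (h j)) ->
    tensor_sum Q (fun x => \prod_j h j (x ord0 j))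
| tensor_add f g : tensor_sum Q f -> tensor_sum Q g ->
    tensor_sum Q (fun x => f x + g x)
| tensor_scale c f : tensor_sum Q f -> tensor_sum Q (fun x => c * f x).

Lemma is_derive_line (f : E -> R) (x v : E) (phi : R -> R) (a : R) :
  (forall t, f (t *: v + x) = phi t) -> is_derive (0 : R) 1 phi a ->
  is_derive x v f a.
Proof.
move=> fphi dphi.
have E1 : (fun h : R => h^-1 *: (f (h *: v + x) - f x)) =
    (fun h => h^-1 *: (phi (h *: 1 + 0) - phi 0)).
  apply/funext => h; rewrite fphi -[in f x](add0r x) -(scale0r v) fphi.
  by rewrite addr0 [h *: 1]mulr1.
have dp : derivable phi (0 : R) 1 := @ex_derive _ _ _ _ _ _ _ dphi.
apply: DeriveDef; first by rewrite /derivable/= E1; exact: dp.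
rewrite /derive/= E1; exact: (@derive_val _ _ _ _ _ _ _ dphi).
Qed.

Lemma is_derive_tensor_prod (h : 'I_d -> R -> R) (i : 'I_d) (x : E) (a : R) :
  is_derive (x ord0 i) 1 (h i) a ->
  is_derive x (e_ i) (fun x => \prod_j h j (x ord0 j))
    (a * \prod_(j | j != i) h j (x ord0 j)).
Proof.
move=> dh; pose c := \prod_(j | j != i) h j (x ord0 j).
apply: (@is_derive_line _ _ _ (fun t => c * h i (1 * t + x ord0 i))).
  move=> t; rewrite (bigD1 i)//= mulrC; congr (_ * _); last first.
    by rewrite !mxE !eqxx mulr1 mul1r.
  by apply: eq_bigr => j ji; rewrite !mxE eqxx (negbTE ji) mulr0 add0r.
have ha := @is_derive_affine _ 1 (x ord0 i) 0.
have hh : is_derive (1 * 0 + x ord0 i) 1 (h i) a by rewrite mulr0 add0r.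
have h1 := @is_derive1_comp _ (h i) (fun t => 1 * t + x ord0 i) 0 _ _ hh ha.
have h2 := @is_deriveZ _ _ _ (h i \o (fun t => 1 * t + x ord0 i)) c 0 1 _ h1.
move: h2; congr is_derive; rewrite mulr1; exact: mulrC.
Qed.

Lemma tensor_sum_imply (P Q : (R -> R) -> Prop) f : (forall h, P h -> Q h) ->
  tensor_sum P f -> tensor_sum Q f.
Proof.
move=> PQ; elim=> [h Ph|f1 g1 _ ? _ ?|c f1 _ ?]; first by apply: tensor_prod => j; exact/PQ.
- exact: tensor_add.
- exact: tensor_scale.
Qed.

Lemma tensor_sumM (P Q S : (R -> R) -> Prop) f g :
  (forall h k, P h -> Q k -> S (fun t => h t * k t)) ->
  tensor_sum P f -> tensor_sum Q g -> tensor_sum S (fun x => f x * g x).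
Proof.
move=> PQS; elim=> [h Ph|f1 f2 _ ih1 _ ih2|c f1 _ ih] tg.
- elim: tg => [k Qk|g1 g2 _ ih1 _ ih2|c g1 _ ih].
  + under [X in tensor_sum _ X]eq_fun do rewrite -big_split/=.
    by apply: (@tensor_prod S (fun j t => h j t * k j t)) => j; exact: PQS.
  + under [X in tensor_sum _ X]eq_fun do rewrite mulrDr.
    exact: tensor_add.
  + under [X in tensor_sum _ X]eq_fun do rewrite mulrCA.
    exact: tensor_scale.
- under [X in tensor_sum _ X]eq_fun do rewrite mulrDl.
  by apply: tensor_add; [exact: ih1|exact: ih2].
- under [X in tensor_sum _ X]eq_fun do rewrite -mulrA.
  by apply: tensor_scale; exact: ih.
Qed.

Lemma tensor_sum_continuous f : tensor_sum (fun h => continuous h) f -> continuous f.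
Proof.
elim=> [h ch|f1 g1 _ cf _ cg|c f1 _ cf] x.
- elim: (index_enum _) => [|j s ih].
    rewrite (_ : (fun x => _) = cst 1); first exact: cst_continuous.
    by apply/funext => y; rewrite big_nil.
  rewrite (_ : (fun x => _) = (fun x : E => h j (x ord0 j)) \*
      (fun x : E => \prod_(j <- s) h j (x ord0 j))); last first.
    by apply/funext => y; rewrite big_cons.
  apply: continuousM => //.
  apply: (@continuous_comp _ _ _ (fun x : E => x ord0 j) (h j)); last exact: ch.
  exact: coord_continuous.
- exact: (continuousD (cf x) (cg x)).
- by apply: (@continuousM _ _ (cst c)); [exact: cst_continuous|exact: cf].
Qed.

Lemma tensor_sum_derive f i : tensor_sum (@smooth1 R) f ->
  exists2 g, tensor_sum (@smooth1 R) g & forall x, is_derive x (e_ i) f (g x).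
Proof.
elim=> [h sh|f1 g1 _ [f' tf' df] _ [g' tg' dg]|c f1 _ [f' tf' df]].
- exists (fun x => \prod_j (if j == i then derive1 (h i) else h j) (x ord0 j)).
    apply: (@tensor_prod _ (fun j => if j == i then derive1 (h i) else h j)) => j.
    case: ifP => // _ k; exact: (sh i k.+1).2.
  move=> x; rewrite (bigD1 i)//= eqxx (eq_bigr (fun j => h j (x ord0 j))); last first.
    by move=> j /negbTE ->.
  apply: is_derive_tensor_prod; rewrite derive1E; apply: derivableP.
  exact: (sh i 1%N).1.
- exists (fun x => f' x + g' x); first exact: tensor_add.
  by move=> x; exact: is_deriveD.
- exists (fun x => c * f' x); first exact: tensor_scale.
  by move=> x; exact: is_deriveZ.
Qed.

Lemma tensor_sum_partial f i : tensor_sum (@smooth1 R) f ->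
  tensor_sum (@smooth1 R) (partial i f) /\ forall x, derivable f x (e_ i).
Proof.
move=> tf; have [g tg dg] := tensor_sum_derive i tf.
split; last by move=> x; exact: (@ex_derive _ _ _ _ _ _ _ (dg x)).
rewrite (_ : partial i f = g)//; apply/funext => x.
exact: (@derive_val _ _ _ _ _ _ _ (dg x)).
Qed.

Lemma tensor_sum_smooth f : tensor_sum (@smooth1 R) f -> smooth f.
Proof.
move=> tf s; have {tf} : tensor_sum (@smooth1 R) (foldr (@partial R d) f s).
  by elim: s => //= i s /(tensor_sum_partial i)[].
move: (foldr _ _ _) => g tg; split.
  by apply: tensor_sum_continuous; apply: tensor_sum_imply tg => h /(_ 0%N).
by move=> i x; have [_] := tensor_sum_partial i tg; exact.
Qed.

Lemma tensor_sum_primitive a f i : tensor_sum (smooth1_from a) f ->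
  exists2 G, tensor_sum (smooth1_from a) G & forall x, is_derive x (e_ i) G (f x).
Proof.
elim=> [h sh|f1 g1 _ [f' tf' df] _ [g' tg' dg]|c f1 _ [f' tf' df]].
- have [H sH dH] := primitive_smooth1_from (sh i).
  exists (fun x => \prod_j (if j == i then H else h j) (x ord0 j)).
    apply: (@tensor_prod _ (fun j => if j == i then H else h j)) => j.
    by case: ifP.
  move=> x; rewrite (bigD1 i)//= (eq_bigr (fun j =>
      (if j == i then H else h j) (x ord0 j))); last by move=> j /negbTE ->.
  apply: (@is_derive_tensor_prod (fun j => if j == i then H else h j)).
  by rewrite eqxx.
- exists (fun x => f' x + g' x); first exact: tensor_add.
  by move=> x; exact: is_deriveD.
- exists (fun x => c * f' x); first exact: tensor_scale.
  by move=> x; exact: is_deriveZ.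
Qed.

Lemma tensor_sum_translate f (z : E) : tensor_sum (@smooth1 R) f ->
  tensor_sum (@smooth1 R) (fun x => f (x + z)).
Proof.
elim=> [h sh|f1 g1 _ ? _ ?|c f1 _ ?]; [|exact: tensor_add|exact: tensor_scale].
rewrite (_ : (fun x => _) =
    fun x : E => \prod_j (fun t => h j (1 * t + z ord0 j)) (x ord0 j)).
  apply: (@tensor_prod _ (fun j t => h j (1 * t + z ord0 j))) => j k.
  by apply: class_C_affine; exact: sh.
by apply/funext => x; apply: eq_bigr => j _; rewrite mxE mul1r.
Qed.

End tensor_sums.

(** * Mean values along lines and integrals against charges *)

Section line.
Context (R : realType) (d : nat).
Local Notation E := 'rV[R]_d.

Lemma is_derive_along_line (G f : E -> R) (v y : E) :
  (forall x, is_derive x v G (f x)) ->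
  forall t : R, is_derive t 1 (fun t : R => G (t *: v + y)) (f (t *: v + y)).
Proof.
move=> dG t.
have E1 : (fun h : R => h^-1 *: (G ((h *: (1 : R) + t) *: v + y) - G (t *: v + y))) =
    (fun h => h^-1 *: (G (h *: v + (t *: v + y)) - G (t *: v + y))).
  by apply/funext => h; rewrite [h *: 1]mulr1 scalerDl addrA.
have D := dG (t *: v + y).
apply: DeriveDef.
  by rewrite /derivable/= E1; exact: (@ex_derive _ _ _ _ _ _ _ D).
by rewrite /derive/= E1; exact: (@derive_val _ _ _ _ _ _ _ D).
Qed.

Lemma mean_value_line (G f : E -> R) (v x : E) (tau : R) : 0 < tau ->
  (forall x, is_derive x v G (f x)) ->
  exists2 xi, 0 < xi < tau & G x - G (x - tau *: v) = tau * f (x - xi *: v).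
Proof.
move=> tau0 dG; pose y := x - tau *: v.
have dphi := is_derive_along_line y dG.
have cphi : {within `[0, tau], continuous (fun t : R => G (t *: v + y))}.
  apply: continuous_subspaceT; apply: derivable_all_continuous => t.
  exact: (@ex_derive _ _ _ _ _ _ _ (dphi t)).
have [c] := MVT tau0 (fun t _ => dphi t) cphi.
rewrite in_itv/= => /andP[c0 ct]; rewrite scale0r add0r subr0 /y addrCA subrr addr0 => ->.
exists (tau - c); first by rewrite subr_gt0 ct/= ltrBlDr ltrDl.
by rewrite mulrC scalerBl opprB addrCA.
Qed.

Lemma measurable_continuous_rV (f : E -> R) : continuous f -> measurable_fun setT f.
Proof.
move=> cf; apply: (@measurability _ _ _ _ _ _ (@RGenOInfty.G R)).
  exact: RGenOInfty.measurableE.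
move=> _ [_ [r ->] <-]; rewrite setTI; apply: open_measurable_rV.
by apply: open_comp => [v _|]; [exact: cf|exact: interval_open].
Qed.

End line.

Section charge_bound.
Context d (T : measurableType d) (R : realType).

Lemma finite_measure_integral_bound (m : {measure set T -> \bar R}) (D : set T)
    (f : T -> R) (M : R) : (m setT < +oo)%E -> measurable D ->
  measurable_fun setT f -> 0 <= M -> (forall x, `|f x| <= M) ->
  (`| \int[m]_(x in D) (f x)%:E | <= M%:E * m setT)%E.
Proof.
move=> moo mD mf M0 fM.
apply: (@le_trans _ _ (M%:E * m D)%E); last first.
  by rewrite lee_wpmul2l// le_measure// inE.
have mf' : measurable_fun D (fun x => (f x)%:E).
  by apply/measurable_EFinP; exact: measurable_funTS.
apply: (le_trans (le_abse_integral _ _ _)) => //.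
apply: integral_le_bound => //.
- by apply: aeW => x _; rewrite lee_fin.
Qed.

End charge_bound.

(** [C] is the total variation of the charge. *)
Lemma charge_integral_bound (R : realType) (d : nat)
    (nu : {charge set 'rV[R]_d -> \bar R}) :
  exists2 C : R, 0 <= C & forall (D : set 'rV[R]_d) (f : 'rV[R]_d -> R) (M : R),
    measurable D -> measurable_fun setT f -> 0 <= M -> (forall x, `|f x| <= M) ->
    (`| charge_integral nu D (EFin \o f) | <= (M * C)%:E)%E.
Proof.
rewrite /charge_integral; case: cid => P exN; case: cid => N PN.
have pfin : (jordan_pos PN setT \is a fin_num) by exact: fin_num_measure.
have nfin : (jordan_neg PN setT \is a fin_num) by exact: fin_num_measure.
exists (fine (jordan_pos PN setT) + fine (jordan_neg PN setT)).
  by rewrite addr_ge0// fine_ge0.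
move=> D f M mD mf M0 fM; rewrite mulrDr EFinD !EFinM !fineK//.
apply: le_trans (lee_abs_sub _ _) _.
apply: leeD; apply: finite_measure_integral_bound => //.
- by rewrite -ge0_fin_numE.
- by rewrite -ge0_fin_numE.
Qed.

(** * Translations and cubes *)

Section translation.
Context (R : realType) (d : nat).
Local Notation E := 'rV[R]_d.
Local Notation mu := (@lebesgue_rV R d).

Lemma ge0_integral_translate (z : E) (f : E -> \bar R) :
  measurable_fun setT f -> (forall x, (0 <= f x)%E) ->
  (\int[mu]_x f (x + z)%R = \int[mu]_x f x)%E.
Proof.
move=> mf f0; have := ge0_integral_affine_rV z ltr01 mf f0.
rewrite expr1n invr1 mul1e => <-.
by apply: eq_integral => x _; rewrite scale1r.
Qed.

Lemma measurable_translate (z : E) : measurable_fun setT (fun x : E => x + z).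
Proof.
rewrite (_ : (fun x => _) = fun x : E => 1 *: x + z); first exact: measurable_affine_rV.
by apply/funext => x; rewrite scale1r.
Qed.

Lemma integral_translate (z : E) (f : E -> \bar R) : measurable_fun setT f ->
  (\int[mu]_x f (x + z)%R = \int[mu]_x f x)%E.
Proof.
move=> mf; rewrite integralE [RHS]integralE; congr (_ - _)%E.
- rewrite -(@ge0_integral_translate z f^\+%E (measurable_funepos mf))//.
  by apply: eq_integral => x _; rewrite !funeposE.
- rewrite -(@ge0_integral_translate z f^\-%E (measurable_funeneg mf))//.
  by apply: eq_integral => x _; rewrite !funenegE.
Qed.

Lemma integrable_translate (z : E) (f : E -> R) : mu.-integrable setT (EFin \o f) ->
  mu.-integrable setT (EFin \o (fun x => f (x + z))).
Proof.
move=> /integrableP[/measurable_EFinP mf foo]; apply/integrableP; split.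
  by apply/measurable_EFinP; exact: (measurableT_comp mf (measurable_translate z)).
apply: le_lt_trans foo; rewrite le_eqVlt; apply/orP; left; apply/eqP.
rewrite -[RHS](integral_translate z)//.
by apply: measurableT_comp => //; exact/measurable_EFinP.
Qed.

End translation.

Lemma integrable_indicM d (T : measurableType d) (R : realType)
    (mu : {measure set T -> \bar R}) (B : set T) (f : T -> R) :
  measurable B -> mu.-integrable B (EFin \o f) ->
  mu.-integrable setT (EFin \o (fun x => f x * \1_B x)).
Proof.
move=> mB /(integrable_mkcond _ mB); apply: eq_integrable => // x _.
by rewrite /= patchE indicE; case: ifP; rewrite ?mulr1 ?mulr0.
Qed.

Section cube.
Context (R : realType) (d : nat).
Local Notation E := 'rV[R]_d.

Definition cube (p : E) (r : R) : set E :=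
  [set x | forall i, `|x ord0 i - p ord0 i| < r].

Definition closed_cube (p : E) (r : R) : set E :=
  [set x | forall i, `|x ord0 i - p ord0 i| <= r].

Lemma compact_closed_cube p r : compact (closed_cube p r).
Proof.
have -> : closed_cube p r = [set v : E | forall i,
    `[p ord0 i - r, p ord0 i + r]%classic (v ord0 i)].
  apply/seteqP; split=> x xp i; have := xp i; rewrite /= in_itv/= ler_distl//.
by apply: (@rV_compact R d (fun i => `[p ord0 i - r, p ord0 i + r]%classic)) => i;
  exact: segment_compact.
Qed.

Lemma closed_closed_cube p r : closed (closed_cube p r).
Proof. by apply: compact_closed; [exact: norm_hausdorff|exact: compact_closed_cube]. Qed.

Lemma cube_subset_closed p r : cube p r `<=` closed_cube p r.
Proof. by move=> x xp i; exact: ltW. Qed.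

Lemma measurable_cube p r : measurable (cube p r).
Proof.
rewrite (_ : cube p r = \bigcap_(i in [set: 'I_d])
    (fun v : E => v ord0 i) @^-1` `](p ord0 i - r), (p ord0 i + r)[%classic).
  apply: fin_bigcap_measurable => // i _.
  by rewrite -[X in measurable X]setTI; exact: measurable_coord_rV.
apply/seteqP; split=> x xp i.
  by move=> _ /=; rewrite in_itv/= -ltr_distl; exact: xp.
by have := xp i I; rewrite /= in_itv/= -ltr_distl.
Qed.

(** A coordinate parallelepiped is stable under moving its points towards one
another, one coordinate at a time or all at once. *)
Lemma cube_convex p r (x z : E) (s t : R) : 0 <= s <= t ->
  cube p r x -> cube p r (x + t *: z) -> cube p r (x + s *: z).
Proof.
move=> /andP[s0 st] px pz i; move: (px i) (pz i); rewrite !mxE !ltr_distl.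
move=> /andP[h1 h2] /andP[h3 h4].
have [t0|t0] := eqVneq t 0.
  have -> : s = 0 by apply/eqP; rewrite eq_le s0 andbT -t0.
  by rewrite mul0r addr0 h1.
have t1 : 0 < t by rewrite lt_neqAle eq_sym t0 (le_trans s0).
have [z0|z0] := leP 0 (z ord0 i).
  have : s * z ord0 i <= t * z ord0 i by rewrite ler_wpM2r.
  have : 0 <= s * z ord0 i by rewrite mulr_ge0.
  by move=> a b; apply/andP; split; lra.
have : t * z ord0 i <= s * z ord0 i by rewrite ler_wnM2r// ltW.
have : s * z ord0 i <= 0 by rewrite mulr_ge0_le0// ltW.
by move=> a b; apply/andP; split; lra.
Qed.

End cube.

(** * Increments tested against smooth functions *)

Section bv_against_test_functions.
Context (R : realType) (d : nat).
Local Notation E := 'rV[R]_d.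
Local Notation mu := (@lebesgue_rV R d).
Local Notation e_ i := (delta_mx ord0 i : E).
Context (Omega : set E) (u : E -> R) (p : E) (r : R) (i : 'I_d).
Context (nu : {charge set E -> \bar R}) (C : R).
Local Notation B := (cube p r).
Context (mOmega : measurable Omega) (mu_ : measurable_fun setT u)
  (iu : mu.-integrable B (EFin \o u)) (BO : closed_cube p r `<=` Omega)
  (Cnu : forall (D : set E) (f : E -> R) (M : R),
    measurable D -> measurable_fun setT f -> 0 <= M -> (forall x, `|f x| <= M) ->
    (`| charge_integral nu D (EFin \o f) | <= (M * C)%:E)%E)
  (du : forall phi, test_function Omega phi ->
    (\int[mu]_(x in Omega) (u x * partial i phi x)%:E =
     - charge_integral nu Omega (EFin \o phi))%E).

Let U x := u x * \1_B x.

Let mB : measurable B. Proof. exact: measurable_cube. Qed.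

Let mU : measurable_fun setT U.
Proof. by apply: measurable_funM => //; exact: measurable_indic. Qed.

Let iU : mu.-integrable setT (EFin \o U). Proof. exact: integrable_indicM. Qed.

(** If [G] is a primitive of [psi] in the [i]-th coordinate, then the test
function [F x := G x - G (x - tau e_i)] has partial derivative
[psi x - psi (x - tau e_i)], and integrating [u] against it gives the increments
of [u] against [psi]. The mean value theorem bounds [F] by [tau], and shows
that [F] vanishes off the cube, which is convex. *)
Lemma increment_against_test (a tau : R) (psi : E -> R) : 0 < tau ->
  tensor_sum (smooth1_from a) psi -> (forall x, `|psi x| <= 1) ->
  (forall x, psi x != 0 -> B x /\ B (x + tau *: e_ i)) ->
  (`| \int[mu]_x ((U (x + tau *: e_ i)%R - U x) * psi x)%:E | <= (tau * C)%:E)%E.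
Proof.
move=> tau0 tpsi psi1 suppsi; set v := e_ i.
have [G tG dG] := tensor_sum_primitive i tpsi.
have sm h : smooth1_from a h -> smooth1 h by case.
have {}tG := tensor_sum_imply sm tG; have tpsi1 := tensor_sum_imply sm tpsi.
pose F x := G x - G (x - tau *: v).
have tF : tensor_sum (@smooth1 R) F.
  rewrite (_ : F = fun x => G x + (-1) * G (x + - (tau *: v))).
    by apply: tensor_add => //; apply: tensor_scale; exact: tensor_sum_translate.
  by apply/funext => x; rewrite mulN1r.
have dF x : partial i F x = psi x - psi (x - tau *: v).
  have D2 : is_derive x v (fun x => G (x - tau *: v)) (psi (x - tau *: v)).
    have := is_derive_along_line (x - tau *: v) dG 0.
    rewrite scale0r add0r => /(@is_derive_line _ _ _ x v).
    by apply => t; rewrite addrA.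
  have D1 := dG x.
  exact: (@derive_val _ _ _ _ _ _ _ (is_deriveB D1 D2)).
have F1 x : `|F x| <= tau.
  rewrite /F; have [xi _ ->] := mean_value_line x tau0 dG.
  by rewrite normrM gtr0_norm// ler_piMr// ltW.
have psiB x : psi (x - tau *: v) != 0 -> B x.
  by move=> /suppsi[_]; rewrite subrK.
have FB x : F x != 0 -> B x.
  rewrite /F; have [xi /andP[xi0 xit] ->] := mean_value_line x tau0 dG.
  rewrite mulf_eq0 negb_or => /andP[_ /suppsi[b1 b2]].
  have -> : x = (x - xi *: v) + xi *: v by rewrite subrK.
  by apply: cube_convex b1 b2; rewrite (ltW xi0) ltW.
have testF : test_function Omega F.
  have S : closure [set x | F x != 0] `<=` closed_cube p r.
    rewrite closureE => x; apply; split; first exact: closed_closed_cube.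
    by move=> y /= /FB; exact: cube_subset_closed.
  split; first exact: tensor_sum_smooth.
  - apply: (subclosed_compact _ (compact_closed_cube (p := p) (r := r)) S).
    exact: closed_closure.
  - exact: subset_trans S BO.
have mpsi : measurable_fun setT psi.
  apply: measurable_continuous_rV; apply: tensor_sum_continuous.
  by apply: tensor_sum_imply tpsi1 => h /(_ 0%N).
have mF : measurable_fun setT F.
  apply: measurable_continuous_rV; apply: tensor_sum_continuous.
  by apply: tensor_sum_imply tF => h /(_ 0%N).
have ib (f : E -> R) (g : E -> R) : mu.-integrable setT (EFin \o f) ->
    measurable_fun setT g -> (forall x, `|g x| <= 1) ->
    mu.-integrable setT (fun x => (f x * g x)%:E).
  move=> fi mg g1; apply: (le_integrable _ _ _ fi) => //.
    apply/measurable_EFinP; apply: measurable_funM => //.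
    by move/measurable_int : fi => /measurable_EFinP.
  by move=> x _ /=; rewrite lee_fin normrM ler_piMr.
have mUt : measurable_fun setT (fun x : E => U (x + tau *: v)).
  exact: (measurableT_comp mU (measurable_translate _)).
have iUt := integrable_translate (tau *: v) iU.
have mpsit : measurable_fun setT (fun x : E => psi (x - tau *: v)).
  exact: (measurableT_comp mpsi (measurable_translate _)).
pose A := (\int[mu]_x (U x * psi x)%:E)%E.
pose A' := (\int[mu]_x (U x * psi (x - tau *: v)%R)%:E)%E.
have finA : A \is a fin_num by apply: integrable_fin_num => //; exact: ib.
have finA' : A' \is a fin_num by apply: integrable_fin_num => //; apply: ib.
have -> : (\int[mu]_x ((U (x + tau *: v)%R - U x) * psi x)%:E = A' - A)%E.
  transitivity (\int[mu]_x (U (x + tau *: v)%R * psi x)%:E - A)%E.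
    rewrite -integralB//; [|exact: ib|exact: ib].
    by apply: eq_integral => x _; rewrite mulrBl EFinB.
  congr (_ - _)%E; rewrite /A' -[RHS](integral_translate (tau *: v)).
    by apply: eq_integral => x _; rewrite addrK.
  by apply/measurable_EFinP; exact: measurable_funM.
have -> : (A' - A = charge_integral nu Omega (EFin \o F))%E.
  rewrite -[RHS]oppeK -(du testF).
  have -> : (\int[mu]_(x in Omega) (u x * partial i F x)%:E = A - A')%E.
    rewrite -integralB//; [|exact: ib|by apply: ib].
    rewrite [LHS]integral_mkcond; apply: eq_integral => x _.
    rewrite patchE -EFinB -mulrBr dF /U indicE.
    case: (boolP (x \in B)) => [/set_mem xB|].
      by rewrite mem_set ?mulr1//; exact/BO/cube_subset_closed.
    rewrite notin_setE => nB; rewrite mulr0 mul0r.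
    have -> : psi x = 0 by apply: contra_notP nB => /eqP/suppsi[].
    have -> : psi (x - tau *: v) = 0 by apply: contra_notP nB => /eqP/psiB.
    by rewrite subr0 mulr0; case: ifP.
  by rewrite (fin_num_oppeB A finA') addeC.
by apply: Cnu => //; exact: ltW.
Qed.

End bv_against_test_functions.

(** * Density of smooth functions *)

Section small_integrals.
Context d (T : measurableType d) (R : realType).
Variable mu : {measure set T -> \bar R}.

Lemma dominated_small (w : T -> R) (f : nat -> T -> R) (M e : R) :
  mu.-integrable setT (EFin \o w) -> (forall x, 0 <= w x) ->
  (forall n, measurable_fun setT (f n)) ->
  (forall n x, `|f n x| <= M) -> (forall x, f n x @[n --> \oo] --> 0) -> 0 < e ->
  exists n, (\int[mu]_x (w x * `|f n x|)%:E <= e%:E)%E.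
Proof.
move=> iw w0 mf fM f0 e0.
have mw : measurable_fun setT w by move/measurable_int : iw => /measurable_EFinP.
have M0 (x : T) : 0 <= M by exact: le_trans (normr_ge0 _) (fM 0%N x).
have iMw : mu.-integrable setT (fun x => (M * w x)%:E).
  by under eq_fun do rewrite EFinM; exact: integrableZl.
have [] := @dominated_convergence _ _ _ mu setT measurableT
  (fun n x => (w x * `|f n x|)%:E) (cst 0%E) (fun x => (M * w x)%:E).
- move=> n; apply/measurable_EFinP; apply: measurable_funM => //.
  by apply: measurableT_comp.
- exact: measurable_cst.
- apply: aeW => x _; rewrite /cst.
  apply/(@fine_cvgP _ _ _ _ (fun n => (w x * `|f n x|)%:E) 0).
  split; first exact: nearW.
  have : (fun n => w x * `|f n x|) @ \oo --> w x * `|0 : R|.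
    by apply: cvgM; [exact: cvg_cst|apply: cvg_norm].
  by rewrite normr0 mulr0.
- exact: iMw.
- apply: aeW => x n _; rewrite lee_fin ger0_norm ?mulr_ge0//.
  by rewrite mulrC ler_wpM2r.
move=> _ _; rewrite integral0 => /fine_cvgP[finI /cvgrPdist_le/(_ e e0) leI].
near \oo => n; exists n.
have fi : (\int[mu]_x (w x * `|f n x|)%:E)%E \is a fin_num by near: n.
rewrite -(fineK fi) lee_fin.
have : `|0 - fine (\int[mu]_x (w x * `|f n x|)%:E)%E| <= e by near: n.
by rewrite sub0r normrN => /(le_trans (ler_norm _)).
Unshelve. all: by end_near. Qed.

End small_integrals.

Section density.
Context (R : realType) (d : nat).
Local Notation E := 'rV[R]_d.
Local Notation mu := (@lebesgue_rV R d).

Definition smooth_cutoff (psi : E -> R) :=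
  tensor_sum (@smooth1 R) psi /\ forall x, 0 <= psi x <= 1.

Lemma measurable_smooth_cutoff psi : smooth_cutoff psi -> measurable_fun setT psi.
Proof.
move=> [tpsi _]; apply: measurable_continuous_rV; apply: tensor_sum_continuous.
by apply: tensor_sum_imply tpsi => h /(_ 0%N).
Qed.

Lemma smooth_cutoffC psi : smooth_cutoff psi -> smooth_cutoff (fun x => 1 - psi x).
Proof.
move=> [tpsi psi01]; split; last by move=> x; have := psi01 x; lra.
rewrite (_ : (fun x => _) = fun x : E => \prod_(j < d) (cst 1 : R -> R) (x ord0 j) + (-1) * psi x).
  apply: tensor_add; last exact: tensor_scale.
  by apply: (@tensor_prod _ _ _ (fun=> cst 1)) => j k; exact: class_C_cst.
by apply/funext => x; rewrite big1// mulN1r.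
Qed.

Lemma smooth_cutoffM psi phi : smooth_cutoff psi -> smooth_cutoff phi ->
  smooth_cutoff (fun x => psi x * phi x).
Proof.
move=> [tpsi psi01] [tphi phi01]; split; last first.
  move=> x; have /andP[? ?] := psi01 x; have /andP[? ?] := phi01 x.
  by rewrite mulr_ge0//= mulr_ile1.
by apply: tensor_sumM tpsi tphi => h k sh sk n; exact: class_CM.
Qed.

Definition box (a b : 'I_d -> R) : set E :=
  [set x | forall i, a i < x ord0 i < b i].

Lemma measurable_box a b : measurable (box a b).
Proof.
rewrite (_ : box a b = \bigcap_(i in [set: 'I_d])
  (fun v : E => v ord0 i) @^-1` `]a i, b i[%classic).
  apply: fin_bigcap_measurable => // i _.
  by rewrite -[X in measurable X]setTI; exact: measurable_coord_rV.
apply/seteqP; split=> x xp i; first by move=> _ /=; rewrite in_itv/=; exact: xp.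
by have := xp i I; rewrite /= in_itv/=.
Qed.

Definition box_cutoff (a b : 'I_d -> R) n : E -> R :=
  fun x => \prod_i (exp_step n.+1%:R^-1 0 (1 * x ord0 i - a i) *
                    exp_step n.+1%:R^-1 0 (-1 * x ord0 i + b i)).

Lemma smooth1_box_factor (a b : R) n :
  smooth1 (fun t : R => exp_step n.+1%:R^-1 0 (1 * t - a) *
                    exp_step n.+1%:R^-1 0 (-1 * t + b)).
Proof.
have n0 : 0 < n.+1%:R^-1 :> R by rewrite invr_gt0 ltr0n.
by move=> k; apply: class_CM; apply: class_C_affine; exact: smooth1_exp_step.
Qed.

Lemma box_cutoff_tensor a b n (m : R) : (forall i, m <= a i) ->
  tensor_sum (smooth1_from m) (box_cutoff a b n).
Proof.
move=> ma; apply: (@tensor_prod _ _ _ (fun i t => exp_step n.+1%:R^-1 0 (1 * t - a i) *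
  exp_step n.+1%:R^-1 0 (-1 * t + b i))) => i; split; first exact: smooth1_box_factor.
move=> t tm; rewrite {1}/exp_step ltNge; rewrite mul1r subr_le0 (le_trans tm)//=.
by rewrite mul0r.
Qed.

Lemma box_cutoff01 a b n x : 0 <= box_cutoff a b n x <= 1.
Proof.
have n0 : 0 <= n.+1%:R^-1 :> R by rewrite invr_ge0.
apply/andP; split.
  by apply: prodr_ge0 => i _; rewrite mulr_ge0// exp_step0_ge0.
apply: prodr_ile1 => i _.
by rewrite mulr_ge0 ?exp_step0_ge0//= mulr_ile1 ?exp_step0_ge0 ?exp_step0_le1.
Qed.

Lemma box_cutoff_smooth a b n : smooth_cutoff (box_cutoff a b n).
Proof.
split; last exact: box_cutoff01.
by apply: (@tensor_prod _ _ _ (fun i t => exp_step n.+1%:R^-1 0 (1 * t - a i) *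
  exp_step n.+1%:R^-1 0 (-1 * t + b i))) => i; exact: smooth1_box_factor.
Qed.

Lemma box_cutoff_supp a b n x : box_cutoff a b n x != 0 -> box a b x.
Proof.
move=> /prodf_neq0 h i; have := h i isT; rewrite mulf_eq0 negb_or.
by move=> /andP[/exp_step0_gt0 ? /exp_step0_gt0 ?]; apply/andP; split; lra.
Qed.

Lemma box_cutoff_cvg a b x :
  box_cutoff a b n x @[n --> \oo] --> (\1_(box a b) x : R).
Proof.
rewrite indicE; case: (boolP (x \in box a b)) => [/set_mem xab|]; last first.
  rewrite notin_setE => xab.
  rewrite (_ : (fun n => _) = cst 0); first exact: cvg_cst.
  by apply/funext => n /=; apply: contra_notP xab => /eqP/box_cutoff_supp.
rewrite /box_cutoff; elim: (index_enum _) => [|j s ih].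
  rewrite (_ : (fun n => _) = cst 1); first exact: cvg_cst.
  by apply/funext => n /=; rewrite big_nil.
set g := (X in X @ _ --> _).
have -> : g = (fun n => exp_step n.+1%:R^-1 0 (1 * x ord0 j - a j) *
    exp_step n.+1%:R^-1 0 (-1 * x ord0 j + b j)) \* (fun n => \prod_(i <- s)
      (exp_step n.+1%:R^-1 0 (1 * x ord0 i - a i) *
       exp_step n.+1%:R^-1 0 (-1 * x ord0 i + b i))).
  by apply/funext => n; rewrite /g big_cons.
have /andP[h1 h2] := xab j.
have := cvgM (cvgM (@exp_step0_cvg R (1 * x ord0 j - a j))
  (@exp_step0_cvg R (-1 * x ord0 j + b j))) ih.
have -> : 0 < 1 * x ord0 j - a j by lra.
have -> : 0 < -1 * x ord0 j + b j by lra.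
by rewrite !mulr1 => h; exact: h.
Qed.

Context (w : E -> R) (iw : mu.-integrable setT (EFin \o w)) (w0 : forall x, 0 <= w x).

Let mw : measurable_fun setT w.
Proof. by move/measurable_int : iw => /measurable_EFinP. Qed.

(** Approximation of [1_A] in [L1 (w mu)] by smooth functions with values in
[[0, 1]]. The bounds are kept because they make the approximation stable under
products, hence under unions. *)
Definition smooth_approximable (A : set E) := measurable A /\ forall e : R, 0 < e ->
  exists2 psi, smooth_cutoff psi &
    (\int[mu]_x (w x * `|\1_A x - psi x|)%:E <= e%:E)%E.

Lemma approximableC A : smooth_approximable A -> smooth_approximable (~` A).
Proof.
move=> [mA hA]; split; first exact: measurableC.
move=> e e0; have [psi spsi psie] := hA e e0.
exists (fun x => 1 - psi x); first exact: smooth_cutoffC.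
apply: le_trans psie; rewrite le_eqVlt; apply/orP; left; apply/eqP.
apply: eq_integral => x _; congr ((_ * _)%:E).
rewrite -normrN !indicE in_setC; congr `|_|.
by case: (x \in A) => /=; lra.
Qed.

Let mwf (f : E -> R) : measurable_fun setT f ->
  measurable_fun setT (fun x => (w x * `|f x|)%:E).
Proof.
move=> mf; apply/measurable_EFinP; apply: measurable_funM => //.
exact: measurableT_comp.
Qed.

(** If [1_(F n)] tends to [1_A] pointwise, then it does so in [L1 (w mu)]. *)
Lemma approximable_limit A (F : nat -> set E) :
  (forall n, smooth_approximable (F n)) -> measurable A ->
  (forall x, (\1_(F n) x : R) @[n --> \oo] --> (\1_A x : R)) ->
  smooth_approximable A.
Proof.
move=> aF mA FA; split => // e e0; have e2 : 0 < e / 2 by rewrite divr_gt0.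
have mF n : measurable (F n) by case: (aF n).
have mAF n : measurable_fun setT (fun x => \1_A x - \1_(F n) x : R).
  by apply: measurable_funB; exact: measurable_indic.
have b1 n x : `|\1_A x - \1_(F n) x : R| <= 1.
  by rewrite !indicE; case: (_ \in _); case: (_ \in _);
    rewrite ?subrr ?subr0 ?sub0r ?normrN ?normr0 ?normr1.
have c1 x : (\1_A x - \1_(F n) x : R) @[n --> \oo] --> (0 : R).
  by rewrite -(subrr (\1_A x)); apply: cvgB; [exact: cvg_cst|exact: FA].
have [n nA] := dominated_small iw w0 mAF b1 c1 e2.
have [psi spsi psie] := (aF n).2 _ e2.
exists psi => //.
have mpsi := measurable_smooth_cutoff spsi.
rewrite [leRHS](_ : _ = (e / 2)%:E + (e / 2)%:E)%E; last first.
  by rewrite -EFinD; congr EFin; lra.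
apply: le_trans (leeD nA psie).
have m2 : measurable_fun setT (fun x => \1_(F n) x - psi x).
  by apply: measurable_funB => //; exact: measurable_indic.
rewrite -ge0_integralD//; [|by move=> x _; rewrite lee_fin mulr_ge0|exact: (mwf (mAF n))|
  by move=> x _; rewrite lee_fin mulr_ge0|exact: mwf].
apply: ge0_le_integral => //.
- by move=> x _; rewrite lee_fin mulr_ge0.
- by apply: mwf; apply: measurable_funB => //; exact: measurable_indic.
- by apply: emeasurable_funD; [exact: (mwf (mAF n))|exact: mwf].
- move=> x _; rewrite -EFinD lee_fin -mulrDr ler_wpM2l//.
  by rewrite (le_trans _ (ler_normD _ _))// addrA subrK.
Qed.

Lemma approximableU A B : smooth_approximable A -> smooth_approximable B ->
  smooth_approximable (A `|` B).
Proof.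
move=> [mA hA] [mB hB]; split; first exact: measurableU.
move=> e e0; have e2 : 0 < e / 2 by rewrite divr_gt0.
have [psi sp psie] := hA _ e2; have [phi sq phie] := hB _ e2.
exists (fun x => 1 - (1 - psi x) * (1 - phi x)).
  by apply: smooth_cutoffC; apply: smooth_cutoffM; exact: smooth_cutoffC.
rewrite [leRHS](_ : _ = (e / 2)%:E + (e / 2)%:E)%E; last first.
  by rewrite -EFinD; congr EFin; lra.
apply: le_trans (leeD psie phie).
have mp := measurable_smooth_cutoff sp; have mq := measurable_smooth_cutoff sq.
have m1 : measurable_fun setT (fun x => \1_A x - psi x).
  by apply: measurable_funB => //; exact: measurable_indic.
have m2 : measurable_fun setT (fun x => \1_B x - phi x).
  by apply: measurable_funB => //; exact: measurable_indic.
rewrite -ge0_integralD//; [|by move=> x _; rewrite lee_fin mulr_ge0|exact: mwf|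
  by move=> x _; rewrite lee_fin mulr_ge0|exact: mwf].
apply: ge0_le_integral => //.
- by move=> x _; rewrite lee_fin mulr_ge0.
- apply: mwf; apply: measurable_funB; first by apply: measurable_indic; exact: measurableU.
  apply: measurable_funB => //; apply: measurable_funM; exact: measurable_funB.
- by apply: emeasurable_funD; exact: mwf.
- move=> x _; rewrite -EFinD lee_fin -mulrDr ler_wpM2l//.
  have /andP[? ?] := sp.2 x; have /andP[? ?] := sq.2 x.
  have -> : \1_(A `|` B) x = 1 - (1 - \1_A x) * (1 - \1_B x) :> R.
    rewrite !indicE in_setU; case: (x \in A); case: (x \in B) => /=; lra.
  set s := \1_A x; set t := \1_B x.
  have s01 : 0 <= s <= 1 by rewrite /s indicE; case: (_ \in _); rewrite ?ler01 ?lexx.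
  have -> : 1 - (1 - s) * (1 - t) - (1 - (1 - psi x) * (1 - phi x)) =
     (s - psi x) * (1 - phi x) + (1 - s) * (t - phi x) by ring.
  apply: le_trans (ler_normD _ _) _; rewrite !normrM.
  apply: lerD; first by rewrite ler_piMr// ger0_norm; lra.
  by rewrite ler_piMl// ger0_norm; lra.
Qed.

Lemma approximable_bigcup (F : nat -> set E) :
  (forall n, smooth_approximable (F n)) -> smooth_approximable (\bigcup_n F n).
Proof.
move=> aF.
have aU n : smooth_approximable (\big[setU/set0]_(i < n) F i).
  elim: n => [|n ih]; last by rewrite big_ord_recr; exact: approximableU.
  rewrite big_ord0; split => // e e0; exists (fun x => 1 - 1 * 1).
    apply: smooth_cutoffC; split; last by move=> x; lra.
    rewrite (_ : (fun x => _) = fun x : E => \prod_(j < d) (cst 1 : R -> R) (x ord0 j)).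
      by apply: (@tensor_prod _ _ _ (fun=> cst 1)) => j k; exact: class_C_cst.
    by apply/funext => x; rewrite big1// mulr1.
  by rewrite integral0_eq ?lee_fin ?ltW// => x _; rewrite indic0 mulr1 subrr subr0 normr0 mulr0.
apply: (approximable_limit aU).
  by apply: bigcupT_measurable => n; case: (aF n).
move=> x; rewrite indicE; case: (boolP (x \in _)) => [/set_mem[m _ Fmx]|].
  apply: cvg_near_cst; exists m.+1 => // n /= mn.
  rewrite indicE mem_set// -bigcup_mkord; exists m => //.
rewrite notin_setE => Fx; apply: cvg_near_cst; near=> n.
rewrite indicE memNset// -bigcup_mkord => -[m _ Fmx]; apply: Fx; exists m => //.
Unshelve. all: by end_near. Qed.

Lemma box_cutoff_approx a b (e : R) : 0 < e -> exists n,
  (\int[mu]_x (w x * `|\1_(box a b) x - box_cutoff a b n x|)%:E <= e%:E)%E.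
Proof.
move=> e0; have mb := measurable_box a b.
have mf n : measurable_fun setT (fun x => \1_(box a b) x - box_cutoff a b n x : R).
  apply: measurable_funB; first exact: measurable_indic.
  exact: measurable_smooth_cutoff (box_cutoff_smooth _ _ _).
have b1 n x : `|\1_(box a b) x - box_cutoff a b n x : R| <= 1.
  have /andP[? ?] := box_cutoff01 a b n x.
  by rewrite indicE ler_norml; case: (_ \in _) => /=; lra.
have c1 x : (\1_(box a b) x - box_cutoff a b n x : R) @[n --> \oo] --> (0 : R).
  rewrite -(subrr (\1_(box a b) x)); apply: cvgB; first exact: cvg_cst.
  exact: box_cutoff_cvg.
exact: dominated_small.
Qed.

Lemma approximable_box a b : smooth_approximable (box a b).
Proof.
split; first exact: measurable_box.
move=> e e0; have [n nA] := box_cutoff_approx a b e0.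
by exists (box_cutoff a b n) => //; exact: box_cutoff_smooth.
Qed.

End density.

Section density_of_smooth_functions.
Context (R : realType) (d : nat).
Local Notation E := 'rV[R]_d.
Local Notation mu := (@lebesgue_rV R d).

Definition rat_box (q : {ffun 'I_d -> rat * rat}) : set E :=
  box (fun i => ratr (q i).1) (fun i => ratr (q i).2).

Lemma rat_box_nbhs (A : set E) (v : E) : nbhs v A ->
  exists2 q, rat_box q v & rat_box q `<=` A.
Proof.
move=> /nbhs_ballP[e /= e0 veA].
have qP i : exists q : rat * rat,
    v ord0 i - e < ratr q.1 < v ord0 i /\ v ord0 i < ratr q.2 < v ord0 i + e.
  have /rat_in_itvoo[q1] : v ord0 i - e < v ord0 i by rewrite ltrBlDr ltrDl.
  have /rat_in_itvoo[q2] : v ord0 i < v ord0 i + e by rewrite ltrDl.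
  by rewrite !in_itv/= => h2 h1; exists (q1, q2).
pose q := [ffun i => projT1 (cid (qP i))].
have qE i : v ord0 i - e < ratr (q i).1 < v ord0 i /\
    v ord0 i < ratr (q i).2 < v ord0 i + e.
  by rewrite /q ffunE; exact: (projT2 (cid (qP i))).
exists q => [i|w qw].
  by have [/andP[h1 h2] /andP[h3 h4]] := qE i; rewrite h2.
apply: veA; split => // i j; rewrite (ord1 i).
have [/andP[h1 h2] /andP[h3 h4]] := qE j; have /andP[h5 h6] := qw j.
by rewrite -ball_normE/= distrC ltr_distl; apply/andP; split; lra.
Qed.

Lemma open_bigcup_box (A : set E) : open A ->
  exists F : nat -> set E, A = \bigcup_n F n /\
    forall n, F n = set0 \/ exists a b, F n = box a b.
Proof.
move=> oA.
exists (fun n => if unpickle n is Some q then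
  if `[< rat_box q `<=` A >] then rat_box q else set0 else set0); split; last first.
  move=> n; case: (unpickle n) => [q|]; last by left.
  by case: ifP => _; [right; do 2 eexists|left].
apply/seteqP; split=> [v Av|v [n _]]; last first.
  by case: (unpickle n) => // q; case: ifP => // /asboolP; exact.
have [q qv qA] := rat_box_nbhs (open_nbhs_nbhs (conj oA Av)).
by exists (pickle q) => //; rewrite pickleK asboolT.
Qed.

(** The approximable sets form a sigma-algebra containing the boxes, countable
unions of which give all the open sets. *)
Lemma measurable_approximable (w : E -> R) (A : set E) :
  mu.-integrable setT (EFin \o w) -> (forall x, 0 <= w x) ->
  measurable A -> smooth_approximable w A.
Proof.
move=> iw w0.
have H0 : smooth_approximable w (set0 : set E).
  have aB := approximable_box iw w0 (fun=> 0) (fun=> 0).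
  have := approximableC (approximableU iw w0 aB (approximableC aB)).
  by rewrite setUv setCT.
have S : <<s (@open E) >> `<=` [set A | smooth_approximable w A].
  apply: smallest_sub.
    split => //=.
    - by move=> B hB; rewrite setTD; exact: approximableC.
    - by move=> F hF; exact: approximable_bigcup.
  move=> B /open_bigcup_box[F [-> hF]] /=.
  apply: approximable_bigcup => // n.
  by have [->|[a [b ->]]] := hF n; [|exact: approximable_box].
exact: S.
Qed.

End density_of_smooth_functions.

(** Testing against [chi (2 psi - 1)] instead of the sign [2 s - 1] cut off by [t]
costs at most the distances from [psi] to [s] and from [chi] to [t]. *)
Lemma sign_test_le (R : realDomainType) (s t chi psi : R) :
  s = 0 \/ s = 1 -> t = 0 \/ t = 1 -> 0 <= chi <= 1 -> 0 <= psi <= 1 ->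
  t <= (2 * s - 1) * (chi * (psi + -1 * (1 - psi))) +
    (`|s - psi| + `|s - psi| + `|t - chi|).
Proof.
move=> s01 t01 /andP[c0 c1] /andP[q0 q1].
have hs : `|s - psi| = (2 * s - 1) * (s - psi).
  by case: s01 => ->; [rewrite ler0_norm|rewrite ger0_norm]; lra.
have ht : `|t - chi| = (2 * t - 1) * (t - chi).
  by case: t01 => ->; [rewrite ler0_norm|rewrite ger0_norm]; lra.
rewrite hs ht.
have h1 : 0 <= (1 - chi) * (1 - psi) by rewrite mulr_ge0 ?subr_ge0.
have h2 : 0 <= chi * psi by rewrite mulr_ge0.
have h3 : 0 <= (1 - chi) * psi by rewrite mulr_ge0 ?subr_ge0.
have h4 : 0 <= chi * (1 - psi) by rewrite mulr_ge0 ?subr_ge0.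
by case: s01 => ->; case: t01 => ->; lra.
Qed.

(** * Increments of functions of bounded variation *)

Section increments.
Context (R : realType) (d : nat).
Local Notation E := 'rV[R]_d.
Local Notation mu := (@lebesgue_rV R d).
Local Notation e_ i := (delta_mx ord0 i : E).
Context (Omega : set E) (u : E -> R) (p : E) (r : R) (i : 'I_d).
Context (nu : {charge set E -> \bar R}) (C : R).
Local Notation B := (cube p r).
Context (mOmega : measurable Omega) (mu_ : measurable_fun setT u)
  (iu : mu.-integrable B (EFin \o u)) (BO : closed_cube p r `<=` Omega)
  (Cnu : forall (D : set E) (f : E -> R) (M : R),
    measurable D -> measurable_fun setT f -> 0 <= M -> (forall x, `|f x| <= M) ->
    (`| charge_integral nu D (EFin \o f) | <= (M * C)%:E)%E)
  (du : forall phi, test_function Omega phi ->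
    (\int[mu]_(x in Omega) (u x * partial i phi x)%:E =
     - charge_integral nu Omega (EFin \o phi))%E).

Let U x := u x * \1_B x.

Let mB : measurable B. Proof. exact: measurable_cube. Qed.

Let mU : measurable_fun setT U.
Proof. by apply: measurable_funM => //; exact: measurable_indic. Qed.

Let iU : mu.-integrable setT (EFin \o U). Proof. exact: integrable_indicM. Qed.

Definition common_cube (z : E) : set E := [set x | B x /\ B (x + z)].

(** The increment [w] is tested against a smooth approximation of its sign,
[2 psi - 1] with [psi] close to [1_(w > 0)], cut off near the boundary of the
common part of the cube and its translate. *)
Lemma increment_along_axis (tau : R) : 0 < tau ->
  (\int[mu]_x (`|u (x + tau *: e_ i)%R - u x| *
     \1_(common_cube (tau *: e_ i)) x)%:E <= (tau * C)%:E)%E.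
Proof.
move=> tau0; set v := e_ i; pose w x := U (x + tau *: v) - U x.
pose a j := p ord0 j - r; pose b j := p ord0 j + r - tau * (j == i)%:R.
have BE : common_cube (tau *: v) = box a b.
  apply/seteqP; split=> x /=.
    move=> [xB xvB] j; have := xB j; have := xvB j; rewrite !mxE eqxx/= /a /b.
    by rewrite !ltr_distl => /andP[h1 h2] /andP[h3 h4]; apply/andP; split; lra.
  move=> xab; split=> j; have := xab j; rewrite ?mxE ?eqxx/= ltr_distl /a /b.
    have : 0 <= tau * (j == i)%:R by rewrite mulr_ge0// ltW.
    by move=> h1 /andP[h2 h3]; apply/andP; split; lra.
  have : 0 <= tau * (j == i)%:R by rewrite mulr_ge0// ltW.
  by move=> h1 /andP[h2 h3]; apply/andP; split; lra.
have mBox := measurable_box a b.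
have mUt : measurable_fun setT (fun x : E => U (x + tau *: v)).
  exact: (measurableT_comp mU (measurable_translate _)).
have iUt := integrable_translate (tau *: v) iU.
have iw : mu.-integrable setT (EFin \o w).
  by rewrite (_ : _ \o _ = (EFin \o (fun x : E => U (x + tau *: v))) \- (EFin \o U))%E//; exact: integrableB.
have mw : measurable_fun setT w by exact: measurable_funB.
have iaw : mu.-integrable setT (EFin \o (fun x => `|w x|)) by exact: integrable_abse iw.
have aw0 x : 0 <= `|w x| by [].
have mP : measurable [set x | 0 < w x].
  by rewrite -[X in measurable X]setTI; exact: measurable_fun_ltr.
apply/lee_addgt0Pr => e e0.
have e3 : 0 < e / 3 by rewrite divr_gt0.
have [psi spsi psie] := (measurable_approximable iaw aw0 mP).2 _ e3.
have mf n : measurable_fun setT (fun x => \1_(box a b) x - box_cutoff a b n x : R).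
  apply: measurable_funB; first exact: measurable_indic.
  exact: measurable_smooth_cutoff (box_cutoff_smooth _ _ _).
have [n chie] := box_cutoff_approx iaw aw0 a b e3.
set chi := box_cutoff a b n in chie.
pose psi' x := chi x * (psi x + -1 * (1 - psi x)).
have [m ma] : exists m, forall j, m <= a j.
  exists (\big[Order.min/0]_j a j) => j; exact: bigmin_le_cond.
have tpsi' : tensor_sum (smooth1_from m) psi'.
  apply: (@tensor_sumM _ _ (smooth1_from m) (@smooth1 R)).
  - move=> h k [sh h0] sk; split; first by move=> l; exact: class_CM.
    by move=> t tm; rewrite h0// mul0r.
  - exact: box_cutoff_tensor.
  - by apply: tensor_add spsi.1 (tensor_scale _ (smooth_cutoffC spsi).1).
have chi01 x : 0 <= chi x <= 1 by exact: box_cutoff01.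
have psi'1 x : `|psi' x| <= 1.
  rewrite normrM mulr_ile1//; first by rewrite ger0_norm; have := chi01 x; lra.
  by rewrite ler_norml; have := spsi.2 x; lra.
have psi'B x : psi' x != 0 -> B x /\ B (x + tau *: v).
  by rewrite mulf_eq0 negb_or => /andP[/box_cutoff_supp]; rewrite -BE.
have key := increment_against_test mOmega mu_ iu BO Cnu du tau0 tpsi' psi'1 psi'B.
have mpsi' : measurable_fun setT psi'.
  apply: measurable_funM.
    exact: measurable_smooth_cutoff (box_cutoff_smooth _ _ _).
  apply: measurable_funD; first exact: measurable_smooth_cutoff.
  apply: measurable_funM => //; apply: measurable_funB => //.
  exact: measurable_smooth_cutoff.
have iwp : mu.-integrable setT (fun x => (w x * psi' x)%:E).
  apply: (le_integrable _ _ _ iw) => //.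
    by apply/measurable_EFinP; exact: measurable_funM.
  by move=> x _ /=; rewrite lee_fin normrM ler_piMr.
pose D1 x := (`|w x| * `|\1_[set x | 0 < w x] x - psi x|)%:E.
pose D2 x := (`|w x| * `|\1_(box a b) x - chi x|)%:E.
have m1 : measurable_fun setT (fun x => \1_[set x | 0 < w x] x - psi x : R).
  apply: measurable_funB; first exact: measurable_indic.
  exact: measurable_smooth_cutoff.
have mwf (f : E -> R) : measurable_fun setT f ->
    measurable_fun setT (fun x => (`|w x| * `|f x|)%:E).
  move=> mf'; apply/measurable_EFinP; apply: measurable_funM => //.
    exact: measurableT_comp.
  exact: measurableT_comp.
have mD1 : measurable_fun setT D1 by exact: mwf.
have mD2 : measurable_fun setT D2 by exact: (mwf _ (mf n)).
have D10 x : (0 <= D1 x)%E by rewrite lee_fin mulr_ge0.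
have D20 x : (0 <= D2 x)%E by rewrite lee_fin mulr_ge0.
have iD1 : mu.-integrable setT D1.
  apply/integrableP; split => //; under eq_integral do rewrite gee0_abs//.
  exact: le_lt_trans psie (ltry _).
have iD2 : mu.-integrable setT D2.
  apply/integrableP; split => //; under eq_integral do rewrite gee0_abs//.
  exact: le_lt_trans chie (ltry _).
have iD : mu.-integrable setT (D1 \+ D1 \+ D2)%E.
  by apply: integrableD => //; exact: integrableD.
have iL : mu.-integrable setT (fun x => (`|u (x + tau *: v) - u x| *
     \1_(common_cube (tau *: v)) x)%:E).
  apply: (le_integrable _ _ _ iaw) => //.
    apply/measurable_EFinP; apply: measurable_funM; last first.
      by rewrite BE; exact: measurable_indic.
    apply: measurableT_comp => //; apply: measurable_funB => //.
    exact: (measurableT_comp mu_ (measurable_translate _)).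
  move=> x _; rewrite /= lee_fin normr_id indicE.
  case: (boolP (_ \in _)) => [/set_mem[xB xvB]|_]; last by rewrite mulr0 normr0.
  by rewrite mulr1 normr_id /w /U !indicE !mem_set// !mulr1.
have -> : ((tau * C)%:E + e%:E = (tau * C)%:E + (e / 3 + e / 3 + e / 3)%:E)%E.
  by congr (_ + _%:E)%E; lra.
apply: (@le_trans _ _ (\int[mu]_x ((w x * psi' x)%:E + (D1 \+ D1 \+ D2) x))%E).
  apply: le_integral => //; first exact: integrableD.
  move=> x _; rewrite /D1 /D2 /= -!EFinD lee_fin.
  have -> : `|u (x + tau *: v) - u x| * \1_(common_cube (tau *: v)) x =
      `|w x| * \1_(box a b) x :> R.
    rewrite BE !indicE; case: (boolP (_ \in _)); last by rewrite !mulr0.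
    rewrite -BE => /set_mem[xB xvB].
    by rewrite !mulr1 /w /U !indicE !mem_set// !mulr1.
  rewrite /psi'; set t := \1_(box a b) x; set s := \1_[set x | 0 < w x] x.
  have t01 : t = 0 \/ t = 1 by rewrite /t indicE; case: (_ \in _); [right|left].
  have [s01 wE] : (s = 0 \/ s = 1) /\ w x = `|w x| * (2 * s - 1).
    rewrite /s indicE; case: (boolP (_ \in _)) => [/set_mem/= h|].
      by split; [right|rewrite gtr0_norm//=; lra].
    rewrite notin_setE/= => /negP; rewrite -leNgt => h.
    by split; [left|rewrite ler0_norm//=; lra].
  have F := sign_test_le s01 t01 (chi01 x) (spsi.2 x).
  rewrite {2}wE -!mulrA -!mulrDr; exact: ler_wpM2l.
rewrite integralD//.
apply: leeD; first exact: le_trans (lee_abs _) key.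
rewrite (integralD measurableT (integrableD measurableT iD1 iD1) iD2).
by rewrite integralD// !EFinD; apply: leeD => //; exact: leeD.
Qed.

End increments.

Section norm.
Context (R : realType) (d : nat).
Local Notation E := 'rV[R]_d.
Local Notation N := (@euclidean_norm R d).

Lemma euclidean_norm_ge0 x : 0 <= N x. Proof. exact: sqrtr_ge0. Qed.

Lemma coord_le_euclidean_norm (x : E) i : `|x ord0 i| <= N x.
Proof.
rewrite -sqrtr_sqr /euclidean_norm ler_wsqrtr// (bigD1 i)//= lerDl.
by apply: sumr_ge0 => j _; exact: sqr_ge0.
Qed.

Lemma euclidean_norm_eq0 (x : E) : N x = 0 -> x = 0.
Proof.
move=> x0; apply/rowP => i; rewrite mxE; apply/eqP; rewrite -normr_le0 -x0.
exact: coord_le_euclidean_norm.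
Qed.

Lemma euclidean_normZ (t : R) x : 0 <= t -> N (t *: x) = t * N x.
Proof.
move=> t0; rewrite /euclidean_norm -[in RHS](ger0_norm t0) -sqrtr_sqr.
rewrite -sqrtrM ?sqr_ge0//; congr Num.sqrt; rewrite mulr_sumr.
by apply: eq_bigr => i _; rewrite mxE exprMn.
Qed.

Lemma measurable_euclidean_norm : measurable_fun setT N.
Proof.
apply: measurableT_comp.
  by apply: continuous_measurable_fun; exact: sqrt_continuous.
apply: measurable_sum => i; apply: measurable_funX; exact: measurable_coord_rV.
Qed.

End norm.

Section increments_in_all_directions.
Context (R : realType) (d : nat).
Local Notation E := 'rV[R]_d.
Local Notation mu := (@lebesgue_rV R d).
Local Notation e_ i := (delta_mx ord0 i : E).
Context (v : E -> R) (p : E) (r : R) (C : 'I_d -> R).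
Local Notation B := (cube p r).
Context (mv : measurable_fun setT v) (C0 : forall i, 0 <= C i)
  (axis : forall i (tau : R), 0 < tau ->
  (\int[mu]_x (`|v (x + tau *: e_ i)%R - v x| *
     \1_(common_cube p r (tau *: e_ i)) x)%:E <= (tau * C i)%:E)%E).

Lemma measurable_common_cube (z : E) : measurable (common_cube p r z).
Proof.
apply: measurableI; first exact: measurable_cube.
rewrite -[X in measurable X]setTI.
by apply: measurable_translate => //; exact: measurable_cube.
Qed.

Lemma measurable_increment (y z : E) :
  measurable_fun setT (fun x : E => (`|v (x + y) - v x| * \1_(common_cube p r z) x)%:E).
Proof.
apply/measurable_EFinP; apply: measurable_funM; last first.
  by apply: measurable_indic; exact: measurable_common_cube.
apply: measurableT_comp => //; apply: measurable_funB => //.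
exact: (measurableT_comp mv (measurable_translate _)).
Qed.

Lemma increment_along_axis_signed i (t : R) :
  (\int[mu]_x (`|v (x + t *: e_ i)%R - v x| *
     \1_(common_cube p r (t *: e_ i)) x)%:E <= (`|t| * C i)%:E)%E.
Proof.
have [t0|t0|->] := ltgtP t 0.
- rewrite ltr0_norm//; have Nt0 : 0 < - t by rewrite oppr_gt0.
  apply: le_trans (axis i Nt0); rewrite le_eqVlt; apply/orP; left; apply/eqP.
  rewrite -(integral_translate ((- t) *: e_ i)); last exact: measurable_increment.
  apply: eq_integral => x _; rewrite scaleNr subrK distrC !indicE.
  congr ((_ * _%:R)%:E); congr nat_of_bool; apply: asbool_equiv_eq.
  by rewrite /common_cube/= subrK; tauto.
- by rewrite gtr0_norm//; exact: axis.
- rewrite normr0 mul0r integral0_eq// => x _.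
  by rewrite scale0r addr0 subrr normr0 mul0r.
Qed.

(** Move along one coordinate after the other: the intermediate points stay in
the cube, and translations preserve the measure. *)
Lemma increment_in_direction (z : E) :
  (\int[mu]_x (`|v (x + z)%R - v x| * \1_(common_cube p r z) x)%:E <=
     (\sum_i (C i * euclidean_norm z))%:E)%E.
Proof.
pose zk k : E := \row_j (if (j < k)%N then z ord0 j else 0).
have zk0 : zk 0%N = 0 by apply/rowP => j; rewrite !mxE.
have zkd : zk d = z by apply/rowP => j; rewrite mxE ltn_ord.
have step k : (k <= d)%N ->
    (\int[mu]_x (`|v (x + zk k)%R - v x| * \1_(common_cube p r z) x)%:E <=
     (\sum_(i < d | (i < k)%N) `|z ord0 i| * C i)%:E)%E.
  elim: k => [_|k ih kd].
    rewrite zk0 big1//= integral0_eq// => x _.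
    by rewrite addr0 subrr normr0 mul0r.
  pose k' := Ordinal kd.
  have zkS : zk k.+1 = zk k + z ord0 k' *: e_ k'.
    apply/rowP => j; rewrite !mxE eqxx/= ltnS leq_eqVlt -(inj_eq val_inj)/=.
    case: eqVneq => [jk|jk]/=; last by rewrite mulr0 addr0.
    by rewrite jk ltnn add0r mulr1; congr (z _ _); exact/val_inj.
  have zkB x l : common_cube p r z x -> B (x + zk l).
    move=> [xB xzB] j; rewrite !mxE; case: ifP => _; last by rewrite addr0.
    by have := xzB j; rewrite mxE.
  pose g (y : E) := (`|v (y + z ord0 k' *: e_ k') - v y| *
     \1_(common_cube p r (z ord0 k' *: e_ k')) y)%:E.
  have mg : measurable_fun setT g by exact: measurable_increment.
  have g0 y : (0 <= g y)%E by rewrite lee_fin mulr_ge0.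
  rewrite (bigD1 k')//= ?leqnn// EFinD addeC.
  have -> : \sum_(i < d | (i < k.+1)%N && (i != k')) `|z ord0 i| * C i =
      \sum_(i < d | (i < k)%N) `|z ord0 i| * C i.
    apply: eq_bigl => i; rewrite ltnS leq_eqVlt -(inj_eq val_inj)/=.
    by case: ltngtP.
  apply: le_trans (leeD (ih (ltnW kd)) (increment_along_axis_signed k' (z ord0 k'))).
  rewrite -(ge0_integral_translate (zk k) mg g0) -ge0_integralD//; [|exact: measurable_increment|
    exact: (measurableT_comp mg (measurable_translate _))].
  apply: ge0_le_integral => //.
  - exact: measurable_increment.
  - apply: emeasurable_funD; first exact: measurable_increment.
    exact: (measurableT_comp mg (measurable_translate _)).
  move=> x _; rewrite /g -EFinD lee_fin !indicE.
  case: (boolP (x \in _)) => [/set_mem xz|_]; last by rewrite !mulr0 add0r mulr_ge0.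
  rewrite !mulr1 mem_set; last first.
    by split; [exact: zkB|rewrite -addrA -zkS; exact: zkB].
  by rewrite mulr1 -addrA -zkS [leRHS]addrC; exact: ler_distD.
have := step d (leqnn d); rewrite zkd => /le_trans; apply.
rewrite lee_fin big_mkcond/=; apply: ler_sum => i _; rewrite ltn_ord mulrC.
by rewrite ler_wpM2l// coord_le_euclidean_norm.
Qed.

End increments_in_all_directions.

Section increments_of_bv_functions.
Context (R : realType) (d : nat).
Local Notation E := 'rV[R]_d.
Local Notation mu := (@lebesgue_rV R d).

Lemma integrable_representative (Omega : set E) (u v : E -> R) (M : set E) (p : E) (r : R) :
  open Omega -> (\int[mu]_(x in Omega) `|u x|%:E < +oo)%E ->
  closed_cube p r `<=` Omega ->
  measurable M -> mu M = 0%E -> measurable_fun setT v ->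
  (forall x, Omega x -> ~ M x -> u x = v x) ->
  mu.-integrable (cube p r) (EFin \o v).
Proof.
move=> oO iu pO mM M0 mv uv; have mO := open_measurable_rV oO.
apply: (@integrableS _ _ _ _ Omega) => //; first exact: measurable_cube.
  by move=> x /cube_subset_closed/pO.
apply/integrableP; split; first by apply/measurable_EFinP; exact: measurable_funTS.
apply: le_lt_trans iu; rewrite le_eqVlt; apply/orP; left; apply/eqP.
by apply: (eq_integral_off_null mM M0) => x Ox Mx; rewrite /= uv.
Qed.

(** The distributional gradient does not see null sets, so that the estimate
along the axes applies to the Borel function [v]. *)
Lemma bv_increments (Omega : set E) (u v : E -> R) (M : set E) (p : E) (r : R) :
  open Omega -> BV Omega u -> closed_cube p r `<=` Omega ->
  measurable M -> mu M = 0%E -> measurable_fun setT v ->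
  (forall x, Omega x -> ~ M x -> u x = v x) ->
  exists2 C : R, 0 <= C & forall z : E,
    (\int[mu]_x (`|v (x + z)%R - v x| * \1_(common_cube p r z) x)%:E <=
     (C * euclidean_norm z)%:E)%E.
Proof.
move=> oO [[_ iu] [Du dDu]] pO mM M0 mv uv.
have mO := open_measurable_rV oO.
pose Cnu i := s2val (cid2 (charge_integral_bound (Du i))).
have Cnu0 i : 0 <= Cnu i := s2valP (cid2 (charge_integral_bound (Du i))).
have CnuP i := s2valP' (cid2 (charge_integral_bound (Du i))).
have iv := integrable_representative oO iu pO mM M0 mv uv.
have dv i phi : test_function Omega phi ->
    (\int[mu]_(x in Omega) (v x * partial i phi x)%:E =
     - charge_integral (Du i) Omega (EFin \o phi))%E.
  move=> /dDu <-; apply: (eq_integral_off_null mM M0) => x Ox Mx.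
  by rewrite uv.
have axis i (tau : R) : 0 < tau ->
    (\int[mu]_x (`|v (x + tau *: delta_mx ord0 i)%R - v x| *
      \1_(common_cube p r (tau *: delta_mx ord0 i)) x)%:E <= (tau * Cnu i)%:E)%E.
  by move=> tau0; apply: (increment_along_axis mO mv iv pO (CnuP i) (dv i)).
exists (\sum_i Cnu i); first exact: sumr_ge0.
move=> z; rewrite mulr_suml; exact: increment_in_direction.
Qed.

End increments_of_bv_functions.

(** * Cubes on which the function is not constant *)

Section cube_measure.
Context (R : realType) (d : nat).
Local Notation E := 'rV[R]_d.
Local Notation mu := (@lebesgue_rV R d).

Lemma lebesgue_cube (p : E) (r : R) : 0 < r -> mu (cube p r) = ((2 * r) ^+ d)%:E.
Proof.
move=> r0; pose A i := `](p ord0 i - r), (p ord0 i + r)[%classic.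
rewrite (_ : cube p r = [set x | forall i, A i (x ord0 i)]); last first.
  apply/seteqP; split=> x xp i; have := xp i; rewrite /A/= in_itv/= ltr_distl//.
rewrite lebesgue_rV_box; last by move=> i; exact: measurable_itv.
rewrite (eq_bigr (fun=> (2 * r)%:E)) => [|i _]; last first.
  rewrite /A lebesgue_measure_itv/= lte_fin ifT; last by lra.
  by rewrite -EFinB; congr EFin; lra.
elim: d {p A} => [|n ih]; first by rewrite big_ord0 expr0.
by rewrite big_ord_recr/= ih exprSr EFinM.
Qed.

Lemma ball_sub_cube (p : E) (r : R) : ball p r `<=` cube p r.
Proof.
move=> w [_ pw] i; have := pw ord0 i.
by rewrite -ball_normE/= distrC.
Qed.

End cube_measure.

Section nonconstant_cube.
Context (R : realType) (d : nat).
Local Notation E := 'rV[R]_d.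
Local Notation mu := (@lebesgue_rV R d).
Context (Omega : set E) (u : E -> R).
Context (oO : open Omega) (cO : connected Omega).

Let constant_near c : set E := [set p | exists2 r, 0 < r &
  closed_cube p r `<=` Omega /\ {ae mu, forall x, cube p r x -> u x = c}].

Let constant_near_open c : open (constant_near c).
Proof.
rewrite openE => p [r r0 [pO ac]]; apply/nbhs_ballP; exists (r / 2) => /=.
  by rewrite divr_gt0.
move=> q /ball_sub_cube qp; exists (r / 2); first by rewrite divr_gt0.
have sub x : closed_cube q (r / 2) x -> cube p r x.
  move=> qx i; have := qx i; have := qp i; rewrite ltr_distl ler_distl ltr_distl.
  by move=> /andP[h1 h2] /andP[h3 h4]; apply/andP; split; lra.
split; first by move=> x /sub/cube_subset_closed/pO.
by apply: filterS ac => x h /cube_subset_closed/sub.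
Qed.

Let constant_near_inj p c c' : constant_near c p -> constant_near c' p -> c = c'.
Proof.
move=> [r r0 [_ ac]] [r' r'0 [_ ac']]; apply/eqP; apply/negPn/negP => cc'.
pose s := Num.min r r'; have s0 : 0 < s by rewrite lt_min r0.
have : {ae mu, forall x, ~ cube p s x}.
  apply: filterS2 ac ac' => x h h' xs; move/eqP: cc'; apply.
  rewrite -h -?h'// => i; apply: lt_le_trans (xs i) _; by rewrite ge_min lexx ?orbT.
move=> [N [mN N0 sN]].
have : (mu (cube p s) <= mu N)%E.
  apply: le_measure; rewrite ?inE//; first exact: measurable_cube.
  by move=> x xs; apply: sN => /(_ xs).
rewrite N0 lebesgue_cube// lee_fin leNgt exprn_gt0//; lra.
Qed.

(** If [u] were constant on every small cube, the sets of points near which it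
takes a given value would be disjoint open sets covering the connected set
[Omega], hence only one of them would be nonempty; and [Omega] is covered by
countably many boxes on which [u] would be equal to that value up to a null
set. *)
Lemma nonconstant_on_some_cube : ~ essentially_constant Omega u ->
  exists p r, [/\ 0 < r, closed_cube p r `<=` Omega &
    ~ exists c, {ae mu, forall x, cube p r x -> u x = c}].
Proof.
move=> nc; apply: contrapT => H; apply: nc.
have {}H p r : 0 < r -> closed_cube p r `<=` Omega ->
    exists c, {ae mu, forall x, cube p r x -> u x = c}.
  by move=> r0 pO; apply: contrapT => h; apply: H; exists p, r.
have cn p : Omega p -> exists c, constant_near c p.
  move=> Op; have /nbhs_ballP[e /= e0 eO] := open_nbhs_nbhs (conj oO Op).
  have e2 : 0 < e / 2 by rewrite divr_gt0.
  have pO : closed_cube p (e / 2) `<=` Omega.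
    move=> x px; apply: eO; split => // i j; rewrite (ord1 i).
    rewrite -ball_normE/= distrC; apply: le_lt_trans (px j) _; lra.
  by have [c hc] := H _ _ e2 pO; exists c; exists (e / 2).
have [[p0 Op0]|Oe] := pselect (Omega !=set0); last first.
  by exists 0; apply: aeW => x Ox; exfalso; apply: Oe; exists x.
have [c0 c0p0] := cn _ Op0.
have cnO c p : constant_near c p -> Omega p.
  by move=> [r r0 [pO _]]; apply: pO => i; rewrite subrr normr0 ltW.
have OE : constant_near c0 = Omega.
  apply: cO; first by exists p0.
    exists (constant_near c0) => //.
    by rewrite setIidr//; exact: cnO.
  exists (~` \bigcup_(c in [set c | c <> c0]) constant_near c).
    by apply: open_closedC; apply: bigcup_open => c _; exact: constant_near_open.
  apply/seteqP; split=> p.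
    move=> h; split; first exact: cnO h.
    by move=> [c cc0] /constant_near_inj/(_ h).
  move=> [Op nh]; have [c hc] := cn _ Op.
  have [<-//|cc0] := pselect (c = c0).
  by exfalso; apply: nh; exists c.
exists c0.
have : mu.-negligible (\bigcup_n (if @unpickle {ffun 'I_d -> rat * rat} n is Some q then
    if `[< {ae mu, forall x, rat_box q x -> u x = c0} >]
    then ~` [set x | rat_box q x -> u x = c0] else set0 else set0 : set E)).
  apply: negligible_bigcup => n; case: unpickle => [q|]; last exact: negligible_set0.
  by case: ifP => [/asboolP//|_]; exact: negligible_set0.
apply: negligibleS => x /= /not_implyP[Ox ux].
have : constant_near c0 x by rewrite OE.
move=> [r r0 [_ ac]].
have [q qx qr] := @rat_box_nbhs R d (cube x r) x
  (filterS (@ball_sub_cube R d x r) (nbhsx_ballx x _ r0)).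
exists (pickle q) => //; rewrite pickleK asboolT//; first by move=> /(_ qx).
by apply: filterS ac => y h /qr.
Qed.

End nonconstant_cube.

(** * Pairs of points between which the function increases *)

Lemma ge0_integral0_ae d (T : measurableType d) (R : realType)
    (mu : {measure set T -> \bar R}) (f : T -> \bar R) :
  measurable_fun setT f -> (forall x, (0 <= f x)%E) ->
  (\int[mu]_x f x = 0)%E -> {ae mu, forall x, f x = 0%E}.
Proof.
move=> mf f0 If; have : (\int[mu]_x `|f x| = 0)%E.
  by rewrite -[RHS]If; apply: eq_integral => x _; rewrite gee0_abs.
by move/(ae_eq_integral_abs _ measurableT mf); apply: filterS => x /(_ I).
Qed.

Section null_sections.
Context d1 d2 (T1 : measurableType d1) (T2 : measurableType d2) (R : realType).
Context (m1 : {sigma_finite_measure set T1 -> \bar R}).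
Context (m2 : {sigma_finite_measure set T2 -> \bar R}).
Context (Y : set (T1 * T2)) (mY : measurable Y)
  (Y0 : (\int[m1 \x m2]_q (\1_Y q)%:E = 0)%E).

Let mYi : measurable_fun setT (fun q => (\1_Y q : R)%:E).
Proof. by apply/measurable_EFinP; exact: measurable_indic. Qed.

Let Yi0 q : (0 <= (\1_Y q : R)%:E)%E. Proof. by rewrite lee_fin. Qed.

Lemma ae_null_xsection : {ae m1, forall x, {ae m2, forall y, ~ Y (x, y)}}.
Proof.
move: Y0; rewrite fubini_tonelli1// => /ge0_integral0_ae h.
apply: filterS (h _ _) => [x||].
- move=> /ge0_integral0_ae h2; apply: filterS (h2 _ _) => [y||//].
    by rewrite indicE; case: (boolP (_ \in _)) => [_ [/eqP]|/negP h3 _ /mem_set//]; rewrite oner_eq0.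
  exact: (measurableT_comp mYi).
- exact: measurable_fun_fubini_tonelli_F.
- by move=> x; exact: integral_ge0.
Qed.

Lemma ae_null_ysection : {ae m2, forall y, {ae m1, forall x, ~ Y (x, y)}}.
Proof.
move: Y0; rewrite fubini_tonelli2// => /ge0_integral0_ae h.
apply: filterS (h _ _) => [x||].
- move=> /ge0_integral0_ae h2; apply: filterS (h2 _ _) => [y||//].
    by rewrite indicE; case: (boolP (_ \in _)) => [_ [/eqP]|/negP h3 _ /mem_set//]; rewrite oner_eq0.
  exact: (measurableT_comp mYi).
- exact: measurable_fun_fubini_tonelli_G.
- by move=> x; exact: integral_ge0.
Qed.

End null_sections.

Section increasing_pairs.
Context (R : realType) (d : nat).
Local Notation E := 'rV[R]_d.
Local Notation mu := (@lebesgue_rV R d).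
Local Notation N := (@euclidean_norm R d).
Context (v : E -> R) (mv : measurable_fun setT v).

(** The parameter [t] scales the step but not the shell where [z] lives, so that
steps of different lengths are averaged over the same set of vectors. *)
Definition steps (p : E) (r rho t : R) : set (E * E) :=
  [set q | [/\ cube p r q.1, cube p r (q.1 + t *: q.2) & rho <= N q.2 < 2 * rho]].

Lemma measurable_fun_add (t : R) :
  measurable_fun setT (fun q : E * E => q.1 + t *: q.2).
Proof. by apply: measurable_addZ; [exact: measurable_fst|exact: measurable_snd]. Qed.

Lemma measurable_preimage d' d'' (T : measurableType d') (T' : measurableType d'')
    (f : T -> T') (A : set T') :
  measurable_fun setT f -> measurable A -> measurable (f @^-1` A).
Proof. by move=> mf mA; rewrite -[X in measurable X]setTI; exact: mf. Qed.

Lemma measurable_steps p r rho t : measurable (steps p r rho t).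
Proof.
rewrite (_ : steps p r rho t = (fst @^-1` cube p r `&`
    (fun q : E * E => q.1 + t *: q.2) @^-1` cube p r) `&`
    (fun q : E * E => N q.2) @^-1` `[rho, 2 * rho[%classic); last first.
  apply/seteqP; split=> q /=; rewrite in_itv/=; first by case.
  by move=> [[]].
apply: measurableI; first apply: measurableI.
- by apply: measurable_preimage; [exact: measurable_fst|exact: measurable_cube].
- by apply: measurable_preimage; [exact: measurable_fun_add|exact: measurable_cube].
- apply: measurable_preimage; last exact: measurable_itv.
  exact: (measurableT_comp (@measurable_euclidean_norm R d) measurable_snd).
Qed.

(** The cap at [1] makes the rise bounded: it will be compared with [s |z|], which
is at least [1] for the slopes [s] under consideration. *)
Definition capped_rise (q : E * E) : R := Num.min (Num.max (v (q.1 + q.2) - v q.1) 0) 1.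

Lemma capped_rise01 q : 0 <= capped_rise q <= 1.
Proof. by rewrite /capped_rise le_min ge_min lexx ler01 orbT le_max lexx orbT. Qed.

Lemma measurable_capped_rise : measurable_fun setT capped_rise.
Proof.
apply: measurable_minr => //; apply: measurable_maxr => //.
apply: measurable_funB.
  apply: (measurableT_comp mv).
  rewrite (_ : (fun x => _) = fun q : E * E => q.1 + 1 *: q.2).
    exact: measurable_fun_add.
  by apply/funext => q; rewrite scale1r.
exact: (measurableT_comp mv measurable_fst).
Qed.

(** If [v y > v x] for almost no pair of points of the cube, then also [v y < v x]
for almost no pair by symmetry, and by Fubini's theorem almost every point [x]
satisfies [v y = v x] for almost every [y]. The possible lengths of the steps
are covered by the countably many shells with [rho] rational. *)
Lemma nonconstant_rise (p : E) (r : R) : 0 < r ->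
  (~ exists c, {ae mu, forall x, cube p r x -> v x = c}) ->
  exists2 rho, 0 < rho &
    (0 < \int[mu \x mu]_q (capped_rise q * \1_(steps p r rho 1) q)%:E)%E.
Proof.
move=> r0 nc; apply: contrapT => H; apply: nc.
have {}H rho : 0 < rho -> (\int[mu \x mu]_q
    (capped_rise q * \1_(steps p r rho 1) q)%:E = 0)%E.
  move=> rho0; apply/eqP; rewrite eq_le; apply/andP; split.
    by rewrite leNgt; apply/negP => h; apply: H; exists rho.
  apply: integral_ge0 => q _; rewrite lee_fin mulr_ge0//.
  by have /andP[] := capped_rise01 q.
pose rn n : R := ratr (odflt 0 (@unpickle rat n)).
pose Z n : set (E * E) := if 0 < rn n then
  [set q | steps p r (rn n) 1 q /\ v q.1 < v (q.1 + q.2)] else set0.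
have Zneg n : (mu \x mu)%E.-negligible (Z n).
  rewrite /Z; case: ifPn => rn0; last exact: negligible_set0.
  have := H _ rn0.
  set f := fun q => (capped_rise q * \1_(steps p r (rn n) 1) q)%:E.
  move=> If0.
  have mf : measurable_fun setT f.
    apply/measurable_EFinP; apply: measurable_funM.
      exact: measurable_capped_rise.
    by apply: measurable_indic; exact: measurable_steps.
  have f0 q : (0 <= f q)%E.
    by rewrite lee_fin mulr_ge0//; have /andP[] := capped_rise01 q.
  move: (ge0_integral0_ae mf f0 If0).
  apply: negligibleS => q /= [qs qv].
  rewrite /f => -[]; rewrite indicE mem_set// mulr1 /capped_rise => /eqP.
  rewrite gt_eqF// lt_min ltr01 andbT lt_max subr_gt0 qv//.
pose Z' : set (E * E) := [set q | [/\ cube p r q.1, cube p r (q.1 + q.2) &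
  v q.1 < v (q.1 + q.2)]].
have Z'neg : (mu \x mu)%E.-negligible Z'.
  apply: negligibleS (negligible_bigcup Zneg) => q [xB yB vq].
  have Nq : 0 < N q.2.
    rewrite lt_neqAle euclidean_norm_ge0 andbT eq_sym; apply/negP => /eqP.
    by move=> /euclidean_norm_eq0 q2; move: vq; rewrite q2 addr0 ltxx.
  have : N q.2 / 2 < N q.2 by lra.
  move=> /rat_in_itvoo[rho]; rewrite in_itv/= => /andP[h1 h2].
  have hr : rn (pickle rho) = ratr rho by rewrite /rn pickleK.
  exists (pickle rho) => //; rewrite /Z hr ifT; last by lra.
  split => //; split; rewrite ?scale1r//; apply/andP; split; lra.
(* in the variables (x, y) = (x, x + z) *)
pose Y : set (E * E) := [set q | [/\ cube p r q.1, cube p r q.2 & v q.1 < v q.2]].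
have mY : measurable Y.
  rewrite (_ : Y = (fst @^-1` cube p r `&` snd @^-1` cube p r) `&`
      [set q : E * E | v q.1 < v q.2]); last first.
    by apply/seteqP; split=> q /=; [case|move=> [[]]].
  apply: measurableI; first apply: measurableI.
  - by apply: measurable_preimage; [exact: measurable_fst|exact: measurable_cube].
  - by apply: measurable_preimage; [exact: measurable_snd|exact: measurable_cube].
  - rewrite -[X in measurable X]setTI; apply: measurable_fun_ltr => //.
      exact: (measurableT_comp mv measurable_fst).
    exact: (measurableT_comp mv measurable_snd).
have mYi : measurable_fun setT (fun q => (\1_Y q : R)%:E).
  by apply/measurable_EFinP; exact: measurable_indic.
have Y0 q : (0 <= (\1_Y q : R)%:E)%E by rewrite lee_fin.
have IY : (\int[mu \x mu]_q (\1_Y q)%:E = 0)%E.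
  rewrite -ge0_integral_shift2//.
  have [M [mM M0 ZM]] := Z'neg.
  rewrite -(@integral0 _ _ _ (mu \x mu)%E setT).
  apply: (eq_integral_off_null mM M0) => q _ Mq.
  rewrite indicE memNset// => -[h1 h2 h3]; apply: Mq; apply: ZM; split => //.
have good : {ae mu, forall x, cube p r x ->
    {ae mu, forall y, cube p r y -> v y = v x}}.
  apply: filterS2 (ae_null_xsection mY IY) (ae_null_ysection mY IY) => x h1 h2 xB.
  apply: filterS2 h1 h2 => y h1 h2 yB; apply/eqP; rewrite eq_le.
  by apply/andP; split; rewrite leNgt; apply/negP => h; [apply: h1|apply: h2].
apply: contrapT => nc; move: good => [M [mM M0 BM]].
have : (mu (cube p r) <= mu M)%E.
  apply: le_measure; rewrite ?inE//; first exact: measurable_cube.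
  by move=> x xs; apply: BM => /(_ xs) h; apply: nc; exists (v x).
rewrite M0 lebesgue_cube// lee_fin leNgt exprn_gt0//; lra.
Qed.

End increasing_pairs.

(** * Averages over scaled steps *)

Lemma measurable_inv (R : realType) : measurable_fun setT (fun x : R => x^-1).
Proof.
rewrite -(setvU [set (0 : R)]); apply/measurable_funU => //.
  exact: measurableC.
split; last exact: measurable_fun_set1.
apply: open_continuous_measurable_fun.
  by apply: closed_openC; exact: closed_eq.
move=> x; rewrite inE/= => /eqP x0; exact: inv_continuous.
Qed.

Lemma measurable_boolR (R : realType) d (T : measurableType d) (f : T -> bool) :
  measurable_fun setT f -> measurable_fun setT (fun x => (f x)%:R : R).
Proof.
move=> mf; rewrite (_ : (fun x => _) = \1_(f @^-1` [set true])).
  by apply: measurable_indic; exact: measurable_preimage.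
apply/funext => x; rewrite indicE; congr (nat_of_bool _)%:R.
by apply/idP/idP => [fx|/set_mem//]; rewrite inE.
Qed.

Section averages.
Context (R : realType) (d : nat).
Local Notation E := 'rV[R]_d.
Local Notation mu := (@lebesgue_rV R d).
Local Notation N := (@euclidean_norm R d).
Context (p : E) (r rho : R) (rho0 : 0 < rho).
Implicit Types (s t c : R) (phi psi : E * E -> R).

Lemma measurable_norm_snd : measurable_fun setT (fun q : E * E => N q.2).
Proof. exact: (measurableT_comp (@measurable_euclidean_norm R d) measurable_snd). Qed.

Lemma measurable_shell (a b : R) :
  measurable_fun setT (fun q : E * E => (a <= N q.2 < b)%R%:R : R).
Proof.
have mN := measurable_norm_snd; apply: measurable_boolR; apply: measurable_and.
  by apply: measurable_fun_ler => //; exact: measurable_cst.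
by apply: measurable_fun_ltr => //; exact: measurable_cst.
Qed.

Lemma measurable_kernel phi : measurable_fun setT phi ->
  measurable_fun setT (fun q : E * E => phi q / N q.2 ^+ d).
Proof.
move=> mphi; apply: measurable_funM => //.
apply: (measurableT_comp (@measurable_inv R)); apply: measurable_funX.
exact: measurable_norm_snd.
Qed.

(** An average up to normalization: the domain of integration has bounded
measure for all [t]. *)
Definition average (t : R) (phi : E * E -> R) : \bar R :=
  (\int[mu \x mu]_q (phi (q.1, t *: q.2) * \1_(steps p r rho t) q)%:E)%E.

Definition common_pairs : set (E * E) :=
  [set q | cube p r q.1 /\ cube p r (q.1 + q.2)].

Lemma measurable_fun_add1 : measurable_fun setT (fun q : E * E => q.1 + q.2).
Proof.
rewrite (_ : (fun x => _) = fun q : E * E => q.1 + 1 *: q.2).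
  exact: measurable_fun_add.
by apply/funext => q; rewrite scale1r.
Qed.

Lemma measurable_common_pairs : measurable common_pairs.
Proof.
apply: measurableI.
  by apply: measurable_preimage; [exact: measurable_fst|exact: measurable_cube].
by apply: measurable_preimage; [exact: measurable_fun_add1|exact: measurable_cube].
Qed.

Lemma measurable_fun_scale2 (t : R) :
  measurable_fun setT (fun q : E * E => (q.1, t *: q.2)).
Proof.
apply: measurable_fun_pair; first exact: measurable_fst.
rewrite (_ : (fun x => _) = fun q : E * E => 0 + t *: q.2).
  by apply: measurable_addZ => //; exact: measurable_snd.
by apply/funext => q; rewrite add0r.
Qed.

Lemma measurable_fun_shear (s : R) :
  measurable_fun setT (fun q : E * E => (q.1 + s *: q.2, q.2)).
Proof. by apply: measurable_fun_pair; [exact: measurable_fun_add|exact: measurable_snd]. Qed.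

Lemma measurable_average_integrand (t : R) (phi : E * E -> R) : measurable_fun setT phi ->
  measurable_fun setT (fun q : E * E => (phi (q.1, t *: q.2) * \1_(steps p r rho t) q)%:E).
Proof.
move=> mphi; apply/measurable_EFinP; apply: measurable_funM.
  exact: (measurableT_comp mphi (measurable_fun_scale2 t)).
by apply: measurable_indic; exact: measurable_steps.
Qed.

Lemma average_ge0 t phi : (forall q, 0 <= phi q) -> (0 <= average t phi)%E.
Proof. by move=> phi0; apply: integral_ge0 => q _; rewrite lee_fin mulr_ge0. Qed.

Lemma le_average t phi psi : measurable_fun setT phi -> measurable_fun setT psi ->
  (forall q, 0 <= phi q) -> (forall q, phi q <= psi q) ->
  (average t phi <= average t psi)%E.
Proof.
move=> mphi mpsi phi0 le; apply: ge0_le_integral => //.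
- by move=> q _; rewrite lee_fin mulr_ge0.
- exact: measurable_average_integrand.
- exact: measurable_average_integrand.
- by move=> q _; rewrite lee_fin ler_wpM2r.
Qed.

Lemma averageZ t c phi : 0 <= c -> measurable_fun setT phi -> (forall q, 0 <= phi q) ->
  average t (fun q => c * phi q) = (c%:E * average t phi)%E.
Proof.
move=> c0 mphi phi0; rewrite /average -ge0_integralZl//.
- by apply: eq_integral => q _; rewrite -EFinM mulrA.
- exact: measurable_average_integrand.
- by move=> q _; rewrite lee_fin mulr_ge0.
Qed.

Lemma averageD t phi psi : measurable_fun setT phi -> measurable_fun setT psi ->
  (forall q, 0 <= phi q) -> (forall q, 0 <= psi q) ->
  average t (fun q => phi q + psi q) = (average t phi + average t psi)%E.
Proof.
move=> mphi mpsi phi0 psi0; rewrite /average -ge0_integralD//.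
- by apply: eq_integral => q _; rewrite -EFinD mulrDl.
- by move=> q _; rewrite lee_fin mulr_ge0.
- exact: measurable_average_integrand.
- by move=> q _; rewrite lee_fin mulr_ge0.
- exact: measurable_average_integrand.
Qed.

(** A step of length [t |z|] starting at [x + s z] is one starting at a point
of the cube, and translations preserve Lebesgue measure. *)
Lemma shifted_average (s t : R) phi : 0 <= s -> 0 <= t -> s + t <= 1 ->
  measurable_fun setT phi -> (forall q, 0 <= phi q) ->
  (\int[mu \x mu]_(q in [set: E * E]) (phi (q.1 + s *: q.2, t *: q.2)%R *
     \1_(steps p r rho 1) q)%:E <= average t phi)%E.
Proof.
move=> s0 t0 st mphi phi0.
have mg := measurable_average_integrand t mphi.
rewrite /average -(ge0_integral_shear s mg); last first.
  by move=> q; rewrite lee_fin mulr_ge0.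
apply: ge0_le_integral => //.
- by move=> q _; rewrite lee_fin mulr_ge0.
- apply/measurable_EFinP; apply: measurable_funM; last first.
    by apply: measurable_indic; exact: measurable_steps.
  apply: (measurableT_comp mphi).
  apply: (measurableT_comp (measurable_fun_scale2 t) (measurable_fun_shear s)).
- exact: (measurableT_comp mg (measurable_fun_shear s)).
- move=> q _; rewrite lee_fin; apply: ler_wpM2l => //.
  rewrite !indicE; case: (boolP (q \in _)) => // /set_mem [xB yB Nz].
  rewrite mem_set//; split => //=.
    by apply: cube_convex yB => //; rewrite s0/= (le_trans _ st)// lerDl.
  rewrite -addrA -scalerDl; apply: cube_convex yB => //.
  by rewrite st andbT addr_ge0.
Qed.

(** The change of variables [z := t z] turns the average over steps of length
comparable to [t rho] into an integral for the kernel [1 / |z|^d]. *)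
Lemma average_le_kernel t phi : 0 < t -> measurable_fun setT phi ->
  (forall q, 0 <= phi q) ->
  (average t phi <= ((2 * rho) ^+ d)%:E * \int[mu \x mu]_q
    (phi q * \1_common_pairs q * (t * rho <= N q.2 < 2 * (t * rho))%R%:R
      / N q.2 ^+ d)%:E)%E.
Proof.
move=> t0 mphi phi0; have t0' := ltW t0.
pose g q := phi q * \1_common_pairs q * (t * rho <= N q.2 < 2 * (t * rho))%R%:R.
have mg : measurable_fun setT g.
  apply: measurable_funM; last exact: measurable_shell.
  by apply: measurable_funM => //; apply: measurable_indic; exact: measurable_common_pairs.
have g0 q : 0 <= g q by rewrite !mulr_ge0.
have -> : average t phi = (\int[mu \x mu]_q (g (q.1, t *: q.2))%:E)%E.
  apply: eq_integral => q _; congr EFin; rewrite /g -mulrA; congr (_ * _).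
  rewrite !indicE /= euclidean_normZ// mulrCA !ler_pM2l// !ltr_pM2l//.
  rewrite -natrM mulnb; congr (nat_of_bool _)%:R.
  apply/idP/idP => [/set_mem[h1 h2 h3]|/andP[/set_mem[h1 h2] h3]].
    by rewrite h3 andbT inE.
  by rewrite inE.
rewrite (@ge0_integral_scale2 _ _ t (fun q => (g q)%:E))//; last exact/measurable_EFinP.
have td0 : 0 <= t ^- d by rewrite invr_ge0 exprn_ge0.
have rd0 : 0 <= (2 * rho) ^+ d by rewrite exprn_ge0// mulr_ge0// ltW.
have h0 q : 0 <= g q / N q.2 ^+ d.
  by rewrite mulr_ge0// invr_ge0 exprn_ge0// euclidean_norm_ge0.
rewrite -!ge0_integralZl//; last first.
- by move=> q _; rewrite lee_fin.
- exact/measurable_EFinP.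
- by move=> q _; rewrite lee_fin; exact: h0.
- by apply/measurable_EFinP; exact: measurable_kernel.
apply: ge0_le_integral => //.
- by move=> q _; rewrite mule_ge0// lee_fin.
- by apply: measurable_funeM; exact/measurable_EFinP.
- by apply: measurable_funeM; apply/measurable_EFinP; exact: measurable_kernel.
move=> q _; rewrite -!EFinM lee_fin /g.
case: (boolP (_ <= _ < _)) => [/andP[h1 h2]|_]; last by rewrite !mulr0 mul0r mulr0.
rewrite mulr1; set X := phi q * _; have X0 : 0 <= X by rewrite mulr_ge0.
rewrite [leRHS]mulrCA mulrC ler_wpM2l//.
have Nq : 0 < N q.2 by apply: lt_le_trans h1; rewrite mulr_gt0.
rewrite ler_pdivlMr ?exprn_gt0// mulrC ler_pdivrMr ?exprn_gt0//.
rewrite -exprMn lerXn2r ?nnegrE ?(ltW Nq)//; first by rewrite !mulr_ge0// ltW.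
by rewrite ltW// (lt_le_trans h2)// mulrCA mulrC.
Qed.

End averages.

(** * Steep steps *)

Section difference_quotients.
Context (R : realType) (d : nat).
Local Notation E := 'rV[R]_d.
Local Notation mu := (@lebesgue_rV R d).
Local Notation N := (@euclidean_norm R d).
Context (p : E) (r rho C : R) (v : E -> R).
Local Notation B := (cube p r).
Local Notation average := (average p r rho).
Context (r0 : 0 < r) (rho0 : 0 < rho) (C0 : 0 <= C) (mv : measurable_fun setT v)
  (incr : forall z : E,
    (\int[mu]_x (`|v (x + z)%R - v x| * \1_(common_cube p r z) x)%:E <=
     (C * N z)%:E)%E).
Implicit Types (t M : R) (q : E * E).

Definition quotient (q : E * E) : R := (v (q.1 + q.2) - v q.1) / N q.2.

Lemma measurable_quotient : measurable_fun setT quotient.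
Proof.
apply: measurable_funM.
  apply: measurable_funB; last exact: (measurableT_comp mv measurable_fst).
  exact: (measurableT_comp mv (@measurable_fun_add1 R d)).
apply: (measurableT_comp (@measurable_inv R)).
exact: (measurableT_comp (@measurable_euclidean_norm R d) measurable_snd).
Qed.

Definition steep (M : R) (q : E * E) : R := (M < quotient q)%R%:R.

Lemma measurable_steep M : measurable_fun setT (steep M).
Proof.
apply: measurable_boolR; apply: measurable_fun_ltr; first exact: measurable_cst.
exact: measurable_quotient.
Qed.

Definition annulus : set E := [set z | rho <= N z < 2 * rho].

Lemma measurable_annulus : measurable annulus.
Proof.
rewrite (_ : annulus = N @^-1` `[rho, 2 * rho[%classic).
  by apply: measurable_preimage; [exact: measurable_euclidean_norm|exact: measurable_itv].
by apply/seteqP; split=> z /=; rewrite in_itv.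
Qed.

Lemma annulus_fin_num : mu annulus \is a fin_num.
Proof.
have r2 : 0 < 2 * rho by rewrite mulr_gt0.
rewrite ge0_fin_numE//; apply: (@le_lt_trans _ _ (mu (cube 0 (2 * rho)))).
  apply: le_measure; rewrite ?inE; [exact: measurable_annulus|exact: measurable_cube|].
  move=> z /andP[_ Nz] i; rewrite mxE subr0.
  exact: le_lt_trans (coord_le_euclidean_norm _ _) Nz.
by rewrite lebesgue_cube// ltry.
Qed.

Local Notation V0 := (fine (mu annulus)).

Lemma V0E : V0%:E = mu annulus. Proof. by rewrite fineK// annulus_fin_num. Qed.

(** Markov's inequality for the increments of [v]. *)
Lemma average_steep t M : 0 < t -> 0 < M ->
  (average t (steep M) <= (C / M * V0)%:E)%E.
Proof.
move=> t0 M0.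
have ms : measurable_fun setT (steep M) by exact: measurable_steep.
have mf := measurable_average_integrand p r rho t ms.
rewrite /average fubini_tonelli2//; last first.
  by move=> q; rewrite lee_fin mulr_ge0.
have -> : (C / M * V0)%:E = ((C / M)%:E * \int[mu]_z (\1_annulus z)%:E)%E.
  by rewrite EFinM V0E integral_indic ?setIT//; exact: measurable_annulus.
rewrite -ge0_integralZl//; last 2 first.
- by apply/measurable_EFinP; apply: measurable_indic; exact: measurable_annulus.
- by rewrite lee_fin divr_ge0// ltW.
apply: ge0_le_integral => //.
- move=> z _; apply: integral_ge0 => x _; rewrite lee_fin mulr_ge0//.
- apply: measurable_fun_fubini_tonelli_G => //.
  by move=> q; rewrite lee_fin mulr_ge0.
- apply: measurable_funeM; apply/measurable_EFinP; apply: measurable_indic.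
  exact: measurable_annulus.
move=> z _; rewrite /fubini_G/= indicE.
case: (boolP (z \in annulus)) => [/set_mem zV|]; last first.
  rewrite notin_setE => zV; rewrite mule0 integral0_eq// => x _.
  by rewrite indicE memNset ?mulr0// => -[].
have Nz : 0 < N z by move: zV => /andP[h _]; exact: lt_le_trans h.
have Ntz : N (t *: z) = t * N z by rewrite euclidean_normZ// ltW.
have Ntz0 : 0 < N (t *: z) by rewrite Ntz mulr_gt0.
rewrite mule1.
have -> : (C / M)%:E = ((M * N (t *: z))^-1%:E * (C * N (t *: z))%:E)%E.
  by rewrite -EFinM; congr EFin; field; rewrite !gt_eqF.
have iM0 : 0 <= (M * N (t *: z))^-1 by rewrite invr_ge0 mulr_ge0// ltW.
apply: (@le_trans _ _ ((M * N (t *: z))^-1%:E * \int[mu]_x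
   (`|v (x + t *: z)%R - v x| * \1_(common_cube p r (t *: z)) x)%:E)%E); last first.
  by apply: lee_wpmul2l => //; exact: incr.
rewrite -ge0_integralZl//; last exact: measurable_increment.
apply: ge0_le_integral => //.
- by move=> x _; rewrite lee_fin mulr_ge0.
- exact: (measurableT_comp mf (pair2_measurable z)).
- by apply: measurable_funeM; exact: measurable_increment.
move=> x _; rewrite -EFinM lee_fin mulrA !indicE.
case: (boolP ((x, z) \in _)) => [/set_mem[/= h1 h2 _]|_]; last first.
  by rewrite mulr0 !mulr_ge0.
rewrite mem_set// !mulr1 /steep /quotient/=; case: ltP => /= [|_]; last by rewrite mulr_ge0.
rewrite ltr_pdivlMr// => h; rewrite mulrC ler_pdivlMr ?mulr_gt0// mul1r.
by apply: le_trans (ltW h) (ler_norm _).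
Qed.

Lemma average1 t : (average t (fun=> 1%R) <= ((2 * r) ^+ d * V0)%:E)%E.
Proof.
have mBV : measurable (B `*` annulus).
  by apply: measurableX; [exact: measurable_cube|exact: measurable_annulus].
have -> : ((2 * r) ^+ d * V0)%:E = (\int[mu \x mu]_q (\1_(B `*` annulus) q)%:E)%E.
  rewrite integral_indic// setIT [RHS]product_measure1E//; last 2 first.
  - exact: measurable_cube.
  - exact: measurable_annulus.
  by rewrite EFinM V0E -(lebesgue_cube p r0).
apply: ge0_le_integral => //.
- apply/measurable_EFinP; apply: measurable_funM => //; apply: measurable_indic.
  exact: measurable_steps.
- apply/measurable_EFinP; apply: measurable_indic.
  by apply: measurableX; [exact: measurable_cube|exact: measurable_annulus].
move=> q _; rewrite lee_fin mul1r !indicE.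
case: (boolP (q \in _)) => [/set_mem[h1 h2 h3]|_] //.
by rewrite mem_set.
Qed.

End difference_quotients.

Section steep_pairs.
Context (R : realType) (d : nat).
Local Notation E := 'rV[R]_d.
Local Notation mu := (@lebesgue_rV R d).
Local Notation N := (@euclidean_norm R d).
Context (p : E) (r rho C : R) (v : E -> R).
Local Notation B := (cube p r).
Local Notation average := (average p r rho).
Local Notation V0 := (fine (mu (@annulus R d rho))).
Local Notation steep := (steep v).
Context (rho0 : 0 < rho) (C0 : 0 <= C) (mv : measurable_fun setT v)
  (iv : mu.-integrable B (EFin \o v))
  (incr : forall z : E,
    (\int[mu]_x (`|v (x + z)%R - v x| * \1_(common_cube p r z) x)%:E <=
     (C * N z)%:E)%E).
Implicit Types (s t : R) (q : E * E).

Let V00 : 0 <= V0. Proof. exact: fine_ge0. Qed.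

(** A steep step of length at least [delta rho] forces one of its endpoints to
carry a large value of [v], which is rare by integrability. *)
Lemma average_steep_long (delta eta : R) : 0 < delta -> 0 < eta ->
  exists2 s0, 0 < s0 & forall s t, s0 <= s -> delta <= t ->
    (average t (fun q => (s * steep s q)%R) <= eta%:E)%E.
Proof.
move=> de0 eta0; pose w x := `|v x| * \1_B x.
have mw : measurable_fun setT w.
  apply: measurable_funM; first exact: measurableT_comp.
  by apply: measurable_indic; exact: measurable_cube.
have w0 x : 0 <= w x by rewrite mulr_ge0.
have iw : mu.-integrable setT (EFin \o w).
  exact: (integrable_indicM (measurable_cube p r) (integrable_abse iv)).
pose f n x : R := (n%:R < `|v x|)%R%:R.
have mf n : measurable_fun setT (f n).
  apply: measurable_boolR; apply: measurable_fun_ltr; first exact: measurable_cst.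
  exact: measurableT_comp.
have f1 n x : `|f n x| <= 1 by rewrite /f; case: (_ < _); rewrite ?normr1 ?normr0.
have fcvg x : f n x @[n --> \oo] --> (0 : R).
  apply: cvg_near_cst; exists (Num.truncn `|v x|).+1 => // n /= hn.
  rewrite /f ltNge; case: leP => //; rewrite ltNge => /negP; case.
  apply: (le_trans (ltW (truncnS_gt _))); by rewrite ler_nat.
(* the two endpoints contribute [2 / (delta rho) * eta' * V0] each *)
pose eta' := eta * (delta * rho) / (4 * (V0 + 1)).
have eta'0 : 0 < eta'.
  by rewrite divr_gt0 ?mulr_gt0// ltr_wpDl.
have [n ne] := dominated_small iw w0 mf f1 fcvg eta'0.
exists (2 * n.+1%:R / (delta * rho)); first by rewrite divr_gt0 ?mulr_gt0.
move=> s t; rewrite ler_pdivrMr ?mulr_gt0// => ns dt.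
have t0 : 0 < t := lt_le_trans de0 dt.
have s0 : 0 < s.
  have : 0 < s * (delta * rho) by apply: lt_le_trans ns; rewrite mulr_gt0.
  by rewrite pmulr_lgt0// mulr_gt0.
pose T x := w x * `|f n x|.
have T0 x : 0 <= T x by rewrite mulr_ge0.
have mT : measurable_fun setT T by apply: measurable_funM => //; exact: measurableT_comp.
pose V := @annulus R d rho.
pose g (q : E * E) := (T q.1 * \1_V q.2)%:E.
have g0 q : (0 <= g q)%E by rewrite lee_fin mulr_ge0.
have mg : measurable_fun setT g.
  apply/measurable_EFinP; apply: measurable_funM.
    exact: (measurableT_comp mT measurable_fst).
  apply: (measurableT_comp _ measurable_snd); apply: measurable_indic.
  exact: measurable_annulus.
have Ig : (\int[mu \x mu]_q g q <= (eta' * V0)%:E)%E.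
  rewrite fubini_tonelli2// /fubini_G/=.
  apply: (@le_trans _ _ (\int[mu]_z (eta'%:E * (\1_V z)%:E))%E).
    apply: ge0_le_integral => //.
    - by move=> z _; apply: integral_ge0 => x _; exact: g0.
    - exact: (measurable_fun_fubini_tonelli_G g mg g0).
    - apply: measurable_funeM; apply/measurable_EFinP; apply: measurable_indic.
      exact: measurable_annulus.
    move=> z _; rewrite /g/=; under eq_integral do rewrite mulrC EFinM.
    rewrite ge0_integralZl//; [|exact/measurable_EFinP|by move=> x _; rewrite lee_fin].
    by rewrite muleC lee_wpmul2r// lee_fin.
  rewrite ge0_integralZl//; last 2 first.
  - by apply/measurable_EFinP; apply: measurable_indic; exact: measurable_annulus.
  - by rewrite lee_fin ltW.
  rewrite integral_indic ?setIT//; last exact: measurable_annulus.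
  by rewrite [leRHS]EFinM V0E.
have dr0 : 0 < delta * rho by rewrite mulr_gt0.
pose c := 2 / (delta * rho).
have c0 : 0 <= c by rewrite divr_ge0// ltW.
have mgs : measurable_fun setT (fun q : E * E => g (q.1 + t *: q.2, q.2)).
  exact: (measurableT_comp mg (measurable_fun_shear t)).
apply: (@le_trans _ _ (c%:E * (\int[mu \x mu]_q g q +
    \int[mu \x mu]_q g (q.1 + t *: q.2, q.2)%R))%E); last first.
  rewrite (@ge0_integral_shear _ _ t g)//.
  apply: (@le_trans _ _ (c%:E * ((eta' * V0)%:E + (eta' * V0)%:E))%E).
    by rewrite lee_wpmul2l// leeD.
  have V1 : V0 + 1 != 0 by rewrite gt_eqF// ltr_wpDl.
  rewrite -EFinD -EFinM lee_fin.
  have -> : c * (eta' * V0 + eta' * V0) = eta * (V0 / (V0 + 1)).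
    by rewrite /c /eta'; field; rewrite V1 !gt_eqF.
  by rewrite ler_piMr ?(ltW eta0)// ler_pdivrMr ?ltr_wpDl// mul1r lerDl.
have msteep : measurable_fun setT (fun q : E * E => s * steep s q).
  by apply: measurable_funM; [exact: measurable_cst|exact: (measurable_steep mv s)].
rewrite -ge0_integralD// -ge0_integralZl//;
  [|exact: (emeasurable_funD mg mgs)|by move=> q _; rewrite adde_ge0].
apply: ge0_le_integral => //.
- by move=> q _; rewrite lee_fin !mulr_ge0// ltW.
- exact: (measurable_average_integrand p r rho t msteep).
- by apply: measurable_funeM; exact: (emeasurable_funD mg mgs).
move=> q _; rewrite /g -!EFinD -EFinM lee_fin/= indicE.
case: (boolP (q \in _)) => [/set_mem[xB yB Nq]|_]; last first.
  by rewrite mulr0 mulr_ge0// addr_ge0// mulr_ge0.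
rewrite mulr1 !indicE mem_set// !mulr1 /steep /quotient/=.
have Nq0 : 0 < N q.2 by move: Nq => /andP[h _]; exact: lt_le_trans h.
have Ntq : N (t *: q.2) = t * N q.2 by rewrite euclidean_normZ// ltW.
case: ltP => [|_]; last by rewrite mulr0 mulr_ge0// addr_ge0.
rewrite mulr1 Ntq ltr_pdivlMr ?mulr_gt0// => h.
have h2 : s * (delta * rho) <= `|v (q.1 + t *: q.2)| + `|v q.1|.
  apply: le_trans (ler_normB _ _); apply: le_trans (ler_norm _); apply: le_trans (ltW h).
  rewrite ler_pM2l//; apply: ler_pM; rewrite ?(ltW de0) ?(ltW rho0)//.
  by case/andP : Nq.
have T1 x : B x -> s * (delta * rho) / 2 <= `|v x| -> s * (delta * rho) / 2 <= T x.
  move=> Bx h3; rewrite /T /w /f indicE mem_set// mulr1.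
  have -> : n%:R < `|v x|.
    apply: lt_le_trans h3; rewrite ltr_pdivlMr//.
    apply: lt_le_trans ns; rewrite mulrC ltr_pM2l// ltr_nat//.
  by rewrite normr1 mulr1.
have : s * (delta * rho) / 2 <= T q.1 + T (q.1 + t *: q.2).
  have [h4|h4] := leP (s * (delta * rho) / 2) `|v q.1|.
    by apply: le_trans (T1 _ xB h4) _; rewrite lerDl.
  have h5 : s * (delta * rho) / 2 <= `|v (q.1 + t *: q.2)| by lra.
  by apply: le_trans (T1 _ yB h5) _; rewrite lerDr.
move=> h6; rewrite /c mulrAC ler_pdivlMr//; lra.
Qed.

Lemma average0_steep s : 0 < s -> average 0 (fun q => (s * steep s q)%R) = 0%E.
Proof.
move=> s0; apply: integral0_eq => q _; rewrite /steep /quotient/= scale0r addr0.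
by rewrite subrr mul0r ltNge (ltW s0)/= mulr0 mul0r.
Qed.

Lemma sum_lt_le (m : nat) (y : R) : 0 <= y ->
  \sum_(k < m) (k%:R < y)%R%:R <= y + 1 :> R.
Proof.
move=> y0; suff [] : \sum_(k < m) (k%:R < y)%R%:R <= y + 1 :> R /\
  \sum_(k < m) (k%:R < y)%R%:R <= m%:R :> R by [].
elim: m => [|m [ih1 ih2]]; first by rewrite big_ord0 lexx addr_ge0.
rewrite big_ord_recr/=; case: ltP => h /=; last first.
  by rewrite addr0; split => //; rewrite (le_trans ih2)// ler_nat.
by rewrite -(natr1 m); split; rewrite lerD2r// (le_trans ih2)// ltW.
Qed.

(** Steps shorter than [delta rho] are a small proportion of all the steps, and
each contributes a bounded amount by Markov's inequality; the others contribute
little when [s] is large. *)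
Lemma sum_average_steep (eta : R) : 0 < eta ->
  exists s0 n0, 0 < s0 /\ forall s n, s0 <= s -> (n0 <= n)%N -> (0 < n)%N ->
    (\sum_(k < n.+1) average (k%:R / n%:R) (fun q => (s * steep s q)%R) <=
     (eta * n%:R)%:E)%E.
Proof.
move=> eta0; pose c := C * V0.
have c0 : 0 <= c by rewrite mulr_ge0.
have c1 : 0 < c + 1 by rewrite ltr_wpDl.
pose delta := eta / 4 / (c + 1).
have delta0 : 0 < delta by rewrite !divr_gt0.
have eta8 : 0 < eta / 8 by rewrite divr_gt0.
have [s0 s00 Hs] := average_steep_long delta0 eta8.
exists s0, (Num.truncn (4 * c / eta)).+1; split => // s n s0s n0n npos.
have sp : 0 < s := lt_le_trans s00 s0s.
have nR : 0 < n%:R :> R by rewrite ltr0n.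
have ms : measurable_fun setT (steep s) by exact: (measurable_steep mv s).
have bound k : (average (k%:R / n%:R) (fun q => (s * steep s q)%R) <=
    (c * (k%:R < delta * n%:R)%R%:R + eta / 8)%:E)%E.
  case: ltP => h; last first.
    rewrite mulr0 add0r; apply: Hs => //.
    by rewrite ler_pdivlMr.
  have [->|k0] := eqVneq k 0%N.
    by rewrite mul0r average0_steep// lee_fin addr_ge0// ?mulr_ge0// ltW.
  rewrite averageZ// ?(ltW sp)//.
  have kn0 : 0 < k%:R / n%:R :> R by rewrite divr_gt0// ltr0n lt0n.
  apply: (@le_trans _ _ (s%:E * (C / s * V0)%:E)%E).
    by apply: lee_wpmul2l; [rewrite lee_fin ltW|exact: average_steep].
  rewrite -EFinM lee_fin mulr1.
  have -> : s * (C / s * V0) = c by rewrite /c; field; rewrite gt_eqF.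
  by rewrite lerDl ltW.
apply: (@le_trans _ _ (\sum_(k < n.+1)
    (c * (k%:R < delta * n%:R)%R%:R + eta / 8)%:E)%E).
  by apply: lee_sum => k _; exact: bound.
rewrite sumEFin lee_fin big_split/= -mulr_sumr sumr_const card_ord.
have := @sum_lt_le n.+1 (delta * n%:R) _; move=> /(_ (mulr_ge0 (ltW delta0) (ltW nR))) h.
have h2 : c * (delta * n%:R + 1) <= eta / 4 * n%:R + eta / 4 * n%:R.
  rewrite mulrDr; apply: lerD.
    rewrite mulrA ler_pM2r// /delta mulrCA ler_piMr//; first by rewrite ltW// divr_gt0.
    by rewrite ler_pdivrMr// mul1r lerDl.
  rewrite mulr1; have : 4 * c / eta <= n%:R.
    by apply: le_trans (ltW (truncnS_gt _)) _; rewrite ler_nat.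
  rewrite ler_pdivrMr//; lra.
have h3 : (eta / 8) *+ n.+1 <= eta / 4 * n%:R.
  rewrite -[_ *+ n.+1]mulr_natr -(natr1 n) mulrDr mulr1.
  have : 1 <= n%:R :> R by rewrite ler1n.
  move=> h4; have h5 : eta / 8 <= eta / 8 * n%:R by rewrite ler_peMr// ltW.
  lra.
have := ler_wpM2l c0 h; lra.
Qed.

End steep_pairs.

(** * Short steps *)

Section energy.
Context (R : realType) (d : nat).
Local Notation E := 'rV[R]_d.
Local Notation mu := (@lebesgue_rV R d).
Local Notation N := (@euclidean_norm R d).
Context (p : E) (r rho C : R) (v : E -> R) (om : R -> R).
Local Notation average := (average p r rho).
Local Notation V0 := (fine (mu (@annulus R d rho))).
Local Notation quotient := (quotient v).
Local Notation steep := (steep v).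
Context (r0 : 0 < r) (rho0 : 0 < rho) (C0 : 0 <= C) (mv : measurable_fun setT v)
  (incr : forall z : E,
    (\int[mu]_x (`|v (x + z)%R - v x| * \1_(common_cube p r z) x)%:E <=
     (C * N z)%:E)%E)
  (com : continuous om) (om_ge0 : forall y, 0 <= om y)
  (om_pos : forall y, 0 < y -> 0 < om y).
Implicit Types (s t M : R) (q : E * E).

Definition energy (q : E * E) : R :=
  om (quotient q) * \1_(common_pairs p r) q / N q.2 ^+ d.

Lemma measurable_energy : measurable_fun setT energy.
Proof.
apply: measurable_kernel; apply: measurable_funM.
  apply: (measurableT_comp (continuous_measurable_fun com)).
  exact: measurable_quotient.
by apply: measurable_indic; exact: measurable_common_pairs.
Qed.

Context (ienergy : (mu \x mu)%E.-integrable setT (EFin \o energy)).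

Lemma energy_ge0 q : 0 <= energy q.
Proof. by rewrite !mulr_ge0// invr_ge0 exprn_ge0// euclidean_norm_ge0. Qed.

Let mq : measurable_fun setT quotient. Proof. exact: measurable_quotient. Qed.

Let mom : measurable_fun setT om. Proof. exact: continuous_measurable_fun. Qed.

Let momq : measurable_fun setT (fun q => om (quotient q)).
Proof. exact: measurableT_comp. Qed.

(** Short steps only see the part of the energy near the diagonal, which is small
by dominated convergence. *)
Lemma average_om_small (e : R) : 0 < e ->
  exists2 t0, 0 < t0 & forall t, 0 < t -> t <= t0 ->
    (average t (fun q => om (quotient q)) <= e%:E)%E.
Proof.
move=> e0; pose c := (2 * rho) ^+ d; have c0 : 0 <= c by rewrite exprn_ge0// mulr_ge0// ltW.
have c1 : 0 < c + 1 by rewrite ltr_wpDl.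
have mN2 := @measurable_norm_snd R d.
pose f n (q : E * E) : R := (0 < N q.2 < 2 * rho / n.+1%:R)%R%:R.
have mf n : measurable_fun setT (f n).
  apply: measurable_boolR; apply: measurable_and.
    by apply: measurable_fun_ltr => //; exact: measurable_cst.
  by apply: measurable_fun_ltr => //; exact: measurable_cst.
have f1 n q : `|f n q| <= 1 by rewrite /f; case: (_ < _ < _); rewrite ?normr1 ?normr0.
have fcvg q : f n q @[n --> \oo] --> (0 : R).
  apply: cvg_near_cst; rewrite /f; have [Nq|Nq] := ltP 0 (N q.2); last by apply: nearW.
  exists (Num.truncn (2 * rho / N q.2)).+1 => // n /= hn.
  have h : 2 * rho / N q.2 < n.+1%:R.
    apply: (lt_le_trans (truncnS_gt _)); rewrite ler_nat; exact: leq_trans hn _.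
  rewrite ltNge; move: h; rewrite ltr_pdivrMr// => h.
  by rewrite ler_pdivrMr ?ltr0n// [_ * n.+1%:R]mulrC ltW.
have [n ne] := dominated_small ienergy energy_ge0 mf f1 fcvg (divr_gt0 e0 c1).
exists n.+1%:R^-1; first by rewrite invr_gt0.
move=> t t0 tn.
apply: le_trans (average_le_kernel p r rho0 t0 momq _) _ => //.
apply: (@le_trans _ _ (c%:E * (e / (c + 1))%:E)%E); last first.
  rewrite -EFinM lee_fin mulrCA ler_piMr// ?(ltW e0)// ler_pdivrMr// mul1r.
  by rewrite lerDl.
apply: lee_wpmul2l; first by rewrite lee_fin.
apply: le_trans ne; apply: ge0_le_integral => //.
- move=> q _; rewrite lee_fin !mulr_ge0//.
  by rewrite invr_ge0 exprn_ge0// euclidean_norm_ge0.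
- apply/measurable_EFinP; apply: measurable_kernel.
  apply: measurable_funM; last exact: measurable_shell.
  by apply: measurable_funM => //; apply: measurable_indic; exact: measurable_common_pairs.
- apply/measurable_EFinP; apply: measurable_funM.
    by move/measurable_int : ienergy => /measurable_EFinP.
  exact: measurableT_comp.
move=> q _; rewrite lee_fin /energy /f.
rewrite mulrAC; apply: ler_wpM2l; first exact: energy_ge0.
rewrite ger0_norm//; case: (boolP (_ <= _ < _)) => // /andP[h1 h2].
have -> : 0 < N q.2 by apply: lt_le_trans h1; rewrite mulr_gt0.
rewrite (lt_le_trans h2)// mulrCA mulrC; apply: ler_wpM2l => //.
by rewrite mulr_ge0// ltW.
Qed.

(** Short steps. A slope bounded away from [0] and from infinity has an energy
bounded below, so such slopes are controlled by the energy of short steps, a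
tail of a convergent integral; small slopes contribute little, and steep ones
are rare since [v] has bounded variation. *)
Lemma average_slope_small (s eta : R) : 0 <= s -> 0 < eta ->
  exists2 t0, 0 < t0 & forall t, 0 < t -> t <= t0 ->
    (average t (fun q => Num.min (Num.max (quotient q) 0) s)%R <= eta%:E)%E.
Proof.
move=> s0 eta0; pose W := (2 * r) ^+ d * V0.
have V00 : 0 <= V0 by exact: fine_ge0.
have W0 : 0 <= W by rewrite mulr_ge0// exprn_ge0// mulr_ge0// ltW.
have W1 : 0 < W + 1 by rewrite ltr_wpDl.
have eta3 : 0 < eta / 3 by rewrite divr_gt0.
pose eps := eta / 3 / (W + 1); have eps0 : 0 < eps by rewrite divr_gt0.
(* slopes above [M] contribute at most [s * (C / M) * V0 <= eta / 3] *)
pose K := s * C * V0 / (eta / 3).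
have K0 : 0 <= K by rewrite !mulr_ge0// invr_ge0 ltW.
pose M := eps + K; have epsM : eps <= M by rewrite lerDl.
have M0 : 0 < M by rewrite (lt_le_trans eps0).
have [y0 y0in y0min] := EVT_min epsM (continuous_subspaceT com).
have m0 : 0 < om y0.
  by apply: om_pos; move: y0in; rewrite in_itv/= => /andP[h _]; exact: lt_le_trans h.
pose c := s / om y0; have c0 : 0 <= c by rewrite divr_ge0// ltW.
have c1 : 0 < c + 1 by rewrite ltr_wpDl.
have [t0 t00 Ht0] := average_om_small (divr_gt0 eta3 c1).
exists t0 => // t tpos tt0.
have ms : measurable_fun setT (fun q => s * steep M q).
  by apply: measurable_funM => //; exact: (measurable_steep mv M).
have mco : measurable_fun setT (fun q => c * om (quotient q)).
  exact: measurable_funM.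
have s10 q : 0 <= s * steep M q by rewrite mulr_ge0.
have co0 q : 0 <= c * om (quotient q) by rewrite mulr_ge0.
apply: (@le_trans _ _ (average t (fun q => eps * 1 + (c * om (quotient q) + s * steep M q)))%R).
  apply: le_average.
  - apply: measurable_minr => //; apply: measurable_maxr => //.
  - apply: measurable_funD => //; exact: measurable_funD.
  - by move=> q; rewrite le_min s0 le_max lexx orbT.
  move=> q; rewrite mulr1; have [h1|h1] := leP (quotient q) eps.
    apply: (@le_trans _ _ eps); last by rewrite lerDl addr_ge0.
    by rewrite ge_min ge_max h1 (ltW eps0).
  apply: (@le_trans _ _ s); first by rewrite ge_min lexx orbT.
  have [h2|h2] := leP (quotient q) M.
    rewrite addrCA; apply: (@le_trans _ _ (c * om (quotient q))); last first.
      by rewrite lerDl addr_ge0// ltW.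
    rewrite /c mulrAC ler_pdivlMr//; apply: ler_wpM2l => //; apply: y0min.
    by rewrite in_itv/= (ltW h1).
  rewrite /steep h2 mulr1 addrA lerDr addr_ge0//; exact: ltW.
rewrite averageD//; last 3 first.
- exact: measurable_funD.
- by move=> q; rewrite mulr1 ltW.
- by move=> q; rewrite addr_ge0.
rewrite averageD// !averageZ//; last 2 first.
- exact: (measurable_steep mv M).
- exact: ltW.
have -> : eta%:E = ((eta / 3)%:E + ((eta / 3)%:E + (eta / 3)%:E))%E.
  by rewrite -!EFinD; congr EFin; lra.
apply: leeD; last apply: leeD.
- apply: (@le_trans _ _ (eps%:E * W%:E)%E).
    by apply: lee_wpmul2l; [rewrite lee_fin ltW|exact: average1].
  by rewrite -EFinM lee_fin /eps mulrAC ler_pdivrMr// ler_pM2l// lerDl.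
- apply: (@le_trans _ _ (c%:E * (eta / 3 / (c + 1))%:E)%E).
    by apply: lee_wpmul2l; [rewrite lee_fin|exact: Ht0].
  by rewrite -EFinM lee_fin mulrA ler_pdivrMr// mulrC ler_pM2l// lerDl.
- apply: (@le_trans _ _ (s%:E * (C / M * V0)%:E)%E).
    by apply: lee_wpmul2l; [rewrite lee_fin|exact: average_steep].
  rewrite -EFinM lee_fin.
  have -> : s * (C / M * V0) = s * C * V0 / M by rewrite !mulrA; lra.
  rewrite ler_pdivrMr// /M mulrDr.
  have -> : eta / 3 * K = s * C * V0 by rewrite /K mulrC divfK// gt_eqF.
  by rewrite lerDr mulr_ge0// ltW.
Qed.

End energy.

(** * Steps whose slope is close to a given one *)

Section product_sigma_finite.
Context d1 d2 (T1 : measurableType d1) (T2 : measurableType d2) (R : realType).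
Variable m1 : {sigma_finite_measure set T1 -> \bar R}.
Variable m2 : {sigma_finite_measure set T2 -> \bar R}.
Local Open Scope ereal_scope.

(** The product measure, together with its sigma-finiteness, which Tonelli's
theorem in three variables relies on. *)
Definition product_sf : set (T1 * T2) -> \bar R := (m1 \x m2)%E.

Let product_sf0 : product_sf set0 = 0.
Proof. exact: measure0. Qed.

Let product_sf_ge0 A : 0 <= product_sf A.
Proof. exact: measure_ge0. Qed.

Let product_sf_sigma_additive : semi_sigma_additive product_sf.
Proof. exact: (@measure_semi_sigma_additive _ _ _ (m1 \x m2)). Qed.

HB.instance Definition _ := isMeasure.Build _ _ _ product_sf
  product_sf0 product_sf_ge0 product_sf_sigma_additive.

Let product_sf_sigma_finite : sigma_finite setT product_sf.
Proof.
have /sigma_finiteP[F [TF ndF Foo]] := sigma_finiteT m1.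
have /sigma_finiteP[G [TG ndG Goo]] := sigma_finiteT m2.
exists (fun n => F n `*` G n).
  apply/esym; rewrite -subTset => -[x y] _.
  have [i _ Fi] : (\bigcup_k F k) x by rewrite -TF.
  have [j _ Gj] : (\bigcup_k G k) y by rewrite -TG.
  exists (maxn i j) => //; split.
    by move: Fi; exact/subsetPset/ndF/leq_maxl.
  by move: Gj; exact/subsetPset/ndG/leq_maxr.
move=> k; have [mFk Fkoo] := Foo k; have [mGk Gkoo] := Goo k.
split; first exact: measurableX.
by rewrite [X in (X < _)%E]product_measure1E// lte_mul_pinfty// ge0_fin_numE.
Qed.

HB.instance Definition _ := Measure_isSigmaFinite.Build _ _ _
  product_sf product_sf_sigma_finite.

Context d3 (T : measurableType d3) (m : {sigma_finite_measure set T -> \bar R}).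
Context (f : T * (T1 * T2) -> \bar R) (mf : measurable_fun setT f)
  (f0 : forall w, 0 <= f w).

Lemma integral_product_swap :
  \int[m]_x \int[m1 \x m2]_q f (x, q) = \int[m1 \x m2]_q \int[m]_x f (x, q).
Proof. exact: (@fubini_tonelli _ _ _ _ R m product_sf f mf f0). Qed.

Lemma measurable_integral_product :
  measurable_fun setT (fun x => \int[m1 \x m2]_q f (x, q)).
Proof. exact: (@measurable_fun_fubini_tonelli_F _ _ _ _ R product_sf f mf f0). Qed.

Lemma measurable_integral_product_l :
  measurable_fun setT (fun q => \int[m]_x f (x, q)).
Proof. exact: (@measurable_fun_fubini_tonelli_G _ _ _ _ R m f mf f0). Qed.

End product_sigma_finite.

Section tangency.
Context (R : realType) (om : R -> R) (com : continuous om)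
  (om_ge0 : forall y, 0 <= om y) (om_pos : forall y, 0 < y -> 0 < om y).
Local Notation leb := (@lebesgue_measure R).

(** A positive continuous function varies by at most a factor [2] over short
intervals with centre in a compact set. *)
Lemma doubling_on_segment (s0 S : R) : 0 < s0 ->
  exists2 K, (1 < K)%N & forall k, (K <= k)%N -> forall s y, s0 <= s <= S ->
    `|y - s| < s / k%:R -> om s <= 2 * om y.
Proof.
move=> s00.
have /compact_near_coveringP/(_ nat \oo (fun k s => forall y : R,
    `|y - s| < s / k%:R -> om s <= 2 * om y)) := @segment_compact R s0 S.
case=> [x|n _ Hn].
  rewrite /= in_itv/= => /andP[s0x _]; have x0 : 0 < x := lt_le_trans s00 s0x.
  have ox : 0 < om x / 3 by rewrite divr_gt0// om_pos.
  have /cvgrPdist_lt/(_ _ ox)[dl /= dl0 Hdl] : om y @[y --> x] --> om x by exact: com.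
  have dl2 : 0 < dl / 2 by rewrite divr_gt0.
  exists ([set s | `|x - s| < dl / 2], [set k | (Num.truncn ((x + dl / 2) / (dl / 2)) < k)%N]).
    split=> /=; last by exists (Num.truncn ((x + dl / 2) / (dl / 2))).+1.
    by exists (dl / 2).
  move=> [s k] /= [xs hk] y ys.
  have k0 : 0 < k%:R :> R by rewrite ltr0n (leq_ltn_trans _ hk).
  have sk : s / k%:R < dl / 2.
    rewrite ltr_pdivrMr//; apply: (@lt_trans _ _ (x + dl / 2)).
      by move: xs; rewrite ltr_norml => /andP[? ?]; lra.
    rewrite [_ * k%:R]mulrC -ltr_pdivrMr//; apply: lt_le_trans (truncnS_gt _) _.
    by rewrite ler_nat.
  have h1 := Hdl s; have h2 := Hdl y.
  have {}h1 : `|om x - om s| < om x / 3.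
    by apply: h1; rewrite /= (lt_trans xs)// gtr_pMr// invf_lt1// ltr1n.
  have {}h2 : `|om x - om y| < om x / 3.
    apply: h2; rewrite /=; move: xs ys sk; rewrite !ltr_norml => /andP[? ?] /andP[? ?] ?.
    by apply/andP; split; lra.
  move: h1 h2; rewrite !ltr_norml => /andP[? ?] /andP[? ?]; lra.
exists (maxn n 2); first by rewrite leq_max orbT.
move=> k; rewrite geq_max => /andP[nk _] s y sS ys.
by apply: (Hn k nk) ys; rewrite /= in_itv.
Qed.

Definition slope_weight (s0 S s : R) : R := om s / s ^+ 2 * \1_(`[s0, S]) s.

Lemma slope_weight_ge0 s0 S s : 0 <= slope_weight s0 S s.
Proof. by rewrite !mulr_ge0// invr_ge0 sqr_ge0. Qed.

Lemma measurable_slope_weight s0 S : measurable_fun setT (slope_weight s0 S).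
Proof.
apply: measurable_funM; last by apply: measurable_indic; exact: measurable_itv.
apply: measurable_funM; first exact: continuous_measurable_fun.
by apply: (measurableT_comp (@measurable_inv R)); exact: measurable_funX.
Qed.

(** The slopes [s] concerned form an interval around [y] of length of order
[y / k], on which [s] is comparable to [y] and [om s] is at most [2 om y]. *)
Lemma slopes_near_value (s0 S : R) (k : nat) (y : R) : 0 < s0 -> (1 < k)%N ->
  (forall s, s0 <= s <= S -> `|y - s| < s / k%:R -> om s <= 2 * om y) ->
  (\int[leb]_s (slope_weight s0 S s * (s * (`|y - s| < s / k%:R)%R%:R))%:E <=
   (8 / k%:R * om y)%:E)%E.
Proof.
move=> s00 k1 Hk.
have k0 : 0 < k%:R :> R by rewrite ltr0n ltnW.
have k2 : 2 <= k%:R :> R by rewrite (ler_nat R 2 k).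
have km : 0 < k%:R - 1 :> R by lra.
have kp : 0 < k%:R + 1 :> R by lra.
have mi : measurable_fun setT (fun s => slope_weight s0 S s * (s * (`|y - s| < s / k%:R)%R%:R)).
  apply: measurable_funM; first exact: measurable_slope_weight.
  apply: measurable_funM => //; apply: measurable_boolR; apply: measurable_fun_ltr.
    by apply: measurableT_comp => //; exact: measurable_funB.
  exact: measurable_funM.
have inS s : slope_weight s0 S s = 0 \/ s0 <= s <= S.
  rewrite /slope_weight indicE; case: (boolP (s \in _)); last by left; rewrite mulr0.
  by move=> /set_mem/=; rewrite in_itv/=; right.
have [y0|y0] := leP y 0.
  rewrite integral0_eq => [|s _]; first by rewrite lee_fin mulr_ge0// divr_ge0// ltW.
  have [->|/andP[h _]] := inS s; first by rewrite mul0r.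
  have s1 : 0 < s := lt_le_trans s00 h.
  rewrite ltNge; suff -> : s / k%:R <= `|y - s| by rewrite !mulr0.
  rewrite ler0_norm; last lra.
  apply: (@le_trans _ _ s); last lra.
  rewrite ler_pdivrMr// ler_peMr//; first exact: ltW.
  lra.
pose a := y * k%:R / (k%:R + 1); pose b := y * k%:R / (k%:R - 1).
have ab : a < b.
  by rewrite /a /b ltr_pM2l ?mulr_gt0// ltf_pV2// ?posrE//; lra.
pose c := 2 * om y * ((k%:R + 1) / (y * k%:R)).
have c0 : 0 <= c by rewrite !mulr_ge0// ?invr_ge0 ?mulr_ge0// ltW.
apply: (@le_trans _ _ (\int[leb]_s (c%:E * (\1_(`]a, b[) s)%:E))%E).
  apply: ge0_le_integral => //.
  - move=> s _; rewrite lee_fin.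
    have [->|/andP[h _]] := inS s; first by rewrite mul0r.
    by rewrite mulr_ge0 ?slope_weight_ge0// mulr_ge0// ltW// (lt_le_trans s00).
  - exact/measurable_EFinP.
  - apply: measurable_funeM; apply/measurable_EFinP; apply: measurable_indic.
    exact: measurable_itv.
  move=> s _; rewrite -EFinM lee_fin.
  have [->|hs] := inS s; first by rewrite mul0r mulr_ge0.
  have s1 : 0 < s by case/andP : hs => h _; exact: lt_le_trans h.
  case: (ltP `|y - s|) => h /=; last by rewrite !mulr0 mulr_ge0.
  have om2 := Hk s hs h.
  move: h; rewrite ltr_norml => /andP[h1 h2].
  have h1' : s * (k%:R - 1) < y * k%:R.
    have := h1; rewrite -(ltr_pM2r k0) mulNr divfK ?gt_eqF// => ?; lra.
  have h2' : y * k%:R < s * (k%:R + 1).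
    have := h2; rewrite -(ltr_pM2r k0) divfK ?gt_eqF// => ?; lra.
  rewrite [X in _ <= c * X]indicE mem_set/=; last first.
    by rewrite in_itv/= /a /b ltr_pdivrMr// ltr_pdivlMr// h1' h2'.
  rewrite !mulr1 /slope_weight indicE mem_set/=; last by rewrite in_itv.
  rewrite mulr1 expr2 invfM mulrA divfK ?gt_eqF// ler_pdivrMr// /c -mulrA.
  apply: (le_trans om2); rewrite mulrA -(mulrA (2 * om y)) ler_peMr ?mulr_ge0//.
  by rewrite mulrAC ler_pdivlMr ?mulr_gt0// mul1r [leRHS]mulrC ltW.
rewrite ge0_integralZl//; last by apply/measurable_EFinP; apply: measurable_indic; exact: measurable_itv.
rewrite integral_indic//.
have lab : leb `]a, b[%classic = (b - a)%:E.
  by rewrite lebesgue_measure_itv/= lte_fin ab -EFinB.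
rewrite setIT; apply: (@le_trans _ _ (c%:E * (b - a)%:E)%E); first by rewrite -lab.
rewrite -EFinM lee_fin.
have -> : c * (b - a) = om y * (4 / (k%:R - 1)).
  by rewrite /c /a /b; field; rewrite !gt_eqF.
rewrite [leRHS]mulrC ler_wpM2l//.
rewrite ler_pdivrMr// mulrAC ler_pdivlMr//; lra.
Qed.

(** Each [X] belongs to [k, 2 k[ for at most [X] values of [k], all larger than
[X / 2]. *)
Lemma sum_dyadic (K n : nat) (X : R) : (0 < K)%N ->
  \sum_(K <= k < n) (k%:R <= X < 2 * k%:R)%R%:R / k%:R <= 2 :> R.
Proof.
move=> K0.
have [X0|X0] := leP X 0.
  rewrite big_nat big1// => k /andP[Kk _]; rewrite leNgt (le_lt_trans X0) ?mul0r//.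
  by rewrite ltr0n (leq_trans K0).
suff H : \sum_(K <= k < n) (k%:R <= X)%R%:R <= X.
  apply: (@le_trans _ _ (\sum_(K <= k < n) (2 / X * (k%:R <= X)%R%:R))).
    rewrite big_nat [leRHS]big_nat; apply: ler_sum => k /andP[Kk _].
    have k0 : 0 < k%:R :> R by rewrite ltr0n (leq_trans K0).
    case: (leP k%:R X) => /= h; last by rewrite mul0r mulr0.
    case: (ltP X (2 * k%:R)) => /= h2; last by rewrite mul0r mulr_ge0// divr_ge0// ltW.
    rewrite mulr1 ler_pdivrMr// mulrAC ler_pdivlMr// mul1r; exact: ltW.
  by rewrite -mulr_sumr mulrAC ler_pdivrMr// ler_pM2l.
suff [] : \sum_(K <= k < n) (k%:R <= X)%R%:R <= X /\
  \sum_(K <= k < n) (k%:R <= X)%R%:R <= n.-1%:R :> R by [].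
elim: n => [|n [ih1 ih2]]; first by rewrite big_geq// ltW.
have [nK|Kn] := ltnP n K; first by rewrite big_geq// ltW.
rewrite big_nat_recr//=.
case: (leP n%:R X) => h; last by rewrite addr0; split => //; rewrite (le_trans ih2)// ler_nat leq_pred.
have n1 : n%:R = n.-1%:R + 1 :> R by rewrite natr1 prednK// (leq_trans K0).
have : \sum_(K <= k < n) (k%:R <= X)%R%:R + 1 <= n%:R :> R by rewrite n1 lerD2r.
by move=> h2; split => //; exact: le_trans h.
Qed.

End tangency.

Section tangent_pairs.
Context (R : realType) (d : nat).
Local Notation E := 'rV[R]_d.
Local Notation mu := (@lebesgue_rV R d).
Local Notation leb := (@lebesgue_measure R).
Local Notation N := (@euclidean_norm R d).
Context (p : E) (r rho : R) (v : E -> R) (om : R -> R).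
Local Notation average := (average p r rho).
Local Notation quotient := (quotient v).
Local Notation energy := (energy p r v om).
Context (rho0 : 0 < rho) (mv : measurable_fun setT v)
  (com : continuous om) (om_ge0 : forall y, 0 <= om y)
  (om_pos : forall y, 0 < y -> 0 < om y).
Implicit Types (s : R) (q : E * E) (k n K : nat).

Definition tangent (s : R) (k : nat) (q : E * E) : R :=
  s * (`|quotient q - s| < s / k%:R)%R%:R.

Let mom : measurable_fun setT om. Proof. exact: continuous_measurable_fun. Qed.

Lemma tangent_ge0 s k q : 0 <= tangent s k q.
Proof.
rewrite /tangent; case: ltP => [h|_]; last by rewrite mulr0.
rewrite mulr1 leNgt; apply/negP => s0.
have := le_lt_trans (normr_ge0 _) h; rewrite ltNge => /negP; apply.
by rewrite nmulr_rle0// invr_ge0.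
Qed.

Let momq : measurable_fun setT (fun q => om (quotient q)).
Proof. exact: (measurableT_comp mom (measurable_quotient mv)). Qed.

Lemma measurable_tangent2 k :
  measurable_fun setT (fun w : measurableTypeR R * (E * E) => tangent w.1 k w.2).
Proof.
have m1 : measurable_fun setT (fun w : measurableTypeR R * (E * E) => w.1).
  exact: measurable_fst.
apply: measurable_funM => //; apply: measurable_boolR; apply: measurable_fun_ltr.
  apply: measurableT_comp => //; apply: measurable_funB => //.
  exact: (measurableT_comp (measurable_quotient mv) measurable_snd).
exact: measurable_funM.
Qed.

Lemma measurable_tangent s k : measurable_fun setT (tangent s k).
Proof. exact: (measurableT_comp (measurable_tangent2 k) (measurable_pair1 s)). Qed.

Let far_integrand s0 S k (t : R) (w : measurableTypeR R * (E * E)) : R :=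
  slope_weight om s0 S w.1 *
  (tangent w.1 k (w.2.1, t *: w.2.2) * \1_(steps p r rho t) w.2).

Let measurable_far s0 S k t : measurable_fun setT (far_integrand s0 S k t).
Proof.
apply: measurable_funM.
  apply: (measurableT_comp _ measurable_fst); exact: measurable_slope_weight.
apply: measurable_funM; last first.
  by apply: (measurableT_comp _ measurable_snd); apply: measurable_indic; exact: measurable_steps.
apply: (measurableT_comp (measurable_tangent2 k)
  (g := fun w : measurableTypeR R * (E * E) => (w.1, (w.2.1, t *: w.2.2)))).
apply: measurable_fun_pair; first exact: measurable_fst.
exact: (measurableT_comp (measurable_fun_scale2 t) measurable_snd).
Qed.

Let far_ge0 s0 S k t w : 0 <= far_integrand s0 S k t w.
Proof.
by apply: mulr_ge0; [exact: slope_weight_ge0|rewrite mulr_ge0 ?tangent_ge0].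
Qed.

Let far_average s0 S k t s : 0 < s0 ->
  ((slope_weight om s0 S s)%:E * average t (tangent s k) =
   \int[mu \x mu]_q (far_integrand s0 S k t (s, q))%:E)%E.
Proof.
move=> s00; have [sS|] := boolP (s \in `[s0, S]%classic); last first.
  move=> sS; have w0 : slope_weight om s0 S s = 0.
    by rewrite /slope_weight indicE (negbTE sS) mulr0.
  by rewrite w0 mul0e integral0_eq// => q _; rewrite /far_integrand w0 mul0r.
have s1 : 0 < s by move: sS => /set_mem/=; rewrite in_itv/= => /andP[h _]; exact: lt_le_trans h.
rewrite -ge0_integralZl//.
- by apply: measurable_average_integrand; exact: measurable_tangent.
- by move=> q _; rewrite lee_fin mulr_ge0// tangent_ge0.
- by rewrite lee_fin slope_weight_ge0.
Qed.

Lemma measurable_weighted_average s0 S k t : 0 < s0 ->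
  measurable_fun setT (fun s => ((slope_weight om s0 S s)%:E * average t (tangent s k))%E).
Proof.
move=> s00; rewrite (_ : (fun x => _) = fun s =>
    (\int[mu \x mu]_q (far_integrand s0 S k t (s, q))%:E)%E).
  apply: (@measurable_integral_product _ _ _ _ R mu mu _ _
    (fun w => (far_integrand s0 S k t w)%:E)).
    by apply/measurable_EFinP; exact: measurable_far.
  by move=> w; rewrite lee_fin far_ge0.
by apply/funext => s; exact: far_average.
Qed.

(** By Tonelli's theorem the integral over the slopes can be taken first, for a
fixed pair of points. *)
Lemma average_tangent_weighted (s0 S t : R) k : 0 < s0 -> (1 < k)%N ->
  (forall s y, s0 <= s <= S -> `|y - s| < s / k%:R -> om s <= 2 * om y) ->
  (\int[leb]_s ((slope_weight om s0 S s)%:E * average t (tangent s k)) <=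
   average t (fun q => (8 / k%:R * om (quotient q))%R))%E.
Proof.
move=> s00 k1 Hk.
under eq_integral do rewrite far_average//.
rewrite (@integral_product_swap _ _ _ _ R mu mu _ _ leb
  (fun w => (far_integrand s0 S k t w)%:E)); last 2 first.
- by apply/measurable_EFinP; exact: measurable_far.
- by move=> w; rewrite lee_fin far_ge0.
apply: ge0_le_integral => //.
- by move=> q _; apply: integral_ge0 => s _; rewrite lee_fin far_ge0.
- apply: (@measurable_integral_product_l _ _ _ _ R _ _ leb
    (fun w => (far_integrand s0 S k t w)%:E)).
    by apply/measurable_EFinP; exact: measurable_far.
  by move=> w; rewrite lee_fin far_ge0.
- apply: (@measurable_average_integrand _ _ p r rho t
    (fun q => 8 / k%:R * om (quotient q))).
  exact: measurable_funM.
move=> q _; rewrite /far_integrand/= indicE.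
case: (q \in _); last first.
  by rewrite mulr0 integral0_eq// => s _; rewrite !mulr0.
rewrite mulr1; under eq_integral do rewrite mulr1.
exact: (slopes_near_value com om_ge0 s00 k1 (fun s => Hk s _)).
Qed.

(** The weights [8 / k] attached to the annuli of radius [(k / n) rho] that
contain a given point have a bounded sum, so all the tangencies together cost
at most a multiple of the energy, whatever [n]. *)
Lemma sum_average_tangent (s0 S : R) : 0 < s0 ->
  exists2 K, (1 < K)%N & forall n, (0 < n)%N ->
    (\int[leb]_s ((slope_weight om s0 S s)%:E *
       \sum_(K <= k < n) average (k%:R / n%:R)%R (tangent s k)) <=
     (16 * (2 * rho) ^+ d)%:E * \int[mu \x mu]_q (energy q)%:E)%E.
Proof.
move=> s00; have [K K1 HK] := doubling_on_segment com om_pos S s00.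
exists K => // n n0; have nR : 0 < n%:R :> R by rewrite ltr0n.
have c0 : 0 <= (2 * rho) ^+ d by rewrite exprn_ge0// mulr_ge0// ltW.
have av0 s k t : (0 <= average t (tangent s k))%E.
  by apply: average_ge0 => q; exact: tangent_ge0.
under eq_integral => s _.
  rewrite ge0_sume_distrr; last by move=> k _; exact: av0.
  over.
rewrite ge0_integral_sum//; last 2 first.
- by move=> k; exact: measurable_weighted_average.
- by move=> k s _; rewrite mule_ge0 ?lee_fin ?slope_weight_ge0.
pose b (k : nat) (q : E * E) : R := 8 / k%:R * om (quotient q) * \1_(common_pairs p r) q *
  (k%:R / n%:R * rho <= N q.2 < 2 * (k%:R / n%:R * rho))%R%:R / N q.2 ^+ d.
have b0 k q : 0 <= b k q.
  by rewrite !mulr_ge0// ?invr_ge0// exprn_ge0// euclidean_norm_ge0.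
have mb k : measurable_fun setT (b k).
  apply: measurable_kernel; apply: measurable_funM; last exact: measurable_shell.
  apply: measurable_funM; first exact: measurable_funM.
  by apply: measurable_indic; exact: measurable_common_pairs.
apply: (@le_trans _ _ (\sum_(K <= k < n)
    (((2 * rho) ^+ d)%:E * \int[mu \x mu]_q (b k q)%:E))%E).
  rewrite big_nat [leRHS]big_nat; apply: lee_sum => k /andP[Kk _].
  have k1 : (1 < k)%N := leq_trans K1 Kk.
  apply: le_trans (average_tangent_weighted _ s00 k1 (HK k Kk)) _.
  apply: average_le_kernel => //.
  - by rewrite divr_gt0// ltr0n ltnW.
  - exact: measurable_funM.
  - by move=> q; rewrite mulr_ge0.
rewrite -ge0_sume_distrr => [|k _]; last by apply: integral_ge0 => q _; rewrite lee_fin.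
rewrite -ge0_integral_sum//; last 2 first.
- by move=> k; exact/measurable_EFinP.
- by move=> k q _; rewrite lee_fin.
rewrite [(16 * _)%:E]EFinM -muleA muleCA; apply: lee_wpmul2l; first by rewrite lee_fin.
have me : measurable_fun setT energy by exact: measurable_energy.
have e0 q : 0 <= energy q by exact: energy_ge0.
rewrite -ge0_integralZl//; last 2 first.
- exact/measurable_EFinP.
- by move=> q _; rewrite lee_fin.
apply: ge0_le_integral => //.
- by move=> q _; rewrite sume_ge0// => k _; rewrite lee_fin.
- by apply: emeasurable_sum => k; exact/measurable_EFinP.
- by apply: measurable_funeM; exact/measurable_EFinP.
move=> q _; rewrite sumEFin -EFinM lee_fin.
rewrite (_ : \sum_(K <= k < n) b k q = 8 * energy q * \sum_(K <= k < n)
    (k%:R <= N q.2 * n%:R / rho < 2 * k%:R)%R%:R / k%:R).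
  have := @sum_dyadic R K n (N q.2 * n%:R / rho) (ltnW K1).
  by have := e0 q; nra.
rewrite mulr_sumr; apply: eq_bigr => k _; rewrite /b /energy.
have -> : (k%:R / n%:R * rho <= N q.2) = (k%:R <= N q.2 * n%:R / rho).
  by rewrite ler_pdivlMr// -ler_pdivrMr// mulrAC.
have -> : (N q.2 < 2 * (k%:R / n%:R * rho)) = (N q.2 * n%:R / rho < 2 * k%:R).
  by rewrite ltr_pdivrMr// -ltr_pdivlMr//; congr (_ < _); field; rewrite gt_eqF.
ring.
Qed.

End tangent_pairs.

(** * Chains of equal steps *)

Section chains.
Context (R : realType) (d : nat).
Local Notation E := 'rV[R]_d.
Local Notation N := (@euclidean_norm R d).
Context (p : E) (r rho : R) (v : E -> R).
Local Notation average := (average p r rho).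
Local Notation quotient := (quotient v).
Local Notation steep := (steep v).
Local Notation tangent := (tangent v).
Context (rho0 : 0 < rho).
Implicit Types (s : R) (q : E * E) (k n : nat).

(** [chain_overlaps] for the values of [v] at [n + 1] equidistant points from [x] to
[x + z], with a line of slope [s] with respect to the length. For [i < j] the
overlap of the intervals with indices [i] and [j] is the product of [|z| / n]
and the positive part of [s - (j - i) |Q - s|], with [Q] the slope of [v] from
the [i]-th point to the [j]-th one; [G (j - i)] stands for any upper bound of
this positive part. *)
Lemma chain_pointwise (G : nat -> E * E -> R) (s : R) n q :
  (0 < n)%N -> 1 <= s * rho -> steps p r rho 1 q ->
  (forall k q, (0 < k)%N -> Num.max 0 (s - k%:R * `|quotient q - s|) <= G k q) ->
  capped_rise v q <= 2 * rho / n%:R * (s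
    + (\sum_(i < n) (s * steep s (q.1, (i%:R / n%:R) *: q.2))
    + (\sum_(i < n) (s * steep s (q.1 + (i%:R / n%:R) *: q.2, ((n - i)%:R / n%:R) *: q.2))
    + \sum_(j < n) \sum_(i < j)
        G (j - i)%N (q.1 + (i%:R / n%:R) *: q.2, ((j - i)%:R / n%:R) *: q.2)))).
Proof.
case: q => x z n0 srho [/= _ _ /andP[Nz1 Nz2]] HG.
have nR : 0 < n%:R :> R by rewrite ltr0n.
have Nz0 : 0 < N z := lt_le_trans rho0 Nz1.
have s0 : 0 < s by rewrite -(pmulr_lgt0 _ rho0) (lt_le_trans _ srho).
pose a (i : nat) := v (x + (i%:R / n%:R) *: z).
pose S := s * N z; have S0 : 0 < S by rewrite mulr_gt0.
pose f (i : nat) := a i - S * (i%:R / n%:R).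
have H0 := @chain_overlaps R a f n S n0 S0 (fun=> erefl).
have xz i j : (i <= j)%N -> x + (i%:R / n%:R) *: z + ((j - i)%:R / n%:R) *: z = x + (j%:R / n%:R) *: z.
  move=> ij; rewrite -addrA -scalerDl -mulrDl -natrD subnKC//.
have quoE i j : (i < j)%N -> quotient (x + (i%:R / n%:R) *: z, ((j - i)%:R / n%:R) *: z)
    = (a j - a i) / ((j - i)%:R / n%:R * N z).
  by move=> ij; rewrite /quotient/= xz ?(ltnW ij)// euclidean_normZ.
have steepE i j : (i < j)%N ->
    (S * ((j - i)%:R / n%:R) < a j - a i) =
    (s < quotient (x + (i%:R / n%:R) *: z, ((j - i)%:R / n%:R) *: z)).
  move=> ij; have ji : 0 < (j - i)%:R :> R by rewrite ltr0n subn_gt0.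
  rewrite quoE// ltr_pdivlMr; last by rewrite mulr_gt0// divr_gt0.
  by rewrite /S -mulrA (mulrC (N z)).
have a0 : a 0%N = v x by rewrite /a mul0r scale0r addr0.
have an : a n = v (x + z) by rewrite /a divff ?gt_eqF// scale1r.
have E1 : \sum_(i < n) (s * steep s (x, (i%:R / n%:R) *: z)) =
    \sum_(i < n) s * (S * (i%:R / n%:R) < a i - a 0%N)%R%:R.
  apply: eq_bigr => -[[|i] ilt] _ /=; congr (_ * (nat_of_bool _)%:R).
    rewrite /quotient/= mul0r scale0r addr0 !subrr mul0r mulr0 ltxx.
    by apply/negbTE; rewrite -leNgt ltW.
  by have := steepE 0%N i.+1 isT; rewrite subn0 mul0r scale0r addr0.
have E2 : \sum_(i < n) (s * steep s (x + (i%:R / n%:R) *: z, ((n - i)%:R / n%:R) *: z)) =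
    \sum_(i < n) s * (S * ((n - i)%:R / n%:R) < a n - a i)%R%:R.
  by apply: eq_bigr => i _; congr (_ * (nat_of_bool _)%:R); rewrite steepE.
rewrite /= E1 E2; set T3 := \sum_(j < n) \sum_(i < j) G _ _.
have G0 k w : (0 < k)%N -> 0 <= G k w.
  by move=> k0; apply: le_trans (HG k w k0); rewrite le_max lexx.
have T30 : 0 <= T3.
  by apply: sumr_ge0 => j _; apply: sumr_ge0 => i _; rewrite G0// subn_gt0.
set T1 := \sum_(i < n) _; set T2 := \sum_(i < n) _.
have T10 : 0 <= T1 by apply: sumr_ge0 => i _; rewrite mulr_ge0 ?ler0n// ltW.
have T20 : 0 <= T2 by apply: sumr_ge0 => i _; rewrite mulr_ge0 ?ler0n// ltW.
(* the overlap in terms of the slope between the two points *)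
have pairs : \sum_(j < n) \sum_(i < j) Num.max 0 (S / n%:R - `|f j - f i|) <=
    N z / n%:R * T3.
  rewrite mulr_sumr; apply: ler_sum => j _; rewrite mulr_sumr; apply: ler_sum => i _.
  have ji : 0 < (j - i)%:R :> R by rewrite ltr0n subn_gt0.
  apply: le_trans (ler_wpM2l _ (HG _ _ _)); last 2 first.
  - by rewrite divr_ge0// ltW.
  - by rewrite subn_gt0.
  rewrite quoE// maxr_pMr ?divr_ge0 ?(ltW Nz0)// mulr0.
  have -> : f j - f i = (j - i)%:R / n%:R * N z *
      ((a j - a i) / ((j - i)%:R / n%:R * N z) - s).
    rewrite /f /S natrB ?(ltnW (ltn_ord i))//; field.
    rewrite -natrB ?(ltnW (ltn_ord i))//; by rewrite !gt_eqF.
  rewrite normrM (ger0_norm (_ : 0 <= (j - i)%:R / n%:R * N z)); last first.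
    by rewrite mulr_ge0 ?divr_ge0// ltW.
  rewrite ge_max !le_max lexx/=; apply/orP; right.
  rewrite /S le_eqVlt; apply/orP; left; apply/eqP; ring.
move: H0; rewrite (_ : \sum_(i < n) _ = (S / n%:R / s) * (T1 + T2)); last first.
  rewrite mulrDr /T1 /T2 !mulr_sumr -big_split/=; apply: eq_bigr => i _.
  rewrite mulrDr; congr (_ + _); rewrite mulrA divfK ?gt_eqF//.
move=> H; rewrite /capped_rise/= -an -a0.
have Sn : S / n%:R / s = N z / n%:R by rewrite /S; field; rewrite !gt_eqF.
have {}H : Num.min (a n - a 0%N) S <= N z / n%:R * (s + (T1 + (T2 + T3))).
  apply: (le_trans H); rewrite Sn [leRHS](_ : _ = S / n%:R + N z / n%:R * (T1 + T2) + N z / n%:R * T3).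
    by rewrite lerD2l.
  rewrite /S; ring.
have RHS0 : 0 <= s + (T1 + (T2 + T3)) by rewrite !addr_ge0// ltW.
apply: (@le_trans _ _ (N z / n%:R * (s + (T1 + (T2 + T3))))); last first.
  by apply: ler_wpM2r => //; rewrite ler_pM2r ?invr_gt0// ltW.
have NR0 : 0 <= N z / n%:R * (s + (T1 + (T2 + T3))).
  by rewrite mulr_ge0// divr_ge0// ltW.
have [h|h] := leP (a n - a 0%N) 0; first by rewrite ge_min NR0.
have S1 : 1 <= S by apply: le_trans srho _; rewrite ler_pM2l.
apply: le_trans H; rewrite le_min !ge_min lexx/= S1 orbT//.
Qed.

End chains.

Section chain_average.
Context (R : realType) (d : nat).
Local Notation E := 'rV[R]_d.
Local Notation mu := (@lebesgue_rV R d).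
Local Notation N := (@euclidean_norm R d).
Context (p : E) (r rho : R) (v : E -> R).
Local Notation average := (average p r rho).
Local Notation quotient := (quotient v).
Local Notation steep := (steep v).
Local Notation tangent := (tangent v).
Local Notation V0 := (fine (mu (@annulus R d rho))).
Context (r0 : 0 < r) (rho0 : 0 < rho) (mv : measurable_fun setT v).
Implicit Types (s : R) (q : E * E) (k n : nat).
Local Open Scope ereal_scope.

Lemma sum_gaps (H : nat -> \bar R) (j : nat) :
  \sum_(i < j) H (j - i)%N = \sum_(1 <= k < j.+1) H k.
Proof.
rewrite -(big_mkord xpredT (fun i => H (j - i)%N)) big_nat_rev/= big_add1/=.
rewrite big_nat [RHS]big_nat; apply: eq_bigr => i /andP[_ ij].
by rewrite add0n subKn.
Qed.

Lemma sum_initial (H : nat -> \bar R) (m j n : nat) : (forall k, 0 <= H k) ->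
  (m <= j)%N -> (j <= n)%N -> \sum_(m <= k < j) H k <= \sum_(m <= k < n) H k.
Proof.
move=> H0 mj jn; rewrite (big_cat_nat mj jn)/= leeDl//.
by apply: sume_ge0 => k _.
Qed.

(** The first and the second half of the exceptional steps, as well as the pairs of
points at distance [k |z| / n], are steps of the same cube, so that the integral
of [chain_pointwise] is controlled by averages that depend only on [k]. *)
Lemma chain_average (G : nat -> E * E -> R) (s : R) n :
  (0 < n)%N -> (1 <= s * rho)%R -> (forall k, measurable_fun setT (G k)) ->
  (forall k q, (0 < k)%N -> (Num.max 0 (s - k%:R * `|quotient q - s|) <= G k q)%R) ->
  (forall k q, (0 <= G k q)%R) ->
  \int[mu \x mu]_q (capped_rise v q * \1_(steps p r rho 1) q)%:E <=
  (2 * rho / n%:R)%:E * ((s * ((2 * r) ^+ d * V0))%:E +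
    (\sum_(k < n.+1) average (k%:R / n%:R)%R (fun q => s * steep s q)%R +
     (\sum_(k < n.+1) average (k%:R / n%:R)%R (fun q => s * steep s q)%R +
      \sum_(j < n) \sum_(1 <= k < n) average (k%:R / n%:R)%R (G k)))).
Proof.
move=> n0 srho mG HG G0.
have nR : (0 < n%:R :> R)%R by rewrite ltr0n.
have s0 : (0 < s)%R by rewrite -(pmulr_lgt0 _ rho0) (lt_le_trans _ srho).
have ms : measurable_fun setT (fun q => s * steep s q)%R.
  by apply: measurable_funM => //; exact: (measurable_steep mv s).
have ss0 q : (0 <= s * steep s q)%R by rewrite mulr_ge0// ltW.
have mst : measurable (steps p r rho 1) by exact: measurable_steps.
have c0 : (0 <= 2 * rho / n%:R)%R by rewrite divr_ge0// mulr_ge0// ltW.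
pose W q : R := \1_(steps p r rho 1) q.
have mW : measurable_fun setT W by apply: measurable_indic.
pose moved (g : E * E -> R) (a t : R) (q : E * E) : \bar R :=
  (g (q.1 + a *: q.2, t *: q.2) * W q)%R%:E.
have mmoved (g : E * E -> R) (a t : R) : measurable_fun setT g -> measurable_fun setT (moved g a t).
  move=> mg; apply/measurable_EFinP; apply: measurable_funM => //.
  exact: (measurableT_comp mg (measurableT_comp (measurable_fun_scale2 t) (measurable_fun_shear a))).
have moved0 (g : E * E -> R) (a t : R) : (forall q, (0 <= g q)%R) -> forall q, 0 <= moved g a t q.
  by move=> g0 q; rewrite lee_fin mulr_ge0.
have Imoved (g : E * E -> R) (a t : R) : (0 <= a)%R -> (0 <= t)%R -> (a + t <= 1)%R ->
    measurable_fun setT g -> (forall q, (0 <= g q)%R) ->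
    \int[mu \x mu]_q moved g a t q <= average t g.
  by move=> a0 t0 at1 mg g0; exact: shifted_average.
pose S1 q : \bar R := \sum_(i < n) moved (fun q => s * steep s q)%R 0%R (i%:R / n%:R)%R q.
pose S2 q : \bar R := \sum_(i < n)
  moved (fun q => s * steep s q)%R (i%:R / n%:R)%R ((n - i)%:R / n%:R)%R q.
pose S3 q : \bar R := \sum_(j < n) \sum_(i < j)
  moved (G (j - i)%N) (i%:R / n%:R)%R ((j - i)%:R / n%:R)%R q.
pose S0 q : \bar R := (s * W q)%:E.
have S00 q : 0 <= S0 q by rewrite lee_fin mulr_ge0// ltW.
have mS0 : measurable_fun setT S0 by apply/measurable_EFinP; exact: measurable_funM.
have S10 q : 0 <= S1 q by apply: sume_ge0 => i _; exact: moved0.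
have S20 q : 0 <= S2 q by apply: sume_ge0 => i _; exact: moved0.
have S30 q : 0 <= S3 q.
  by apply: sume_ge0 => j _; apply: sume_ge0 => i _; apply: moved0.
have mS1 : measurable_fun setT S1 by apply: emeasurable_sum => i; exact: mmoved.
have mS2 : measurable_fun setT S2 by apply: emeasurable_sum => i; exact: mmoved.
have mS3 : measurable_fun setT S3.
  by apply: emeasurable_sum => j; apply: emeasurable_sum => i; exact: mmoved.
have mS23 : measurable_fun setT (fun q => S2 q + S3 q) by exact: emeasurable_funD.
have mS123 : measurable_fun setT (fun q => S1 q + (S2 q + S3 q)) by exact: emeasurable_funD.
have mS : measurable_fun setT (fun q => S0 q + (S1 q + (S2 q + S3 q))).
  exact: emeasurable_funD.
have S230 q : 0 <= S2 q + S3 q by rewrite adde_ge0.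
have S1230 q : 0 <= S1 q + (S2 q + S3 q) by rewrite adde_ge0.
apply: (@le_trans _ _ (\int[mu \x mu]_q
    ((2 * rho / n%:R)%:E * (S0 q + (S1 q + (S2 q + S3 q)))))).
  apply: ge0_le_integral => //.
  - move=> q _; rewrite lee_fin mulr_ge0//.
    by case/andP : (capped_rise01 v q).
  - apply/measurable_EFinP; apply: measurable_funM => //.
    exact: measurable_capped_rise.
  - exact: measurable_funeM.
  move=> q _; rewrite /S0 /S1 /S2 /S3 /moved /W indicE.
  case: (boolP (q \in _)) => [/set_mem qs|_]; last first.
    rewrite mulr0 mule_ge0// !adde_ge0//.
    - by rewrite mulr0.
    - by apply: sume_ge0 => i _; rewrite mulr0.
    - by apply: sume_ge0 => i _; rewrite mulr0.
    - by apply: sume_ge0 => j _; apply: sume_ge0 => i _; rewrite mulr0.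
  have := chain_pointwise rho0 n0 srho qs HG.
  rewrite -lee_fin mulr1 => h; apply: (le_trans h).
  rewrite EFinM !EFinD -!sumEFin.
  apply: lee_wpmul2l; first by rewrite lee_fin.
  rewrite mulr1; apply: leeD => //; apply: leeD; last apply: leeD.
  - by apply: lee_sum => i _; rewrite scale0r addr0 mulr1.
  - by apply: lee_sum => i _; rewrite mulr1.
  - by apply: lee_sum => j _; rewrite -sumEFin; apply: lee_sum => i _; rewrite mulr1.
rewrite ge0_integralZl//; last by move=> q _; rewrite adde_ge0.
apply: lee_wpmul2l; first by rewrite lee_fin.
rewrite ge0_integralD// ge0_integralD// ge0_integralD//.
have av0 t : 0 <= average t (fun q => s * steep s q)%R by exact: average_ge0.
have avG k t : 0 <= average t (G k) by exact: average_ge0.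
apply: leeD; last apply: leeD; last apply: leeD.
- rewrite /S0 /W; under eq_integral do rewrite EFinM.
  rewrite ge0_integralZl//; last 2 first.
  - exact/measurable_EFinP.
  - by rewrite lee_fin ltW.
  rewrite [leRHS]EFinM; apply: lee_wpmul2l; first by rewrite lee_fin ltW.
  have := average1 p r0 rho0 1; apply: le_trans.
  by rewrite /average; under [leRHS]eq_integral do rewrite mul1r.
- rewrite ge0_integral_sum//; last 2 first.
  - by move=> i; exact: mmoved.
  - by move=> i q _; exact: moved0.
  rewrite big_ord_recr/=; apply: (@le_trans _ _
    (\sum_(k < n) average (k%:R / n%:R)%R (fun q => s * steep s q)%R)).
    apply: lee_sum => i _; apply: Imoved => //.
    by rewrite add0r ler_pdivrMr// mul1r ler_nat ltnW.
  by rewrite leeDl.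
- rewrite ge0_integral_sum//; last 2 first.
  - by move=> i; exact: mmoved.
  - by move=> i q _; exact: moved0.
  apply: (@le_trans _ _ (\sum_(i < n) average ((n - i)%:R / n%:R)%R (fun q => s * steep s q)%R)).
    apply: lee_sum => i _; apply: Imoved; rewrite ?divr_ge0//.
    by rewrite -mulrDl -natrD subnKC 1?ltnW// divff// gt_eqF.
  rewrite (sum_gaps (fun k => average (k%:R / n%:R)%R (fun q => s * steep s q)%R) n).
  by rewrite -(big_mkord xpredT (fun k => average (k%:R / n%:R)%R _)) [leRHS]big_ltn// leeDr.
- rewrite ge0_integral_sum//; last 2 first.
  - by move=> j; apply: emeasurable_sum => i; exact: mmoved.
  - by move=> j q _; apply: sume_ge0 => i _; exact: moved0.
  apply: lee_sum => j _.
  rewrite ge0_integral_sum//; last 2 first.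
  - by move=> i; exact: mmoved.
  - by move=> i q _; exact: moved0.
  apply: (@le_trans _ _ (\sum_(i < j) average ((j - i)%:R / n%:R)%R (G (j - i)%N))).
    apply: lee_sum => i _; apply: Imoved; rewrite ?divr_ge0//.
    rewrite -mulrDl -natrD subnKC 1?ltnW// ler_pdivrMr// mul1r ler_nat.
    exact: ltnW.
  rewrite (sum_gaps (fun k => average (k%:R / n%:R)%R (G k)) j).
  by apply: sum_initial.
Qed.

End chain_average.

(** * The weighted integral of the slopes is bounded *)

Lemma sume_const (R : realDomainType) (x : \bar R) (n : nat) : (0 <= x)%E ->
  (\sum_(i < n) x = n%:R%:E * x)%E.
Proof.
move=> x0; elim: n => [|n ih]; first by rewrite big_ord0 mul0e.
by rewrite big_ord_recr/= ih -(natr1 n) EFinD ge0_muleDl// mul1e.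
Qed.

Section weight_bound.
Context (R : realType) (d : nat).
Local Notation E := 'rV[R]_d.
Local Notation mu := (@lebesgue_rV R d).
Local Notation leb := (@lebesgue_measure R).
Local Notation N := (@euclidean_norm R d).
Context (p : E) (r rho C : R) (v : E -> R) (om : R -> R).
Local Notation B := (cube p r).
Local Notation average := (average p r rho).
Local Notation V0 := (fine (mu (@annulus R d rho))).
Local Notation quotient := (quotient v).
Local Notation steep := (steep v).
Local Notation tangent := (tangent v).
Local Notation energy := (energy p r v om).
Context (r0 : 0 < r) (rho0 : 0 < rho) (C0 : 0 <= C) (mv : measurable_fun setT v)
  (iv : mu.-integrable B (EFin \o v))
  (incr : forall z : E,
    (\int[mu]_x (`|v (x + z)%R - v x| * \1_(common_cube p r z) x)%:E <=
     (C * N z)%:E)%E)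
  (com : continuous om) (om_ge0 : forall y, 0 <= om y)
  (om_pos : forall y, 0 < y -> 0 < om y)
  (ienergy : (mu \x mu)%E.-integrable setT (EFin \o energy)).

Local Notation rise :=
  (\int[mu \x mu]_q (capped_rise v q * \1_(steps p r rho 1) q)%:E)%E.

Let W := (2 * r) ^+ d * V0.

Let W0 : 0 <= W.
Proof. by rewrite mulr_ge0 ?fine_ge0// exprn_ge0// mulr_ge0// ltW. Qed.

Lemma rise_le : (rise <= W%:E)%E.
Proof.
apply: le_trans (average1 p r0 rho0 1); apply: ge0_le_integral => //.
- by move=> q _; rewrite lee_fin mulr_ge0//; case/andP : (capped_rise01 v q).
- apply/measurable_EFinP; apply: measurable_funM; first exact: measurable_capped_rise.
  by apply: measurable_indic; exact: measurable_steps.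
- by apply: (@measurable_average_integrand _ _ p r rho 1 (fun=> 1)).
by move=> q _; rewrite lee_fin ler_wpM2r//; case/andP : (capped_rise01 v q).
Qed.

Let near_pair (s : R) q := Num.min (Num.max (quotient q) 0) s.

(** Two intervals of a chain of slope [s] overlap only if the slope of [v]
between their endpoints is close to [s], the more so the further apart they
are; for nearby intervals it is enough that this slope is positive. *)
Lemma overlap_le (s : R) (K k : nat) q : 0 <= s -> (0 < k)%N ->
  Num.max 0 (s - k%:R * `|quotient q - s|) <=
  (if (k < K)%N then near_pair s q else tangent s k q).
Proof.
move=> s0 k0; have k1 : 1 <= k%:R :> R by rewrite ler1n.
have k0' : 0 < k%:R :> R by rewrite ltr0n.
case: ifP => _.
  rewrite /near_pair ge_max !le_min !le_max lexx s0 orbT/=.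
  have h : `|quotient q - s| <= k%:R * `|quotient q - s| by rewrite ler_peMl.
  rewrite gerBl mulr_ge0// andbT.
  have := ler_norm (s - quotient q); rewrite distrC => h2.
  by apply/orP; left; lra.
rewrite ge_max tangent_ge0/= /tangent; case: ltP => h.
  by rewrite mulr1 gerBl mulr_ge0.
by rewrite mulr0 subr_le0 mulrC -ler_pdivrMr.
Qed.

(** The average rise [c] is split among the steep steps, the pairs of points of the
chain with fewer than [K] steps in between, and the other pairs. The constants
are chosen in the order [s0], [S], [K], [n]: for [s0] large the steep steps
account for at most [c / 8] at every slope above [s0]; given [S] and [K], for
[n] large the close pairs account for at most [c / 8], and the boundary term as
well. What remains, at least [c / 2], comes from the pairs whose slope is close
to [s], and its integral against [om s / s ^+ 2] is at most a multiple of the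
energy that does not depend on [S]. *)
Lemma slope_weight_bounded : (0 < rise)%E ->
  exists s0 A : R, 1 <= s0 /\ forall S, s0 <= S ->
    (\int[leb]_s (slope_weight om s0 S s)%:E <= A%:E)%E.
Proof.
move=> rise0; have rise_fin : rise \is a fin_num.
  by rewrite ge0_fin_numE ?ltW// (le_lt_trans rise_le)// ltry.
pose c := fine rise; have cE : rise = c%:E by rewrite fineK.
have c0 : 0 < c by rewrite -lte_fin -cE.
(* [2 * (2 rho / n) * (c / (32 rho) * n) = c / 8] *)
have eta0 : 0 < c / (32 * rho) by rewrite divr_gt0// mulr_gt0.
have [s1 [n1 [_ Hbad]]] := sum_average_steep rho0 C0 mv iv incr eta0.
pose s0 := Num.max s1 (Num.max 1 rho^-1).
have s0s1 : s1 <= s0 by rewrite le_max lexx.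
have s01 : 1 <= s0 by rewrite !le_max lexx orbT.
have s0rho : rho^-1 <= s0 by rewrite !le_max lexx !orbT.
have s00 : 0 < s0 := lt_le_trans ltr01 s01.
have int_energy0 : (0 <= \int[mu \x mu]_q (energy q)%:E)%E.
  by apply: integral_ge0 => q _; rewrite lee_fin energy_ge0.
have int_energy_fin : (\int[mu \x mu]_q (energy q)%:E)%E \is a fin_num.
  exact: integrable_fin_num ienergy.
pose e := fine (\int[mu \x mu]_q (energy q)%:E)%E.
have eE : (\int[mu \x mu]_q (energy q)%:E)%E = e%:E by rewrite fineK.
exists s0, (2 / c * (2 * rho * (16 * (2 * rho) ^+ d * e))); split => // S s0S.
have S0 : 0 <= S by rewrite (le_trans _ s0S)// ltW.
have [K K1 HK] := sum_average_tangent p r rho0 mv com om_ge0 om_pos S s00.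
have KR : 0 < K%:R :> R by rewrite ltr0n ltnW.
(* fewer than [K] lengths, each with weight [2 rho], contribute [c / 8] *)
have near0 : 0 < c / (16 * rho * K%:R) by rewrite divr_gt0// !mulr_gt0.
have [t0 t00 Hnear] :=
  average_slope_small r0 rho0 C0 mv incr com om_ge0 om_pos ienergy S0 near0.
pose n := maxn (maxn n1 K) (maxn (Num.truncn (K%:R / t0)).+1
  (Num.truncn (16 * rho * S * W / c)).+1).
have n1n : (n1 <= n)%N by rewrite /n -maxnA leq_maxl.
have Kn : (K <= n)%N by rewrite /n leq_max leq_maxr.
have tn : (Num.truncn (K%:R / t0) < n)%N by rewrite !leq_max leqnn !orbT.
have wn : (Num.truncn (16 * rho * S * W / c) < n)%N by rewrite !leq_max leqnn !orbT.
have n0 : (0 < n)%N := leq_trans (ltnW K1) Kn.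
have nR : 0 < n%:R :> R by rewrite ltr0n.
have {}tn : K%:R / t0 <= n%:R.
  by apply: le_trans (ltW (truncnS_gt _)) _; rewrite ler_nat.
have {}wn : 16 * rho * S * W / c <= n%:R.
  by apply: le_trans (ltW (truncnS_gt _)) _; rewrite ler_nat.
pose far s : \bar R := (\sum_(K <= k < n) average (k%:R / n%:R) (tangent s k))%E.
have far0 s : (0 <= far s)%E.
  by apply: sume_ge0 => k _; apply: average_ge0 => q; exact: tangent_ge0.
have main s : s0 <= s <= S -> ((c / 2)%:E <= (2 * rho)%:E * far s)%E.
  move=> /andP[s0s sS]; have sp : 0 < s := lt_le_trans s00 s0s.
  pose G k q := if (k < K)%N then near_pair s q else tangent s k q.
  have mnear : measurable_fun setT (near_pair s).
    apply: measurable_minr => //; apply: measurable_maxr => //.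
    exact: measurable_quotient.
  have near_ge0 q : 0 <= near_pair s q by rewrite le_min (ltW sp) le_max lexx orbT.
  have mG k : measurable_fun setT (G k).
    by rewrite /G; case: (k < K)%N => //; exact: measurable_tangent.
  have G0 k q : 0 <= G k q by rewrite /G; case: ifP => // _; exact: tangent_ge0.
  have srho : 1 <= s * rho by rewrite -ler_pdivrMr// mul1r (le_trans s0rho).
  have := chain_average p r0 rho0 mv n0 srho mG (fun k q => overlap_le K q (ltW sp)) G0.
  rewrite cE sume_const; last first.
    by apply: sume_ge0 => k _; exact: average_ge0.
  rewrite (big_cat_nat (ltnW K1) Kn)/=.
  set bad := (\sum_(k < n.+1) _)%E; set near := (\sum_(1 <= k < K) _)%E.
  have -> : (\sum_(K <= k < n) average (k%:R / n%:R) (G k) = far s)%E.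
    rewrite /far big_nat [RHS]big_nat; apply: eq_bigr => k /andP[Kk _].
    by rewrite /G ltnNge Kk.
  have Hb : (bad <= (c / (32 * rho) * n%:R)%:E)%E by apply: Hbad => //; exact: le_trans s0s.
  have Hn : (near <= (c / (16 * rho))%:E)%E.
    apply: (@le_trans _ _ (\sum_(1 <= k < K) (c / (16 * rho * K%:R))%:E)%E).
      rewrite /near big_nat [leRHS]big_nat; apply: lee_sum => k /andP[k1 kK].
      rewrite /G kK; apply: (@le_trans _ _ (average (k%:R / n%:R) (near_pair S))).
        apply: le_average => //.
          apply: measurable_minr => //; apply: measurable_maxr => //.
          exact: measurable_quotient.
        move=> q; rewrite /near_pair le_min ge_min lexx/=.
        by rewrite ge_min sS orbT.
      apply: Hnear; first by rewrite divr_gt0// ltr0n.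
      rewrite ler_pdivrMr//; apply: (@le_trans _ _ K%:R); first by rewrite ler_nat ltnW.
      by move: tn; rewrite ler_pdivrMr// mulrC.
    rewrite sumEFin lee_fin sumr_const_nat -[_ *+ (K - 1)]mulr_natr.
    apply: (@le_trans _ _ (c / (16 * rho * K%:R) * K%:R)).
      by rewrite ler_pM2l// ler_nat leq_subr.
    by rewrite le_eqVlt; apply/orP; left; apply/eqP; field; rewrite !gt_eqF.
  move=> H; have {}H : (c%:E <= (c / 2)%:E + (2 * rho)%:E * far s)%E.
    apply: (le_trans H); apply: (@le_trans _ _ ((2 * rho / n%:R)%:E *
        ((s * W)%:E + ((c / (32 * rho) * n%:R)%:E + ((c / (32 * rho) * n%:R)%:E +
         n%:R%:E * ((c / (16 * rho))%:E + far s)))))%E).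
      apply: lee_wpmul2l; first by rewrite lee_fin divr_ge0// mulr_ge0// ltW.
      do 3!(apply: leeD => //).
      by apply: lee_wpmul2l => //; exact: leeD.
    have nz0 : (0 <= n%:R%:E * far s)%E by rewrite mule_ge0.
    have cr x : 0 < x -> 0 <= c / (x * rho) by move=> x0; rewrite divr_ge0// ?mulr_ge0// ltW.
    rewrite (ge0_muleDr n%:R%:E) ?lee_fin ?cr// !addeA -!EFinD.
    rewrite ge0_muleDr//; last first.
      by rewrite lee_fin !addr_ge0// mulr_ge0// ?cr// ltW.
    rewrite muleA -!EFinM divfK ?gt_eqF//; apply: leeD => //.
    rewrite lee_fin.
    have -> : 2 * rho / n%:R * (s * W + c / (32 * rho) * n%:R +
        c / (32 * rho) * n%:R + n%:R * (c / (16 * rho))) =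
        2 * rho * (s * W) / n%:R + c / 4.
      by field; rewrite !gt_eqF.
    suff : 2 * rho * (s * W) / n%:R <= c / 8 by lra.
    rewrite ler_pdivrMr//; move: wn; rewrite ler_pdivrMr// => wn.
    have h1 : rho * (s * W) <= rho * (S * W).
      by rewrite ler_pM2l// ler_wpM2r.
    by lra.
  have : (c%:E - (c / 2)%:E <= (2 * rho)%:E * far s)%E by rewrite leeBlDl.
  by rewrite -EFinB (_ : c - c / 2 = c / 2)//; lra.
have := HK n n0; rewrite eE => HKn.
have far_le : ((c / 2)%:E * \int[leb]_s (slope_weight om s0 S s)%:E <=
    (2 * rho)%:E * (16 * (2 * rho) ^+ d * e)%:E)%E.
  rewrite [X in ((2 * rho)%:E * X)%E]EFinM; apply: le_trans (lee_wpmul2l _ HKn); last first.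
    by rewrite lee_fin mulr_ge0// ltW.
  have mw : measurable_fun setT (fun s : R => (slope_weight om s0 S s)%:E).
    by apply/measurable_EFinP; exact: measurable_slope_weight.
  have w0 s : (0 <= (slope_weight om s0 S s)%:E)%E by rewrite lee_fin slope_weight_ge0.
  have mwfar : measurable_fun setT (fun s => ((slope_weight om s0 S s)%:E * far s)%E).
    rewrite (_ : (fun s => _) = fun s => (\sum_(K <= k < n)
        ((slope_weight om s0 S s)%:E * average (k%:R / n%:R)%R (tangent s k)))%E).
      by apply: emeasurable_sum => k; exact: measurable_weighted_average.
    apply/funext => s; rewrite ge0_sume_distrr// => k _.
    by apply: average_ge0 => q; exact: tangent_ge0.
  have rho2 : (0 <= (2 * rho)%:E)%E by rewrite lee_fin mulr_ge0// ltW.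
  have c2 : (0 <= (c / 2)%:E)%E by rewrite lee_fin divr_ge0// ltW.
  rewrite -ge0_integralZl// -ge0_integralZl//; last first.
    by move=> s _; apply: mule_ge0 => //; exact: far0.
  apply: ge0_le_integral => //.
  - by move=> s _; exact: mule_ge0.
  - exact: measurable_funeM.
  - exact: measurable_funeM.
  move=> s _; have [sS|] := boolP (s \in `[s0, S]%classic); last first.
    by move=> sS; rewrite /slope_weight indicE (negbTE sS) mulr0 mul0e !mule0.
  rewrite muleC [leRHS]muleCA; apply: lee_wpmul2l => //; apply: main.
  by move: sS => /set_mem; rewrite /= in_itv.
have h2 : (0 <= (2 / c)%:E)%E by rewrite lee_fin divr_ge0// ltW.
have := lee_wpmul2l h2 far_le.
rewrite muleA -!EFinM (_ : 2 / c * (c / 2) = 1) ?mul1e//.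
by field; rewrite gt_eqF.
Qed.

End weight_bound.

(** * Divergence, and the energy as part of the functional *)

Section even_extension.
Context (R : realType) (omega : R -> R).

Lemma continuous_even_extension : {within `[0, +oo[, continuous omega} ->
  continuous (fun t : R => omega `|t|).
Proof.
move=> /subspace_continuousP c x.
have /c h : [set` `[0, +oo[] `|x| by rewrite /= in_itv/= normr_ge0.
apply: cvg_trans h => A /= [e e0 Ae].
have : \forall t \near x, ball `|x| e `|t|.
  by apply: (@norm_continuous _ R); exact: nbhsx_ballx.
by apply: filterS => t /Ae; apply; rewrite /= in_itv/= normr_ge0.
Qed.

End even_extension.

Section divergence.
Context (R : realType) (om : R -> R) (com : continuous om)
  (om_ge0 : forall y, 0 <= om y).
Local Notation leb := (@lebesgue_measure R).

Lemma slope_weight_finite (S : R) : 1 <= S ->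
  (\int[leb]_s (slope_weight om 1 S s)%:E < +oo)%E.
Proof.
move=> S1; have [y0 _ y0max] := EVT_max S1 (continuous_subspaceT com).
apply: (@le_lt_trans _ _ (\int[leb]_s ((om y0)%:E * (\1_(`[1, S]) s)%:E))%E); last first.
  rewrite ge0_integralZl//; last 2 first.
  - by apply/measurable_EFinP; apply: measurable_indic; exact: measurable_itv.
  - by rewrite lee_fin.
  have lS : (leb `[1%R, S]%classic < +oo)%E.
    by rewrite lebesgue_measure_itv/=; case: ifP; rewrite ?ltry.
  by rewrite integral_indic// setIT lte_mul_pinfty// lee_fin.
apply: ge0_le_integral => //.
- by move=> s _; rewrite lee_fin slope_weight_ge0.
- by apply/measurable_EFinP; exact: measurable_slope_weight.
- apply: measurable_funeM; apply/measurable_EFinP; apply: measurable_indic.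
  exact: measurable_itv.
move=> s _; rewrite -EFinM lee_fin /slope_weight [X in X * \1_ _ _]mulrC indicE.
have [/set_mem/= sS|_] := boolP (s \in _); last by rewrite !mulr0.
rewrite !mulr1 mulrC; have := sS; rewrite in_itv/= => /andP[s1 _].
rewrite ler_pdivrMr ?exprn_gt0 ?(lt_le_trans _ s1)//.
apply: le_trans (y0max _ sS) _; rewrite ler_peMr// exprn_ege1//.
Qed.

Lemma weight_integral_finite (s0 A : R) : 1 <= s0 ->
  (forall S, s0 <= S -> (\int[leb]_s (slope_weight om s0 S s)%:E <= A%:E)%E) ->
  (\int[leb]_(t in `[1%R, +oo[) (om t / t ^+ 2)%:E < +oo)%E.
Proof.
move=> s01 H; pose f (t : R) := (om t / t ^+ 2)%:E.
have f0 t : (0 <= f t)%E by rewrite lee_fin mulr_ge0// invr_ge0 sqr_ge0.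
have mf : measurable_fun setT f.
  apply/measurable_EFinP; apply: measurable_funM; first exact: continuous_measurable_fun.
  by apply: (measurableT_comp (@measurable_inv R)); exact: measurable_funX.
pose F (i : nat) : set R := `[1, s0 + i%:R]%classic.
have mF i : measurable (F i) by exact: measurable_itv.
have ndF : nondecreasing_seq F.
  move=> m n mn; apply/subsetPset => x; rewrite /F /= !in_itv/= => /andP[-> h] /=.
  by rewrite (le_trans h)// lerD2l ler_nat.
have UF : \bigcup_i F i = `[1, +oo[%classic.
  apply/seteqP; split => [x [i _]|x]; rewrite /F /= !in_itv/= andbT; first by case/andP.
  move=> x1; exists (Num.truncn x).+1 => //=; rewrite in_itv/= x1/=.
  by rewrite (le_trans (ltW (truncnS_gt x)))// lerDr (le_trans _ s01).
have cvgF : (\int[leb]_(x in F i) f x @[i --> \oo] -->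
    \int[leb]_(x in \bigcup_i F i) f x)%E.
  apply: ge0_nondecreasing_set_cvg_integral => //.
  by move=> i; exact: measurable_funTS.
rewrite UF in cvgF.
pose b : \bar R := (\int[leb]_s (slope_weight om 1 s0 s)%:E)%E.
have boo : (b + A%:E < +oo)%E by rewrite lte_add_pinfty ?ltry// slope_weight_finite.
apply: le_lt_trans boo.
apply: cvge_le cvgF; apply: nearW => i.
rewrite integral_mkcond.
apply: (@le_trans _ _ (\int[leb]_s ((slope_weight om 1 s0 s)%:E +
    (slope_weight om s0 (s0 + i%:R) s)%:E))%E).
  apply: ge0_le_integral => //.
  - by move=> s _; apply: erestrict_ge0.
  - exact/(measurable_restrictT _ (mF i))/measurable_funTS.
  - by apply: emeasurable_funD; apply/measurable_EFinP; exact: measurable_slope_weight.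
  move=> s _; rewrite patchE -EFinD; case: ifPn => [/set_mem|_]; last first.
    by rewrite lee_fin addr_ge0 ?slope_weight_ge0.
  rewrite /F/= in_itv/= => /andP[h1 h2]; rewrite /f lee_fin.
  have [h|h] := leP s s0.
    rewrite [slope_weight om 1 s0 s]/slope_weight indicE mem_set/=; last by rewrite in_itv/= h1.
    by rewrite mulr1 lerDl slope_weight_ge0.
  rewrite [slope_weight om s0 _ s]/slope_weight indicE mem_set/=; last by rewrite in_itv/= (ltW h).
  by rewrite mulr1 lerDr slope_weight_ge0.
rewrite ge0_integralD//.
- by apply: leeD => //; apply: H; rewrite lerDl.
- by move=> s _; rewrite lee_fin slope_weight_ge0.
- by apply/measurable_EFinP; exact: measurable_slope_weight.
- by move=> s _; rewrite lee_fin slope_weight_ge0.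
- by apply/measurable_EFinP; exact: measurable_slope_weight.
Qed.

End divergence.

Section energy_of_functional.
Context (R : realType) (d : nat).
Local Notation E := 'rV[R]_d.
Local Notation mu := (@lebesgue_rV R d).
Local Notation N := (@euclidean_norm R d).
Context (omega : R -> R) (Omega : set E) (u v : E -> R) (M : set E) (p : E) (r : R).
Local Notation om := (fun t : R => omega `|t|).

(** The energy of slopes inside the cube is part of the functional, up to the
change of variables [y = x + z] and to a null set of pairs. *)
Lemma energy_le_functional :
  continuous om -> (forall t, 0 <= t -> 0 <= omega t) ->
  measurable_fun setT v -> measurable M -> mu M = 0%E ->
  (forall x, Omega x -> ~ M x -> u x = v x) -> cube p r `<=` Omega ->
  (\int[mu \x mu]_q (energy p r v om q)%:E <= F_functional omega u Omega)%E.
Proof.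
move=> com omega0 mv mM M0 uv pO.
pose g (w : E * E) : R := om ((v w.2 - v w.1) / N (w.2 - w.1)) *
  \1_(cube p r `*` cube p r) w / N (w.2 - w.1) ^+ d.
have g0 w : 0 <= g w.
  by rewrite !mulr_ge0// ?omega0// invr_ge0 exprn_ge0// euclidean_norm_ge0.
have mN : measurable_fun setT (fun w : E * E => N (w.2 - w.1)).
  apply: (measurableT_comp (@measurable_euclidean_norm R d)).
  rewrite (_ : (fun w => _) = fun w : E * E => w.2 + (-1) *: w.1).
    by apply: measurable_addZ; [exact: measurable_snd|exact: measurable_fst].
  by apply/funext => w; rewrite scaleN1r.
have mg : measurable_fun setT g.
  apply: measurable_funM; last first.
    by apply: (measurableT_comp (@measurable_inv R)); exact: measurable_funX.
  apply: measurable_funM; last first.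
    by apply: measurable_indic; apply: measurableX; exact: measurable_cube.
  apply: (measurableT_comp (continuous_measurable_fun com)).
  apply: measurable_funM; last exact: (measurableT_comp (@measurable_inv R)).
  by apply: measurable_funB; apply: (measurableT_comp mv);
    [exact: measurable_snd|exact: measurable_fst].
have -> : (\int[mu \x mu]_q (energy p r v om q)%:E =
    \int[mu \x mu]_q (g (q.1, q.1 + q.2))%:E)%E.
  apply: eq_integral => q _; congr EFin.
  by rewrite /g /energy /quotient/= (addrC q.1) addrK (addrC q.2).
rewrite (@ge0_integral_shift2 _ _ (fun w => (g w)%:E)); last 2 first.
- exact/measurable_EFinP.
- by move=> w; rewrite lee_fin.
have -> : (\int[mu \x mu]_w (g w)%:E =
    \int[mu \x mu]_(w in Omega `*` Omega) (g w)%:E)%E.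
  rewrite [RHS]integral_mkcond; apply: eq_integral => w _; rewrite patchE.
  case: ifPn => // /negP wO; rewrite /g indicE memNset ?mulr0 ?mul0r//.
  by move=> [h1 h2]; apply: wO; rewrite inE; split; exact: pO.
pose M2 := M `*` setT `|` setT `*` M.
have mM1 : measurable (M `*` (setT : set E)) by exact: measurableX.
have mM1' : measurable ((setT : set E) `*` M) by exact: measurableX.
have mM2 : measurable M2 by exact: measurableU.
have M20 : (mu \x mu)%E M2 = 0%E.
  apply/eqP; rewrite eq_le measure_ge0 andbT; apply: le_trans (measureU2 _ mM1 mM1') _.
  have h1 : (mu \x mu)%E (M `*` setT) = 0%E.
    rewrite product_measure1E// -[RHS](mul0e (mu setT)); congr (_ * _)%E; exact: M0.
  have h2 : (mu \x mu)%E (setT `*` M) = 0%E.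
    rewrite product_measure1E// -[RHS](mule0 (mu setT)); congr (_ * _)%E; exact: M0.
  by rewrite -[leRHS]adde0; apply: leeD; rewrite le_eqVlt; apply/orP; left; apply/eqP.
apply: (le_integral_off_null mM2 M20).
- by move=> w _; rewrite lee_fin.
- move=> w _; rewrite lee_fin mulr_ge0// ?invr_ge0 ?exprn_ge0// ?euclidean_norm_ge0//.
  by apply: omega0; rewrite mulr_ge0// invr_ge0 euclidean_norm_ge0.
move=> w [w1 w2] Mw; rewrite lee_fin /g.
have M1 : ~ M w.1 by move=> Mw1; apply: Mw; left.
have M2' : ~ M w.2 by move=> Mw2; apply: Mw; right.
rewrite !uv//.
rewrite normrM normfV (ger0_norm (euclidean_norm_ge0 _)).
apply: ler_wpM2r; first by rewrite invr_ge0 exprn_ge0// euclidean_norm_ge0.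
rewrite ler_piMr// ?indicE ?lern1 ?leq_b1//.
by apply: omega0; rewrite mulr_ge0// invr_ge0 euclidean_norm_ge0.
Qed.

End energy_of_functional.

Theorem corollary1p4 (R : realType) (omega : R -> R)
  (omega_ge0 : forall t : R, 0 <= t -> 0 <= omega t)
  (omega_continuous : {within `[0, +oo[, continuous omega})
  (omega_gt0 : forall t : R, 0 < t -> 0 < omega t)
  (omega_divergent :
    (\int[lebesgue_measure]_(t in `[1%R, +oo[) (omega t / t ^+ 2)%:E = +oo)%E)
  (d : nat) (d_gt0 : (0 < d)%N)
  (Omega : set 'rV[R]_d) (Omega_open : open Omega)
  (Omega_connected : connected Omega)
  (u : 'rV[R]_d -> R) (u_BV : BV Omega u)
  (u_nonconstant : ~ essentially_constant Omega u) :
  F_functional omega u Omega = +oo%E.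
Proof.
pose om (t : R) := omega `|t|.
have com : continuous om by exact: continuous_even_extension.
have om_ge0 y : 0 <= om y by exact: omega_ge0.
have om_pos y : 0 < y -> 0 < om y by move=> y0; rewrite /om gtr0_norm// omega_gt0.
have [[u_meas u_int] _] := u_BV.
have [v [M [mM M0 mv uv]]] := lebesgue_measurable_borel u_meas.
have [p [r [r0 pO nc_u]]] :=
  nonconstant_on_some_cube Omega_open Omega_connected u_nonconstant.
have pO' : cube p r `<=` Omega by move=> x /cube_subset_closed; exact: pO.
have nc_v : ~ exists c, {ae lebesgue_rV, forall x, cube p r x -> v x = c}.
  move=> [c vc]; apply: nc_u; exists c.
  have aeM : {ae lebesgue_rV, forall x, ~ M x}.
    by exists M; split => // x /= /contrapT.
  apply: filterS2 vc aeM => x vc Mx xp.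
  by rewrite uv ?vc//; exact: pO'.
have [rho rho0 rise0] := nonconstant_rise mv r0 nc_v.
have [C C0 incr] := bv_increments Omega_open u_BV pO mM M0 mv uv.
have iv := integrable_representative Omega_open u_int pO mM M0 mv uv.
apply/eqP; rewrite eq_le leey/= leNgt; apply/negP => Foo.
have ienergy : (lebesgue_rV \x lebesgue_rV)%E.-integrable setT
    (EFin \o energy p r v om).
  apply/integrableP; split; first by apply/measurable_EFinP; exact: measurable_energy.
  apply: le_lt_trans Foo.
  have := energy_le_functional com omega_ge0 mv mM M0 uv pO'.
  apply: le_trans; rewrite le_eqVlt; apply/orP; left; apply/eqP.
  by apply: eq_integral => q _; rewrite /= ger0_norm// energy_ge0.
have [s0 [A [s01 HA]]] := slope_weight_bounded r0 rho0 C0 mv iv incr com om_ge0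
  om_pos ienergy rise0.
have := weight_integral_finite com om_ge0 s01 HA.
suff -> : (\int[lebesgue_measure]_(t in `[1%R, +oo[) (om t / t ^+ 2)%:E = +oo)%E.
  by rewrite ltxx.
rewrite -omega_divergent; apply: eq_integral => t; rewrite inE/= in_itv/= andbT => t1.
by rewrite /om ger0_norm// (le_trans ler01).
Qed.
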